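(* Consider the mathematical program with variational inequality constraints $$\text{(MPVI)}\qquad\min_{x,y} f(x,y)\quad\text{s.t.}\quad y\in\Gamma(x),\ \ \langle F(x,y),y'-y\rangle\ge0\quad\forall y'\in\Gamma(x),$$ with $\Gamma(x):=\{y\mid\psi(x,y)\in P\}$ and $P:=\mathbb{R}^l_-$, where $f:\mathbb{R}^{n_1}\times\mathbb{R}^{n_2}\to\mathbb{R}$, $F:\mathbb{R}^{n_1}\times\mathbb{R}^{n_2}\to\mathbb{R}^{n_2}$ and $\psi:\mathbb{R}^{n_1}\times\mathbb{R}^{n_2}\to\mathbb{R}^l$ are twice continuously differentiable and $\nabla_y\psi$ is twice continuously differentiable as well. Let $\bar z:=(\bar x,\bar y)$ be a feasible point of (MPVI). Assume that $\psi(x,y)$ is (componentwise) convex in the variable $y$ and that $$\nabla_y\psi(\bar z)^Td^*=0,\ d^*\in\big(N_P(\psi(\bar z))\big)^+\ \Rightarrow\ d^*=0.$$ Then there exists a unique $\eta^*\in N_P(\psi(\bar z))$ such that $0=F(\bar z)+\nabla_y\psi(\bar z)^T\eta^*$. Consider directions $d\in\mathbb{R}^{n_1}\times\mathbb{R}^{n_2}$ which, together with some $e^*\in\mathbb{R}^l$, satisfy $$\nabla f(\bar z)d\le0,\qquad 0=\nabla[F+\nabla_y\psi^T\eta^*](\bar z)d+\nabla_y\psi(\bar z)^Te^*,\qquad(\nabla\psi(\bar z)d,e^* )\in T_{\mathrm{gph}\,N_P}(\psi(\bar z),\eta^* ).\qquad(\ast)$$ (i) Let $\bar z$ be a local optimal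 solution of (MPVI) and let $d$ (with $e^*$) satisfy $(\ast)$. Suppose that for all $(\lambda,\tau^* )\in\mathbb{R}^{n_2}\times\mathbb{R}^l$ $$\left.\begin{array}{l}\nabla\big(F+\nabla_y\psi^T\eta^*\big)(\bar z)^T\lambda-\nabla\psi(\bar z)^T\tau^*=0,\\(\tau^*,\nabla_y\psi(\bar z)\lambda)\in N_{\mathrm{gph}\,N_P}\big((\psi(\bar z),\eta^* );(\nabla\psi(\bar z)d,e^* )\big)\end{array}\right\}\Longrightarrow\lambda=0.$$ Then there exist multipliers $\lambda\in\mathbb{R}^{n_2}$, $\tau^*\in\mathbb{R}^l$ with $(\tau^*,\nabla_y\psi(\bar z)\lambda)\in N_{\mathrm{gph}\,N_P}\big((\psi(\bar z),\eta^* );(\nabla\psi(\bar z)d,e^* )\big)$ such that the first-order condition $$\nabla f(\bar z)-\nabla\big(F+\nabla_y\psi^T\eta^*\big)(\bar z)^T\lambda+\nabla\psi(\bar z)^T\tau^*=0$$ (with $\nabla f(\bar z)$ understood as a column vector) and the second-order condition $$\nabla^2f(\bar z)(d,d)-\big\langle\lambda,\nabla^2\big(F+\nabla_y\psi^T\eta^*\big)(\bar z)(d,d)+2\big(\nabla(\nabla_y\psi)(\bar z)d\big)^Te^*\big\rangle+\langle\tau^*,\nabla^2\psi(\bar z)(d,d)\rangle\ge0$$ hold. (ii) Suppose that for every nonzero $d$ satisfying $(\ast)$ (with $e^*$) there is $(\alpha,\lambda,\tau^* )\in\mathbb{R}\times\mathbb{R}^{n_2}\times\mathbb{R}^l$,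 not all equal to zero, satisfying $\alpha\ge0$, $$\alpha\nabla f(\bar z)-\nabla\big(F+\nabla_y\psi^T\eta^*\big)(\bar z)^T\lambda+\nabla\psi(\bar z)^T\tau^*=0,\qquad(\tau^*,\nabla_y\psi(\bar z)\lambda)\in\widehat N_{T_{\mathrm{gph}\,N_P}(\psi(\bar z),\eta^* )}(\nabla\psi(\bar z)d,e^* ),$$ and $$\alpha\nabla^2f(\bar z)(d,d)-\big\langle\lambda,\nabla^2\big(F+\nabla_y\psi^T\eta^*\big)(\bar z)(d,d)+2\big(\nabla(\nabla_y\psi)(\bar z)d\big)^Te^*\big\rangle+\langle\tau^*,\nabla^2\psi(\bar z)(d,d)\rangle>0.$$ Then $\bar z$ is an essential local minimizer of second order for (MPVI).
   Context: $N_P$ is the normal cone mapping of convex analysis of $P=\mathbb{R}^l_-$ (empty outside $P$), and $\mathrm{gph}\,N_P=\{(p,p^* )\mid p^*\in N_P(p)\}$. For a set $C$, $C^+:=\mathrm{span}(C-C)$. For a closed set $C$ and $z\in C$: tangent cone $T_C(z)=\{u\mid\exists t_k\downarrow0,u_k\to u: z+t_ku_k\in C\}$; regular (Fréchet) normal cone $\widehat N_C(z)=\{v\mid\langle v,z'-z\rangle\le o(\|z'-z\|)\ \forall z'\in C\}$ (empty if $z\notin C$); directional limiting normal cone $N_C(z;u)=\{v\mid\exists t_k\downarrow0,u_k\to u,v_k\to v: v_k\in\widehat N_C(z+t_ku_k)\}$. Derivatives: $\nabla$ without subscript is the Jacobian with respect to the full variable $z=(x,y)$; $\nabla_y\psi(z)\in\mathbb{R}^{l\times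 n_2}$ is the partial Jacobian in $y$; $\nabla_y\psi^T\eta^*$ is the map $z\mapsto\nabla_y\psi(z)^T\eta^*$ with $\eta^*$ fixed; $\nabla(\nabla_y\psi)(\bar z)d\in\mathbb{R}^{l\times n_2}$ is the directional derivative of $z\mapsto\nabla_y\psi(z)$ at $\bar z$ along $d$; $\nabla^2\phi(z)(d,d)$ is the vector with components $d^T\nabla^2\phi_i(z)d$. Essential local minimizer of second order: for a problem $\min f(z)$ s.t. $\varphi(z)\in\Omega$, a point $\bar z$ is an essential local minimizer of second order if there exist $\beta,\delta>0$ with $\max\{f(z)-f(\bar z),\mathrm{dist}(\varphi(z),\Omega)\}\ge\beta\|z-\bar z\|^2$ for all $z$ in the ball of radius $\delta$ around $\bar z$. Here (MPVI) is regarded as a problem of this form through its reformulation $\min f(z)$ s.t. $0\in F(z)+\nabla_y\psi(z)^TN_P(\psi(z))$, i.e. with $\varphi(z):=(z,-F(z))$ and $\Omega:=\{(z,\nabla_y\psi(z)^T\eta)\mid(\psi(z),\eta)\in\mathrm{gph}\,N_P\}$. *)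

(* Defs.v *)
From HB Require Import structures.
From mathcomp Require Import all_boot all_order all_algebra.
From mathcomp Require Import all_classical all_reals all_analysis.

Set Implicit Arguments.
Unset Strict Implicit.
Unset Printing Implicit Defensive.

Import Order.TTheory GRing.Theory Num.Theory.
Import numFieldNormedType.Exports.

Local Open Scope classical_set_scope.
Local Open Scope ring_scope.

(* Vectors are columns and a pair (a, b) in R^p x R^q is encoded as
   col_mx a b : 'cV_(p + q), so that Jacobians act on the left.  The library
   norm on matrices is the sup norm; distances and normal cones below are
   taken with respect to the Euclidean structure defined here. *)

Section Euclidean.
Context {R : realType}.

Definition dot m (u v : 'cV[R]_m) : R := \sum_i u i 0 * v i 0.

Definition enorm m (u : 'cV[R]_m) : R := Num.sqrt (dot u u).

(* The infimum is junk when C is empty; C is nonempty wherever this is used. *)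
Definition dist m (z : 'cV[R]_m) (C : set 'cV[R]_m) : R :=
  inf [set enorm (z - c) | c in C].

End Euclidean.

Section Calculus.
Context {R : realType}.

(* k times continuously differentiable: since the domain has finite dimension,
   z |-> 'd h z is C^k iff every z |-> 'D_v h z is. *)
Fixpoint Ck (k : nat) n (W : normedModType R) (h : 'cV[R]_n -> W) : Prop :=
  if k is k'.+1 then
    (forall z, differentiable h z) /\ (forall v, Ck k' (fun z => 'D_v h z))
  else continuous h.

Definition basis_vec n (j : 'I_n) : 'cV[R]_n := delta_mx j 0.

Definition grad n (f : 'cV[R]_n -> R) (z : 'cV[R]_n) : 'cV[R]_n :=
  \col_j ('D_(basis_vec j) f z : R).

Definition jac n m (h : 'cV[R]_n -> 'cV[R]_m) (z : 'cV[R]_n) : 'M[R]_(m, n) :=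
  \matrix_(i, j) 'D_(basis_vec j) h z i 0.

Definition hess n (f : 'cV[R]_n -> R) (z : 'cV[R]_n) : 'M[R]_n :=
  \matrix_(i, j) ('D_(basis_vec i) (fun z' => 'D_(basis_vec j) f z') z : R).

(* nabla^2 f (z) (d, d) for a scalar function, resp. a vector function. *)
Definition d2 n (f : 'cV[R]_n -> R) (z d : 'cV[R]_n) : R :=
  dot d (hess f z *m d).

Definition d2v n m (h : 'cV[R]_n -> 'cV[R]_m) (z d : 'cV[R]_n) : 'cV[R]_m :=
  \col_i d2 (fun z' => h z' i 0) z d.

(* Partial Jacobian with respect to y, for z = (x, y). *)
Definition jac_y n1 n2 m (h : 'cV[R]_(n1 + n2) -> 'cV[R]_m)
    (z : 'cV[R]_(n1 + n2)) : 'M[R]_(m, n2) :=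
  rsubmx (jac h z).

End Calculus.

Section VariationalAnalysis.
Context {R : realType}.

Definition lin_span m (S : set 'cV[R]_m) : set 'cV[R]_m :=
  [set v | exists2 s : seq 'cV[R]_m,
             (forall c, c \in s -> S c) & v \in span s].

(* C^+ = span (C - C). *)
Definition plus_span m (C : set 'cV[R]_m) : set 'cV[R]_m :=
  lin_span [set a - b | a in C & b in C].

(* Normal cone of convex analysis. *)
Definition normal_cone m (C : set 'cV[R]_m) (p : 'cV[R]_m) : set 'cV[R]_m :=
  [set q | C p /\ forall p', C p' -> dot q (p' - p) <= 0].

Definition graph m p (M : 'cV[R]_m -> set 'cV[R]_p) : set 'cV[R]_(m + p) :=
  [set w | M (usubmx w) (dsubmx w)].

Definition tangent_cone m (C : set 'cV[R]_m) (z : 'cV[R]_m) : set 'cV[R]_m :=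
  [set u | exists (t : nat -> R) (u_ : nat -> 'cV[R]_m),
    [/\ forall k, 0 < t k, t @ \oo --> 0, u_ @ \oo --> u
      & forall k, C (z + t k *: u_ k)]].

Definition regular_normal_cone m (C : set 'cV[R]_m) (z : 'cV[R]_m) :
    set 'cV[R]_m :=
  [set v | C z /\ forall eps, 0 < eps ->
    \forall z' \near z, C z' -> dot v (z' - z) <= eps * enorm (z' - z)].

Definition dir_normal_cone m (C : set 'cV[R]_m) (z u : 'cV[R]_m) :
    set 'cV[R]_m :=
  [set v | exists (t : nat -> R) (u_ v_ : nat -> 'cV[R]_m),
    [/\ forall k, 0 < t k, t @ \oo --> 0, u_ @ \oo --> u, v_ @ \oo --> v
      & forall k, regular_normal_cone C (z + t k *: u_ k) (v_ k)]].

Definition local_minimizer m (f : 'cV[R]_m -> R) (S : set 'cV[R]_m)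
    (z : 'cV[R]_m) : Prop :=
  S z /\ \forall z' \near z, S z' -> f z <= f z'.

(* For the problem min f(z) s.t. phi(z) in Omega. *)
Definition essential_local_minimizer2 m p (f : 'cV[R]_m -> R)
    (phi : 'cV[R]_m -> 'cV[R]_p) (Omega : set 'cV[R]_p) (zbar : 'cV[R]_m) :
    Prop :=
  exists beta delta : R, [/\ 0 < beta, 0 < delta
    & forall z, enorm (z - zbar) <= delta ->
        beta * enorm (z - zbar) ^+ 2
        <= Num.max (f z - f zbar) (dist (phi z) Omega)].

End VariationalAnalysis.

Section MPVI.
Context {R : realType} {n1 n2 l : nat}.
Implicit Types (f : 'cV[R]_(n1 + n2) -> R) (F : 'cV[R]_(n1 + n2) -> 'cV[R]_n2)
  (psi : 'cV[R]_(n1 + n2) -> 'cV[R]_l) (z d : 'cV[R]_(n1 + n2))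
  (eta e : 'cV[R]_l).

Definition nonpos_orthant m : set 'cV[R]_m := [set p | forall i, p i 0 <= 0].

Definition N_P m : 'cV[R]_m -> set 'cV[R]_m := normal_cone (@nonpos_orthant m).

Definition Gamma psi (x : 'cV[R]_n1) : set 'cV[R]_n2 :=
  [set y | nonpos_orthant (psi (col_mx x y))].

Definition MPVI_feasible F psi : set 'cV[R]_(n1 + n2) :=
  [set z | Gamma psi (usubmx z) (dsubmx z) /\
    forall y', Gamma psi (usubmx z) y' -> 0 <= dot (F z) (y' - dsubmx z)].

(* MPVI rewritten as min f(z) s.t. MPVI_phi F z \in MPVI_Omega psi, through
   0 \in F(z) + (nabla_y psi(z))^T N_P(psi(z)). *)
Definition MPVI_phi F z : 'cV[R]_((n1 + n2) + n2) := col_mx z (- F z).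

Definition MPVI_Omega psi : set 'cV[R]_((n1 + n2) + n2) :=
  [set w | exists z eta, graph (@N_P l) (col_mx (psi z) eta) /\
                         w = col_mx z ((jac_y psi z)^T *m eta)].

(* F + nabla_y psi^T eta, with eta fixed. *)
Definition F_eta F psi eta z : 'cV[R]_n2 := F z + (jac_y psi z)^T *m eta.

Definition critical_direction f F psi z eta d e : Prop :=
  [/\ dot (grad f z) d <= 0,
      0 = jac (F_eta F psi eta) z *m d + (jac_y psi z)^T *m e
    & tangent_cone (graph (@N_P l)) (col_mx (psi z) eta)
        (col_mx (jac psi z *m d) e)].

(* nabla^2 (F + nabla_y psi^T eta)(z)(d,d) + 2 (nabla (nabla_y psi)(z) d)^T e;
   'D_d (jac_y psi) z is the directional derivative of the matrix-valued map
   jac_y psi. *)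
Definition curvature F psi z eta d e : 'cV[R]_n2 :=
  d2v (F_eta F psi eta) z d + 2%:R *: (('D_d (jac_y psi) z)^T *m e).

End MPVI.

(* Main.v *)
Require Import Defs.
From HB Require Import structures.
From mathcomp Require Import all_boot all_order all_algebra.
From mathcomp Require Import all_classical all_reals all_analysis.
From mathcomp Require Import ring lra.
Import Order.TTheory GRing.Theory Num.Theory.
Import numFieldNormedType.Exports.
Local Open Scope classical_set_scope.
Local Open Scope ring_scope.

Set Implicit Arguments.
Unset Strict Implicit.
Unset Printing Implicit Defensive.

(* By convexity and the nondegeneracy assumption, feasibility of z near zbar
   amounts to H(z, eta) := F(z) + nabla_y psi(z)^T eta = 0 with (psi(z), eta) in
   gph N_P for some eta, and eta stays close to the multiplier of zbar.  So both
   parts are statements about the map (f, H, psi, id) in the variables (z, eta)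
   and the closed polyhedral set ]-oo, f(zbar)] x {0} x gph N_P.

   Necessity: along the curve u + t x + t^2 v, with x = (d, e), the rescaled
   second-order remainder of this map avoids a t-dependent slice of the set.  A
   penalised projection of the remainder onto that slice yields a unit proximal
   normal that almost annihilates the derivative and is almost nonnegative on
   the second derivative; as t -> 0 this becomes a directional normal.  The
   constraint qualification rules out alpha = 0.

   Sufficiency: a sequence violating quadratic growth yields in the limit of the
   difference quotients a nonzero critical direction, and the second-order
   expansion paired with its multiplier is eventually both positive and
   nonpositive. *)

(** * Euclidean structure and compactness *)

(** With [eta] as a variable, the mixed second derivative of the product of [jac_y psi] and [eta] is
    exactly the summand with factor 2 in [curvature]. The obstacle in the necessity part is that no
    constraint qualification is available for the lifted system: a second-order correction [v]
    cannot be solved for, and no a priori bound on [v] exists. The penalty supplies one: with slope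
    of order e, a ball of radius of order 1/e contains the minimiser, and since t is chosen after
    this radius, all Taylor errors are uniform on the ball. The sign of the second-order term
    combines two facts: the normal is nonnegative on the projected point, because slices of a
    polyhedral union can be shrunk towards 0, and it is nonpositive on the derivative along [v],
    because of the penalty. In the sufficiency part the distance to [MPVI_Omega] is only an infimum
    over pairs, so multipliers belong to a point near the one violating growth; Lipschitz bounds
    move the estimates there. The nondegeneracy assumption makes these multipliers converge and
    excludes limit directions of the form (0, e). *)

Section EuclideanSpace.
Context {R : realType}.

Lemma dotE m (u v : 'cV[R]_m) : dot u v = (u^T *m v) 0 0.
Proof. by rewrite !mxE; apply: eq_bigr => i _; rewrite !mxE. Qed.

Lemma dotC m (u v : 'cV[R]_m) : dot u v = dot v u.
Proof. by apply: eq_bigr => i _; rewrite mulrC. Qed.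

Lemma dotDr m (u v w : 'cV[R]_m) : dot u (v + w) = dot u v + dot u w.
Proof. by rewrite !dotE mulmxDr mxE. Qed.

Lemma dotDl m (u v w : 'cV[R]_m) : dot (v + w) u = dot v u + dot w u.
Proof. by rewrite ![dot _ u]dotC dotDr. Qed.

Lemma dotZr m a (u v : 'cV[R]_m) : dot u (a *: v) = a * dot u v.
Proof. by rewrite !dotE -scalemxAr mxE. Qed.

Lemma dotZl m a (u v : 'cV[R]_m) : dot (a *: v) u = a * dot v u.
Proof. by rewrite ![dot _ u]dotC dotZr. Qed.

Lemma dotNr m (u v : 'cV[R]_m) : dot u (- v) = - dot u v.
Proof. by rewrite -scaleN1r dotZr mulN1r. Qed.

Lemma dotNl m (u v : 'cV[R]_m) : dot (- v) u = - dot v u.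
Proof. by rewrite ![dot _ u]dotC dotNr. Qed.

Lemma dotBr m (u v w : 'cV[R]_m) : dot u (v - w) = dot u v - dot u w.
Proof. by rewrite dotDr dotNr. Qed.

Lemma dotBl m (u v w : 'cV[R]_m) : dot (v - w) u = dot v u - dot w u.
Proof. by rewrite dotDl dotNl. Qed.

Lemma dot0r m (u : 'cV[R]_m) : dot u 0 = 0.
Proof. by rewrite -(scale0r 0) dotZr mul0r. Qed.

Lemma dot0l m (u : 'cV[R]_m) : dot 0 u = 0.
Proof. by rewrite dotC dot0r. Qed.

Lemma dot_mulmx m n (A : 'M[R]_(m, n)) u v : dot u (A *m v) = dot (A^T *m u) v.
Proof. by rewrite !dotE trmx_mul trmxK mulmxA. Qed.

Lemma dot_col_mx m n (a c : 'cV[R]_m) (b d : 'cV[R]_n) :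
  dot (col_mx a b) (col_mx c d) = dot a c + dot b d.
Proof. by rewrite !dotE tr_col_mx mul_row_col mxE. Qed.

Lemma dot_delta m (u : 'cV[R]_m) j : dot u (delta_mx j 0) = u j 0.
Proof.
rewrite /dot (bigD1 j)//= !mxE !eqxx mulr1 big1 ?addr0// => i ij.
by rewrite mxE (negbTE ij) mulr0.
Qed.

Lemma dot_ext m (u v : 'cV[R]_m) : (forall h, dot u h = dot v h) -> u = v.
Proof.
move=> uv; apply/matrixP => i j; rewrite ord1.
by have := uv (delta_mx i 0); rewrite !dot_delta.
Qed.

Lemma dot_ge0 m (u : 'cV[R]_m) : 0 <= dot u u.
Proof. by apply: sumr_ge0 => i _; rewrite -expr2 sqr_ge0. Qed.

Lemma dot_eq0 m (u : 'cV[R]_m) : dot u u = 0 -> u = 0.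
Proof.
move=> u0; apply/matrixP => i j; rewrite ord1 mxE; apply/eqP.
rewrite -sqrf_eq0 expr2; apply/eqP.
by apply: (psumr_eq0P _ u0) => // k _; rewrite -expr2 sqr_ge0.
Qed.

Lemma norm_entry m n (A : 'M[R]_(m, n)) i j : `|A i j| <= `|A|.
Proof.
rewrite [leRHS]/Num.Def.normr/= mx_normrE.
exact: (le_bigmax _ (fun ij : 'I_m * 'I_n => `|A ij.1 ij.2|) (i, j)).
Qed.

Lemma norm_coord m (u : 'cV[R]_m) i : `|u i 0| <= `|u|.
Proof. exact: norm_entry. Qed.

Lemma norm_le_coord m (u : 'cV[R]_m) e :
  0 <= e -> (forall i, `|u i 0| <= e) -> `|u| <= e.
Proof.
move=> e0 ue; rewrite [leLHS]/Num.Def.normr/= mx_normrE.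
by apply/bigmax_le => // -[i j] _; rewrite ord1 /= ue.
Qed.

Lemma norm_mulmx m n (A : 'M[R]_(m, n)) (v : 'cV[R]_n) :
  `|A *m v| <= n%:R * `|A| * `|v|.
Proof.
apply: norm_le_coord => [|i]; first by rewrite !mulr_ge0.
rewrite mxE; apply: (le_trans (ler_norm_sum _ _ _)).
have -> : n%:R * `|A| * `|v| = \sum_(j < n) `|A| * `|v|.
  by rewrite sumr_const card_ord -mulrA mulr_natl.
by apply: ler_sum => j _; rewrite normrM ler_pM ?norm_coord ?norm_entry.
Qed.

Lemma norm_trmx m n (A : 'M[R]_(m, n)) : `|A^T| <= `|A|.
Proof.
rewrite [leLHS]/Num.Def.normr/= mx_normrE.
by apply/bigmax_le => // -[i j] _ /=; rewrite mxE norm_entry.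
Qed.

Lemma dot_bound m (u v : 'cV[R]_m) : `|dot u v| <= m%:R * `|u| * `|v|.
Proof.
apply: (le_trans (ler_norm_sum _ _ _)).
have -> : m%:R * `|u| * `|v| = \sum_(i < m) `|u| * `|v|.
  by rewrite sumr_const card_ord -mulrA mulr_natl.
by apply: ler_sum => i _; rewrite normrM ler_pM// norm_coord.
Qed.

Lemma norm_le_enorm m (u : 'cV[R]_m) : `|u| <= enorm u.
Proof.
apply: norm_le_coord => [|i]; first exact: sqrtr_ge0.
rewrite -sqrtr_sqr ler_wsqrtr// /dot (bigD1 i)//= expr2 lerDl.
by apply: sumr_ge0 => j _; rewrite -expr2 sqr_ge0.
Qed.

(** With [norm_le_enorm] this lets the Euclidean quantities of the statement be estimated in the sup
    norm of the library. The factor is not sharp: it comes from m <= m^2. *)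
Lemma enorm_le_norm m (u : 'cV[R]_m) : enorm u <= m%:R * `|u|.
Proof.
have mu0 : 0 <= m%:R * `|u| by rewrite mulr_ge0.
rewrite -[leRHS]ger0_norm// -sqrtr_sqr ler_wsqrtr// expr2.
apply: le_trans (ler_norm _) _; apply: le_trans (dot_bound _ _) _.
case: m u {mu0} => [|m] u; first by rewrite !mul0r.
rewrite mulrACA mulrA ler_wpM2r// ler_wpM2r// -natrM ler_nat.
by rewrite leq_pmulr.
Qed.

Lemma enorm_ge0 m (u : 'cV[R]_m) : 0 <= enorm u.
Proof. exact: sqrtr_ge0. Qed.

Lemma sqr_enorm m (u : 'cV[R]_m) : enorm u ^+ 2 = dot u u.
Proof. by rewrite sqr_sqrtr ?dot_ge0. Qed.

(** The infimum need not be attained, so only a near-projection is obtained. Nonemptiness matters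
    because [inf] of the empty set is a default value. *)
Lemma dist_lt m (p : 'cV[R]_m) C (r : R) : C !=set0 -> dist p C < r ->
  exists2 q, C q & enorm (p - q) < r.
Proof.
move=> [q0 Cq0] dr; apply: contrapT => nq.
suff : r <= dist p C by rewrite leNgt dr.
apply: lb_le_inf; first by exists (enorm (p - q0)), q0.
move=> _ [q Cq <-]; rewrite leNgt; apply/negP => qr; apply: nq.
by exists q.
Qed.

Lemma continuous_coord m i : continuous (fun u : 'cV[R]_m => u i 0 : R).
Proof. exact: coord_continuous. Qed.

Lemma cvg_coord (T : Type) (F : set_system T) {FF : Filter F} m
    (f : T -> 'cV[R]_m) (a : 'cV[R]_m) i :
  f x @[x --> F] --> a -> (f x i 0 : R) @[x --> F] --> (a i 0 : R).
Proof. by move=> fa; exact: (cvg_comp _ _ fa (@continuous_coord _ i a)). Qed.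

Lemma cvg_dot (T : Type) (F : set_system T) {FF : Filter F} m
    (f g : T -> 'cV[R]_m) (a b : 'cV[R]_m) :
  f x @[x --> F] --> a -> g x @[x --> F] --> b ->
  dot (f x) (g x) @[x --> F] --> dot a b.
Proof.
move=> fa gb; rewrite /dot.
have addc : continuous (fun z : R * R => z.1 + z.2) by exact: add_continuous.
apply: (cvg_big (x0 := 0) (P := xpredT) addc (F := F) (r := index_enum _)
  (Ff := fun i z => f z i 0 * g z i 0) (Fa := fun i => a i 0 * b i 0)) => i _.
by apply: cvgM; exact: cvg_coord.
Qed.

Lemma continuous_dot (T : topologicalType) m (f g : T -> 'cV[R]_m) x :
  {for x, continuous f} -> {for x, continuous g} ->
  {for x, continuous (fun z => dot (f z) (g z))}.
Proof. by move=> cf cg; exact: cvg_dot. Qed.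

Lemma continuous_enorm (T : topologicalType) m (f : T -> 'cV[R]_m) x :
  {for x, continuous f} -> {for x, continuous (fun z => enorm (f z))}.
Proof.
move=> cf; apply: (@continuous_comp _ _ _ (fun z => dot (f z) (f z)) Num.sqrt).
  exact: continuous_dot.
exact: sqrt_continuous.
Qed.

Lemma norm_usubmx m n (u : 'cV[R]_(m + n)) : `|usubmx u| <= `|u|.
Proof. by apply: norm_le_coord => // i; rewrite mxE norm_coord. Qed.

Lemma norm_dsubmx m n (u : 'cV[R]_(m + n)) : `|dsubmx u| <= `|u|.
Proof. by apply: norm_le_coord => // i; rewrite mxE norm_coord. Qed.

Lemma cvg_dsubmx m n (u : nat -> 'cV[R]_(m + n)) (a : 'cV[R]_(m + n)) :
  u @ \oo --> a -> dsubmx (u k) @[k --> \oo] --> dsubmx a.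
Proof.
move=> /cvgrPdist_le ua; apply/cvgrPdist_le => e e0.
have := ua e e0; apply: filterS => k; apply: le_trans.
by rewrite -linearB norm_dsubmx.
Qed.

Lemma cvg_usubmx m n (u : nat -> 'cV[R]_(m + n)) (a : 'cV[R]_(m + n)) :
  u @ \oo --> a -> usubmx (u k) @[k --> \oo] --> usubmx a.
Proof.
move=> /cvgrPdist_le ua; apply/cvgrPdist_le => e e0.
have := ua e e0; apply: filterS => k; apply: le_trans.
by rewrite -linearB norm_usubmx.
Qed.

(** A sup-norm ball is a product of segments, compact for row vectors by [rV_compact]; transposition
    is continuous and carries this to columns. *)
Lemma cV_closed_ball_compact m (r : R) :
  compact [set u : 'cV[R]_m | `|u| <= r].
Proof.
have [r0|r0] := leP 0 r; last first.
  rewrite (_ : [set _ | _] = set0); first exact: compact0.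
  by rewrite -subset0 => u /= /(le_trans (normr_ge0 _)); rewrite leNgt r0.
have -> : [set u : 'cV[R]_m | `|u| <= r] =
    trmx @` [set v : 'rV[R]_m | forall i, `[- r, r]%classic (v ord0 i)].
  apply/seteqP; split => [u /= ur|_ [v /= vr <-]].
    exists u^T; last by rewrite trmxK.
    by move=> i; rewrite mxE in_itv/= -ler_norml (le_trans (norm_coord _ _)).
  apply: norm_le_coord => // i; rewrite mxE ler_norml.
  by have := vr i; rewrite in_itv.
apply: continuous_compact; last first.
  apply: (@rV_compact R m (fun=> `[- r, r]%classic)) => i.
  exact: segment_compact.
apply: continuous_subspaceT.
suff tc : continuous (fun v : 'rV[R]_m => v^T : 'cV[R]_m) by exact: tc.
move=> v; apply/(@cvgrPdist_le _ _ _ (nbhs v)) => e e0; near=> w.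
rewrite -linearB; apply: norm_le_coord => [|i]; first exact: ltW.
move: i; near: w; apply: filter_forall => i.
have cv : w 0 i @[w --> v] --> (v 0 i : R) by exact: coord_continuous.
move/(@cvgrPdist_le _ _ _ (nbhs v)): cv => /(_ _ e0).
by apply: filterS => w; rewrite !mxE.
Unshelve. all: by end_near. Qed.

(** The index [s k] is any n >= k with [u n] within 1/(k+1) of a cluster point. The bound k <= s k,
    weaker than monotonicity, is all that [cvg_subseq] asks for. *)
Lemma bolzano_weierstrass m (u : nat -> 'cV[R]_m) r :
  (forall k, `|u k| <= r) ->
  exists (l : 'cV[R]_m) (s : nat -> nat),
    (forall k, (k <= s k)%N) /\ u \o s @ \oo --> l.
Proof.
move=> ur; have := @cV_closed_ball_compact m r (u @ \oo) _.
have uoo : (u @ \oo) [set u | `|u| <= r] by exists 0%N => // k _ /=.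
case/(_ _ uoo) => l [_ cl]; exists l.
have next k : exists n, (k <= n)%N /\ `|l - u n| < k.+1%:R^-1.
  have [||_ [[n /= kn <-] /= un]] :=
      cl [set u n | n in [set n | (k <= n)%N]] (ball l k.+1%:R^-1).
  - by exists k => // n /= kn; exists n.
  - exact: nbhsx_ballx.
  - by exists n; split=> //; move: un; rewrite -ball_normE.
have [s sP] := choice next; exists s; split=> [k|]; first by case: (sP k).
apply/cvgrPdist_lt => e e0; near=> k.
apply: lt_trans (sP k).2 _.
near: k; exact: (near_infty_natSinv_lt (PosNum e0)).
Unshelve. all: by end_near. Qed.

Lemma cvg_subseq (T : topologicalType) (u : nat -> T) (l : T) (s : nat -> nat) :
  (forall k, (k <= s k)%N) -> u @ \oo --> l -> u \o s @ \oo --> l.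
Proof.
move=> ks; apply: (@cvg_comp _ _ _ s u \oo \oo (nbhs l)) => A [N _ NA].
by exists N => // k /= Nk; apply: NA => /=; exact: leq_trans (ks k).
Qed.

Lemma cvg_ge0_approx (a b : nat -> R) (l : R) : a @ \oo --> l ->
  b @ \oo --> 0 -> (forall k, - b k <= a k) -> 0 <= l.
Proof.
move=> al b0 ba; rewrite leNgt; apply/negP => l0.
have l2 : 0 < - l / 2 by rewrite divr_gt0// oppr_gt0.
near \oo => k.
have : `|l - a k| < - l / 2.
  by near: k; move/cvgrPdist_lt : al; apply.
have : `|0 - b k| < - l / 2.
  by near: k; move/cvgrPdist_lt : b0; apply.
by have := ba k; rewrite !ltr_norml => ? /andP[? ?] /andP[? ?]; lra.
Unshelve. all: by end_near. Qed.

End EuclideanSpace.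

(** * Calculus of C^k maps *)

Section SmoothMaps.
Context {R : realType}.

Lemma linear_diff (V W : normedModType R) (L : V -> W) (linL : linear L) x :
  continuous L -> differentiable L x /\ forall v, 'd L x v = L v.
Proof.
move=> cL; pose Lm := GRing.isLinear.Build _ _ _ _ _ linL.
pose LL : {linear V -> W} := HB.pack L Lm.
have dL := @linear_differentiable _ _ _ LL x cL.
by split=> // v; have := @diff_lin _ _ _ LL x cL => ->.
Qed.

Section Composition.
Context {V V' W W' : normedModType R}.

Lemma diff_comp_linear (L : W -> W') (h : V -> W) z : linear L ->
  continuous L -> differentiable h z ->
  differentiable (L \o h) z /\ forall v, 'D_v (L \o h) z = L ('D_v h z).
Proof.
move=> linL cL dh; have [dL dLE] := linear_diff linL (h z) cL.
have dLh : differentiable (L \o h) z by exact: differentiable_comp.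
by split=> // v; rewrite !deriveE// diff_comp//= dLE.
Qed.

Lemma diff_linear_comp (A : V -> V') (h : V' -> W) z : linear A ->
  continuous A -> differentiable h (A z) ->
  differentiable (h \o A) z /\ forall v, 'D_v (h \o A) z = 'D_(A v) h (A z).
Proof.
move=> linA cA dh; have [dA dAE] := linear_diff linA z cA.
have dhA : differentiable (h \o A) z by exact: differentiable_comp.
by split=> // v; rewrite !deriveE// diff_comp//= dAE.
Qed.

End Composition.

Lemma Ck_derive k n (W : normedModType R) (h : 'cV[R]_n -> W) v :
  Ck k.+1 h -> Ck k ('D_v h).
Proof. by move=> [_ Dh]; exact: Dh. Qed.

Lemma CkS k n (W : normedModType R) (h : 'cV[R]_n -> W) : Ck k.+1 h -> Ck k h.
Proof.
elim: k h => [|k IH] h [dh Dh] /=.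
  by move=> z; exact: differentiable_continuous.
by split=> // v; apply: IH; exact: Dh.
Qed.

Lemma Ck_cst k n (W : normedModType R) (c : W) : Ck k (fun _ : 'cV[R]_n => c).
Proof.
elim: k c => [|k IH] c /=; first exact: cst_continuous.
split=> [z|v]; first exact: differentiable_cst.
rewrite [X in Ck k X](_ : _ = fun=> 0); first exact: IH.
by apply/funext => z; exact: derive_cst.
Qed.

Lemma Ck_comp_linear k n (W W' : normedModType R) (L : W -> W')
    (h : 'cV[R]_n -> W) : linear L -> continuous L -> Ck k h -> Ck k (L \o h).
Proof.
move=> linL cL; elim: k h => [|k IH] h /= ch.
  by move=> z; apply: continuous_comp; [exact: ch|exact: cL].
have dLh z := diff_comp_linear linL cL (ch.1 z).
split=> [z|v]; first exact: (dLh z).1.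
rewrite [X in Ck k X](_ : _ = L \o 'D_v h); first exact/IH/ch.2.
by apply/funext => z; exact: (dLh z).2.
Qed.

Lemma Ck_linear_comp k n n' (W : normedModType R) (A : 'cV[R]_n -> 'cV[R]_n')
    (h : 'cV[R]_n' -> W) : linear A -> continuous A -> Ck k h -> Ck k (h \o A).
Proof.
move=> linA cA; elim: k h => [|k IH] h /= ch.
  by move=> z; apply: continuous_comp; [exact: cA|exact: ch].
have dhA z := diff_linear_comp linA cA (ch.1 (A z)).
split=> [z|v]; first exact: (dhA z).1.
rewrite [X in Ck k X](_ : _ = 'D_(A v) h \o A); first exact/IH/ch.2.
by apply/funext => z; exact: (dhA z).2.
Qed.

Lemma Ck_linear k n (W : normedModType R) (L : 'cV[R]_n -> W) :
  linear L -> continuous L -> Ck k L.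
Proof.
case: k => [//|k] linL cL; have dL z := linear_diff linL z cL.
split=> [z|v]; first exact: (dL z).1.
rewrite [X in Ck k X](_ : _ = fun=> L v); first exact: Ck_cst.
by apply/funext => z; rewrite deriveE; [exact: (dL z).2|exact: (dL z).1].
Qed.

Lemma CkD k n (W : normedModType R) (g h : 'cV[R]_n -> W) :
  Ck k g -> Ck k h -> Ck k (fun z => g z + h z).
Proof.
elim: k g h => [|k IH] g h /= cg ch.
  by move=> z; exact: (continuousD (cg z) (ch z)).
split=> [z|v]; first exact: differentiableD (cg.1 z) (ch.1 z).
rewrite [X in Ck k X](_ : _ = fun z => 'D_v g z + 'D_v h z).
  by apply: IH; [exact: cg.2|exact: ch.2].
by apply/funext => z; rewrite deriveD//; apply: diff_derivable;
  [exact: cg.1|exact: ch.1].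
Qed.

Lemma CkM k n (g h : 'cV[R]_n -> R) :
  Ck k g -> Ck k h -> Ck k (fun z => g z * h z).
Proof.
elim: k g h => [|k IH] g h.
  by move=> /= cg ch z; exact: (continuousM (cg z) (ch z)).
move=> cg ch; split=> [z|v]; first exact: differentiableM (cg.1 z) (ch.1 z).
rewrite [X in Ck k X](_ : _ = fun z => g z * 'D_v h z + h z * 'D_v g z).
  apply: CkD; apply: IH; rewrite ?(cg.2 v, ch.2 v)//.
  - exact: CkS.
  - exact: ch.2.
  - exact: CkS.
  - exact: cg.2.
by apply/funext => z; rewrite deriveM//; apply: diff_derivable;
  [exact: cg.1|exact: ch.1].
Qed.

Lemma Ck_sum k n (W : normedModType R) (I : Type) (r : seq I) (P : pred I)
    (h : I -> 'cV[R]_n -> W) :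
  (forall i, Ck k (h i)) -> Ck k (fun z => \sum_(i <- r | P i) h i z).
Proof.
move=> ch; elim: r => [|i r IH].
  rewrite [X in Ck k X](_ : _ = fun=> 0); first exact: Ck_cst.
  by apply/funext => z; rewrite big_nil.
have [Pi|nPi] := boolP (P i).
  rewrite [X in Ck k X](_ : _ = fun z => h i z + \sum_(i <- r | P i) h i z).
    exact: CkD.
  by apply/funext => z; rewrite big_cons Pi.
rewrite [X in Ck k X](_ : _ = fun z => \sum_(i <- r | P i) h i z)//.
by apply/funext => z; rewrite big_cons (negbTE nPi).
Qed.

Lemma Ck_coord k n p q (h : 'cV[R]_n -> 'M[R]_(p, q)) i j :
  Ck k h -> Ck k (fun z => h z i j : R).
Proof.
apply: (@Ck_comp_linear _ _ _ _ (fun M : 'M[R]_(p, q) => M i j : R)).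
  by move=> a M N; rewrite !mxE.
exact: coord_continuous.
Qed.

Lemma Ck_mx k n p q (h : 'cV[R]_n -> 'M[R]_(p, q)) :
  (forall i j, Ck k (fun z => h z i j : R)) -> Ck k h.
Proof.
move=> ch; rewrite [X in Ck k X](_ : _ = fun z =>
    \sum_i \sum_j (h z i j : R) *: delta_mx i j); last first.
  by apply/funext => z; rewrite [LHS]matrix_sum_delta.
do 2!apply: Ck_sum => ?.
apply: (@Ck_comp_linear _ _ _ _ (fun a : R => a *: delta_mx _ _)) => //.
  by move=> a x y; rewrite scalerDl scalerA.
exact: scalel_continuous.
Qed.

Lemma Ck_mulmx_tr k n p q (M : 'cV[R]_n -> 'M[R]_(p, q)) (u : 'cV[R]_n -> 'cV[R]_p) :
  Ck k M -> Ck k u -> Ck k (fun z => (M z)^T *m u z).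
Proof.
move=> cM cu; apply: Ck_mx => i j.
rewrite [X in Ck k X](_ : _ = fun z => \sum_l M z l i * u z l j).
  by apply: Ck_sum => l; apply: CkM; exact: Ck_coord.
by apply/funext => z; rewrite mxE; apply: eq_bigr => l _; rewrite mxE.
Qed.

Lemma derive_coord n p q (h : 'cV[R]_n -> 'M[R]_(p, q)) z v i j :
  differentiable h z -> 'D_v (fun z => h z i j : R) z = 'D_v h z i j.
Proof.
by move=> dh; rewrite derive_mx ?mxE//; exact: diff_derivable.
Qed.

Lemma derive_mulmx_tr n p q (M : 'cV[R]_n -> 'M[R]_(p, q))
    (u : 'cV[R]_n -> 'cV[R]_p) z v : differentiable M z -> differentiable u z ->
  'D_v (fun z => (M z)^T *m u z) z = ('D_v M z)^T *m u z + (M z)^T *m 'D_v u z.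
Proof.
move=> dM du.
have dMc i j : differentiable (fun z => M z i j : R) z.
  exact: differentiable_comp (differentiable_coord _ _ _).
have duc i j : differentiable (fun z => u z i j : R) z.
  exact: differentiable_comp (differentiable_coord _ _ _).
have Ec i j : (fun x => ((M x)^T *m u x) i j : R) =
    \sum_k ((fun x => M x k i) * (fun x => u x k j)).
  apply/funext => x; rewrite mxE fct_sumE; apply: eq_bigr => k _.
  by rewrite mxE.
have dprod i j k : derivable ((fun x => M x k i : R) * (fun x => u x k j : R)) z v.
  by apply: derivableM; exact: diff_derivable.
rewrite derive_mx; last first.
  by apply/derivable_mxP => i j; rewrite Ec; exact: derivable_sum.
apply/matrixP => i j; rewrite mxE Ec derive_sum// !mxE -big_split/=.
apply: eq_bigr => k _; rewrite deriveM; try exact: diff_derivable.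
by rewrite !derive_coord// !mxE addrC; congr (_ + _); rewrite [LHS]mulrC.
Qed.

Lemma derive_linear n (W : normedModType R) (h : 'cV[R]_n -> W) z :
  differentiable h z -> linear (fun v => 'D_v h z).
Proof. by move=> dh a u v; rewrite !deriveE// linearP. Qed.

Lemma derive_basis n (W : normedModType R) (h : 'cV[R]_n -> W) z v :
  differentiable h z -> 'D_v h z = \sum_j v j 0 *: 'D_(basis_vec j) h z.
Proof.
move=> dh; rewrite deriveE// [in LHS](matrix_sum_delta v) linear_sum/=.
by apply: eq_bigr => j _; rewrite big_ord1 linearZ/= deriveE.
Qed.

Lemma jac_mulmx n m (h : 'cV[R]_n -> 'cV[R]_m) z v :
  differentiable h z -> jac h z *m v = 'D_v h z.
Proof.
move=> dh; rewrite (derive_basis _ dh); apply/matrixP => i j.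
rewrite ord1 mxE summxE; apply: eq_bigr => k _.
by rewrite !mxE mulrC.
Qed.

Lemma dot_grad n (f : 'cV[R]_n -> R) z v :
  differentiable f z -> dot (grad f z) v = 'D_v f z.
Proof.
move=> df; rewrite (derive_basis _ df); apply: eq_bigr => i _.
by rewrite mxE mulrC.
Qed.

(** Replaces the Hessian matrix by an iterated directional derivative, the form in which the lifted
    map is differentiated. Rows of [hess] index the outer derivative, which matches the order of the
    two basis expansions. *)
Lemma d2E n (f : 'cV[R]_n -> R) z d : Ck 2 f -> d2 f z d = 'D_d ('D_d f) z.
Proof.
move=> [df Df].
have -> : 'D_d f = \sum_j (d j 0 *: 'D_(basis_vec j) f).
  by apply/funext => x; rewrite derive_basis// fct_sumE.
have dD j : differentiable ('D_(basis_vec j) f) z by exact: (Df _).1.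
rewrite derive_sum => [|j]; last by apply: derivableZ; exact: diff_derivable.
rewrite /d2 dotE mulmxA mxE; apply: eq_bigr => j _.
rewrite deriveZ; last exact: diff_derivable.
rewrite derive_basis// mulrC; congr (_ * _).
by rewrite mxE; apply: eq_bigr => i _; rewrite !mxE.
Qed.

Lemma d2vE n m (h : 'cV[R]_n -> 'cV[R]_m) z d :
  Ck 2 h -> d2v h z d = 'D_d ('D_d h) z.
Proof.
move=> ch; apply/matrixP => i j; rewrite ord1 mxE d2E; last exact: Ck_coord.
rewrite -derive_coord; last exact: (ch.2 d).1.
by congr ('D_d _ z); apply/funext => x; rewrite derive_coord//; exact: ch.1.
Qed.

End SmoothMaps.

(** * First- and second-order expansions, uniform over nearby directions *)

Section Expansions.
Context {R : realType}.

Lemma is_derive_line n (W : normedModType R) (h : 'cV[R]_n -> W) (a v : 'cV[R]_n)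
    (s : R) :
  differentiable h (a + s *: v) ->
  is_derive s 1 (fun s : R => h (a + s *: v)) ('D_v h (a + s *: v)).
Proof.
move=> dh; have /= := diff_derivable (v := v) dh.
have E : (fun k => k^-1 *: (((fun s : R => h (a + s *: v)) \o shift s) (k *: (1 : R)) -
                     h (a + s *: v))) =
         (fun k : R => k^-1 *: ((h \o shift (a + s *: v)) (k *: v) - h (a + s *: v))).
  apply/funext => k /=; congr (_ *: (h _ - _)).
  by rewrite [k *: 1]mulr1 scalerDl addrCA.
move=> dhv; apply: DeriveDef; rewrite /derivable /derive; first by rewrite E.
by rewrite E.
Qed.

Lemma mean_value_le (c c' : R -> R) (t C : R) : 0 < t ->
  (forall s : R, is_derive s 1 c (c' s)) ->
  (forall s, 0 < s < t -> `|c' s| <= C) -> `|c t - c 0| <= C * t.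
Proof.
move=> t0 dc c'C.
have [|] := MVT t0 (fun s _ => dc s).
  apply: continuous_subspaceT => s; apply: differentiable_continuous.
  by apply/derivable1_diffP; have [] := dc s.
move=> s; rewrite in_itv/= => st ->; rewrite subr0 normrM (gtr0_norm t0).
by rewrite ler_wpM2r ?(ltW t0)// c'C.
Qed.

Lemma derive_bound n (W : normedModType R) (h : 'cV[R]_n -> W) (a : 'cV[R]_n) :
  differentiable h a -> exists2 K, 0 < K & forall v, `|'D_v h a| <= K * `|v|.
Proof.
move=> dh; have [K K0 dK] := linear_lipschitz (diff_continuous dh).
by exists K => // v; rewrite deriveE.
Qed.

(** [Ck] gives continuity of the derivative for each fixed direction only; expanding [v] in the
    basis reduces uniformity in [v] to finitely many directions, each with its share of [e]. *)
Lemma derive_near n (W : normedModType R) (h : 'cV[R]_n -> W) (a : 'cV[R]_n)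
    (e : R) : Ck 1 h ->
  0 < e -> \forall z \near a, forall v, `|'D_v h z - 'D_v h a| <= e * `|v|.
Proof.
move=> [dh Dh] e0.
have n0 : 0 < e / n.+1%:R by rewrite divr_gt0.
have : \forall z \near a, forall j : 'I_n,
    `|'D_(basis_vec j) h a - 'D_(basis_vec j) h z| <= e / n.+1%:R.
  apply: (@filter_forall _ _ (fun j z => `|'D_(basis_vec j) h a -
    'D_(basis_vec j) h z| <= e / n.+1%:R) (nbhs a)) => j.
  by move/(@cvgrPdist_le _ _ _ (nbhs a)): (Dh (basis_vec j) a) => /(_ _ n0).
apply: filterS => z zj v; rewrite !(derive_basis _ (dh _)) -sumrB.
apply: (le_trans (ler_norm_sum _ _ _)).
have : e / n.+1%:R * `|v| *+ n <= e * `|v|.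
  rewrite -mulr_natl mulrA ler_wpM2r// mulrCA ler_piMr ?(ltW e0)//.
  by rewrite ler_pdivrMr// mul1r ler_nat.
apply: le_trans; rewrite -[X in _ *+ X]card_ord -sumr_const.
apply: ler_sum => j _; rewrite -scalerBr normrZ mulrC distrC.
by rewrite ler_pM// norm_coord.
Qed.

(** Mean value theorem, coordinate by coordinate, along the segment from [v] to [u]: it stays in a
    ball where the derivative differs by at most 1 from the one at [a], whence the constant 1 +
    K. *)
Lemma Ck1_lipschitz n m (h : 'cV[R]_n -> 'cV[R]_m) (a : 'cV[R]_n) : Ck 1 h ->
  exists L d, [/\ 0 < L, 0 < d & forall u v, `|u - a| < d -> `|v - a| < d ->
    `|h u - h v| <= L * `|u - v|].
Proof.
move=> ch; have [dh _] := ch; have [K K0 hK] := derive_bound (dh a).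
have /nbhs_ballP[d /= d0 dP] := derive_near a ch ltr01.
exists (1 + K), d; split=> [||u v ud vd]; rewrite ?addr_gt0//.
apply: norm_le_coord => [|i]; first by rewrite mulr_ge0// addr_ge0// ltW.
have dl (s : R) : is_derive s 1 (fun s : R => h (v + s *: (u - v)) i 0)
    ('D_(u - v) h (v + s *: (u - v)) i 0).
  have := @is_derive_line _ _ (fun z => h z i 0) v (u - v) s.
  rewrite derive_coord//; apply; exact: differentiable_comp (differentiable_coord _ _ _).
have := mean_value_le (C := (1 + K) * `|u - v|) ltr01 dl.
rewrite scale1r scale0r addr0 (addrC v) subrK mulr1 !mxE; apply=> s /andP[s0 s1].
apply: le_trans (norm_coord _ _) _.
set w := v + _; have wd : ball a d w.
  rewrite -ball_normE /= distrC.
  have -> : w - a = s *: (u - a) + (1 - s) *: (v - a).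
    rewrite /w scalerBl scale1r !scalerBr.
    by apply/matrixP => p q; rewrite !mxE; ring.
  apply: (le_lt_trans (ler_normD _ _)); rewrite !normrZ !gtr0_norm ?subr_gt0//.
  have -> : d = s * d + (1 - s) * d by ring.
  by rewrite ltrD// ltr_pM2l// subr_gt0.
rewrite -[X in `|X|](subrK ('D_(u - v) h a)); apply: (le_trans (ler_normD _ _)).
by rewrite mulrDl lerD// dP.
Qed.

(** The direction [x'] may vary while the linear term is frozen at [x]: half of [e] pays for the
    differentiability remainder, half for replacing [x'] by [x]. *)
Lemma diff_expansion n (W : normedModType R) (h : 'cV[R]_n -> W) (a x : 'cV[R]_n)
    (e : R) :
  differentiable h a -> 0 < e -> exists2 d, 0 < d &
    forall (t : R) (x' : 'cV[R]_n), 0 < t < d -> `|x' - x| < d ->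
      `|h (a + t *: x') - h a - t *: 'D_x h a| <= e * t.
Proof.
move=> dh e0; have [K K0 hK] := linear_lipschitz (diff_continuous dh).
have x0 : 0 < `|x| + 1 by rewrite ltr_wpDl.
have e1 : 0 < e / 2 / (`|x| + 1) by rewrite !divr_gt0.
have /diff_locallyx := dh => dE.
have /nbhs_ballP[r /= r0 rP] : \forall k \near 0 : 'cV[R]_n,
    `|h (k + a) - (h a + 'd h a k)| <= e / 2 / (`|x| + 1) * `|k|.
  have : h \o shift a = (fun k => h a + 'd h a k) +o_ (nbhs (0 : 'cV[R]_n)) id.
    by apply: eqaddoE; apply/funext => k; rewrite /= dE.
  by move/eqaddoP => /(_ _ e1).
(* The three bounds ensure, in this order, |x'| <= |x| + 1, then t |x'| < r so that the remainder
   estimate applies, and finally K |x' - x| <= e/2. *)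
have d0 : 0 < Num.min 1 (Num.min (r / (`|x| + 1)) (e / 2 / K)).
  by rewrite !lt_min ltr01 !divr_gt0.
exists (Num.min 1 (Num.min (r / (`|x| + 1)) (e / 2 / K))) => // t x'.
rewrite !lt_min => /andP[t0 /and3P[_ tr _]] /and3P[x'1 _ x'K].
have x'x : `|x'| <= `|x| + 1.
  rewrite -[X in `|X|](subrK x) addrC; apply: le_trans (ler_normD _ _) _.
  by rewrite lerD2l ltW.
have tx'x : t * `|x'| < r.
  rewrite (le_lt_trans (y := t * (`|x| + 1))) ?ler_wpM2l ?(ltW t0)//.
  by rewrite -ltr_pdivlMr.
have H := rP (t *: x'); rewrite -ball_normE/= sub0r normrN normrZ in H.
rewrite (gtr0_norm t0) in H; have {}H := H tx'x.
have -> : h (a + t *: x') - h a - t *: 'D_x h a =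
    (h (t *: x' + a) - (h a + 'd h a (t *: x'))) + t *: 'd h a (x' - x).
  have -> : 'd h a (t *: x') = t *: 'd h a x' by rewrite linearZ.
  have -> : 'd h a (x' - x) = 'd h a x' - 'd h a x by rewrite linearB.
  by rewrite (addrC a) deriveE// scalerBr opprD -!addrA addKr.
apply: (le_trans (ler_normD _ _)); rewrite [e in leRHS]splitr mulrDl lerD//.
  apply: (le_trans H); rewrite (mulrC t) mulrA ler_wpM2r ?(ltW t0)//.
  by rewrite -mulrA ler_piMr ?divr_ge0 ?(ltW e0)// mulrC ler_pdivrMr// mul1r.
rewrite normrZ (gtr0_norm t0) mulrC ler_wpM2r ?(ltW t0)//.
apply: le_trans (hK _) _; rewrite mulrC -ler_pdivlMr//.
exact: ltW.
Qed.

Lemma cvg_diff_quotient n (W : normedModType R) (h : 'cV[R]_n -> W)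
    (u x : 'cV[R]_n) (t : nat -> R) (x_ : nat -> 'cV[R]_n) :
  differentiable h u -> (forall k, 0 < t k) -> t @ \oo --> 0 -> x_ @ \oo --> x ->
  (t k)^-1 *: (h (u + t k *: x_ k) - h u) @[k --> \oo] --> 'D_x h u.
Proof.
move=> dh t0 tc xc; apply/cvgrPdist_le => e e0.
have [d d0 dP] := diff_expansion x dh e0.
near=> k; have tk : 0 < t k < d.
  rewrite t0; near: k; move/cvgrPdist_lt : tc => /(_ d d0); apply: filterS => k.
  by rewrite sub0r normrN gtr0_norm.
have xk : `|x_ k - x| < d.
  by near: k; move/cvgrPdist_lt : xc => /(_ d d0); apply: filterS => k; rewrite distrC.
have H := dP _ _ tk xk; rewrite distrC.
have -> : (t k)^-1 *: (h (u + t k *: x_ k) - h u) - 'D_x h u =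
    (t k)^-1 *: (h (u + t k *: x_ k) - h u - t k *: 'D_x h u).
  by rewrite [RHS]scalerBr scalerA mulVf ?gt_eqF// scale1r.
by rewrite normrZ normfV gtr0_norm// ler_pdivrMl// mulrC.
Unshelve. all: by end_near. Qed.

Lemma grad_Ck k n (f : 'cV[R]_n -> R) : Ck k.+1 f -> Ck k (grad f).
Proof.
move=> [_ Df]; apply: Ck_mx => i j.
rewrite [X in Ck k X](_ : _ = 'D_(basis_vec i) f); first exact: Df.
by apply/funext => z; rewrite mxE.
Qed.

(** Makes the second derivative of [f] a first derivative of the gradient, to which [diff_expansion]
    applies. *)
Lemma derive_derive n (f : 'cV[R]_n -> R) (a x : 'cV[R]_n) : Ck 2 f ->
  'D_x ('D_x f) a = dot ('D_x (grad f) a) x.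
Proof.
move=> cf; have dg : differentiable (grad f) a by case: (grad_Ck cf).
have -> : 'D_x f = (fun u : 'cV[R]_n => dot u x) \o grad f.
  by apply/funext => z /=; rewrite dot_grad//; exact: cf.1.
have [|z|_ ->//] := diff_comp_linear (L := (fun u : 'cV[R]_n => dot u x)) _ _ dg.
  by move=> k u v; rewrite dotDl dotZl.
by apply: (@continuous_dot _ _ _ id (fun=> x)); [exact: cvg_id|exact: cst_continuous].
Qed.

(** The linear term keeps the true direction [x'], since freezing it at [x] would cost an error of
    order t |x' - x|, too large beside t^2. Only the quadratic term is frozen. *)
Lemma taylor2_fun n (f : 'cV[R]_n -> R) (a x : 'cV[R]_n) (e : R) : Ck 2 f -> 0 < e ->
  exists2 d, 0 < d & forall (t : R) (x' : 'cV[R]_n), 0 < t < d -> `|x' - x| < d ->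
    `|f (a + t *: x') - f a - t * 'D_x' f a - t ^+ 2 / 2 * 'D_x ('D_x f) a|
      <= e * t ^+ 2.
Proof.
move=> cf e0; have [dg _] := grad_Ck cf.
set g := grad f in dg; set w := 'D_x g a.
(* [b] and [r] split the error on the derivative of the auxiliary function into halves: the gradient
   remainder paired with [x'] costs e/2 * t through [b], and replacing [x'] by [x] against [w] costs
   e/2 * t through [r]. Taking n + 1 keeps the constants positive in dimension 0. *)
set b := n.+1%:R * (`|x| + 1).
have b0 : 0 < b by rewrite mulr_gt0// ltr_wpDl.
have [d d0 dP] := diff_expansion x (dg a) (divr_gt0 e0 (mulr_gt0 (ltr0Sn R 1) b0)).
pose r := e / 2 / (n.+1%:R * (`|w| + 1)).
have r0 : 0 < r by rewrite !divr_gt0// mulr_gt0// ltr_wpDl.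
exists (Num.min 1 (Num.min d r)); first by rewrite !lt_min ltr01 d0.
move=> t x'; rewrite !lt_min => /andP[t0 /and3P[_ td _]] /and3P[x'1 x'd x'r].
have x'x : `|x'| <= `|x| + 1.
  rewrite -[X in `|X|](subrK x) addrC; apply: le_trans (ler_normD _ _) _.
  by rewrite lerD2l ltW.
set q := 'D_x ('D_x f) a; set p := 'D_x' f a.
pose c (s : R) := f (a + s *: x') - s * p - s ^+ 2 / 2 * q.
pose c' (s : R) := 'D_x' f (a + s *: x') - p - s * q.
have dc (s : R) : is_derive s 1 c (c' s).
  have dl := is_derive_line (v := x') (cf.1 (a + s *: x')).
  have -> : c = (fun s => f (a + s *: x')) - p \*: id - (q / 2) \*: (id ^+ 2).
    apply/funext => r'; rewrite /c !fctE; congr (_ - _ - _); rewrite [RHS]mulrC//.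
    by field.
  apply: is_derive_eq; rewrite /c' expr1; congr (_ - _ - _).
    by rewrite [LHS]mulr1.
  rewrite [_ *: 1]mulr1 [LHS]mulrC /=; by field.
have := mean_value_le (C := e * t) t0 dc.
have -> : c t - c 0 = f (a + t *: x') - f a - t * p - t ^+ 2 / 2 * q.
  by rewrite /c scale0r addr0; ring.
rewrite (_ : e * t ^+ 2 = e * t * t); last by rewrite expr2 mulrA.
apply=> s /andP[s0 st]; rewrite /c'.
have -> : 'D_x' f (a + s *: x') - p - s * q =
    dot (g (a + s *: x') - g a - s *: w) x' + s * dot w (x' - x).
  rewrite -!(dot_grad _ (cf.1 _)) /q derive_derive// -/g -/w.
  rewrite /p -(dot_grad _ (cf.1 _)) !dotBl dotZl dotBr; ring.
apply: (le_trans (ler_normD _ _)).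
have -> : e * t = e / 2 * t + e / 2 * t by field.
rewrite lerD//.
  apply: (le_trans (dot_bound _ _)).
  have -> : e / 2 * t = n.+1%:R * (e / (2 * b) * t) * (`|x| + 1).
    rewrite /b; field; rewrite !gt_eqF//; lra.
  rewrite ler_pM ?mulr_ge0// ler_pM// ?ler_nat//.
  apply: le_trans (dP s x' _ x'd) _; first by rewrite s0 (lt_trans st).
  by rewrite ler_wpM2l ?(ltW st)// divr_ge0 ?(ltW e0)// mulr_ge0// ltW.
rewrite normrM (gtr0_norm s0) mulrC ler_pM ?(ltW s0) ?(ltW st)//.
apply: (le_trans (dot_bound _ _)).
have -> : e / 2 = n.+1%:R * (`|w| + 1) * r.
  rewrite /r [RHS]mulrC [RHS]divfK// gt_eqF// mulr_gt0// ltr_wpDl//.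
by rewrite ler_pM ?mulr_ge0 ?(ltW x'r)// ler_pM// ?ler_nat// lerDl.
Qed.

Lemma common_radius (I : finType) (d : I -> R) :
  (forall i, 0 < d i) -> exists2 r, 0 < r & forall i, r <= d i.
Proof.
move=> d0; exists (\big[Num.min/1]_i d i); first exact/lt_bigmin.
by move=> i; exact: bigmin_le_cond.
Qed.

Lemma taylor2 n m (h : 'cV[R]_n -> 'cV[R]_m) (a x : 'cV[R]_n) (e : R) :
  Ck 2 h -> 0 < e ->
  exists2 d, 0 < d & forall (t : R) (x' : 'cV[R]_n), 0 < t < d -> `|x' - x| < d ->
    `|h (a + t *: x') - h a - t *: 'D_x' h a - (t ^+ 2 / 2) *: 'D_x ('D_x h) a|
      <= e * t ^+ 2.
Proof.
move=> ch e0; have dh := ch.1.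
have /choice[d dP] i : exists r : R, 0 < r /\ forall (t : R) (x' : 'cV[R]_n),
    0 < t < r -> `|x' - x| < r ->
    `|(h (a + t *: x') - h a - t *: 'D_x' h a - (t ^+ 2 / 2) *: 'D_x ('D_x h) a)
       i 0| <= e * t ^+ 2.
  have [r r0 rP] := taylor2_fun a x (Ck_coord i 0 ch) e0.
  exists r; split=> // t x' tr x'r; apply: le_trans (rP _ _ tr x'r).
  rewrite !mxE -(derive_coord _ _ _ (dh _)) -(derive_coord _ _ _ ((ch.2 x).1 _)).
  suff -> : 'D_x (fun z => h z i 0) = (fun z => 'D_x h z i 0) by [].
  by apply/funext => z; rewrite derive_coord.
have [r r0 rd] := common_radius (fun i => (dP i).1).
exists r => // t x' /andP[t0 tr] x'r; apply: norm_le_coord => [|i].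
  by rewrite mulr_ge0 ?(ltW e0)// sqr_ge0.
by apply: (dP i).2; rewrite ?t0 (lt_le_trans _ (rd i)).
Qed.

End Expansions.

(** * Second-order Fritz John conditions *)

Section ApproximateMultipliers.
Context {R : realType}.

Lemma diff_dot n m (u w : 'cV[R]_n -> 'cV[R]_m) z :
  differentiable u z -> differentiable w z ->
  differentiable (fun z => dot (u z) (w z)) z /\
  forall v, 'D_v (fun z => dot (u z) (w z)) z =
    dot ('D_v u z) (w z) + dot (u z) ('D_v w z).
Proof.
move=> du dw.
have duc i : differentiable (fun z => u z i 0 : R) z.
  exact: differentiable_comp (differentiable_coord _ _ _).
have dwc i : differentiable (fun z => w z i 0 : R) z.
  exact: differentiable_comp (differentiable_coord _ _ _).
have -> : (fun z => dot (u z) (w z)) =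
    \sum_i ((fun z => u z i 0 : R) * (fun z => w z i 0)).
  by apply/funext => x; rewrite fct_sumE.
split=> [|v].
  by apply: differentiable_sum => i; exact: differentiableM.
rewrite derive_sum => [|i]; last by apply: derivableM; exact: diff_derivable.
rewrite /dot -big_split/=; apply: eq_bigr => i _.
rewrite deriveM; try exact: diff_derivable.
by rewrite !derive_coord// addrC; congr (_ + _); rewrite [LHS]mulrC.
Qed.

Lemma local_min_derive n (f : 'cV[R]_n -> R) (a v : 'cV[R]_n) (d : R) :
  (forall z, differentiable f z) -> 0 < d ->
  (forall z, `|z - a| < d -> f a <= f z) -> 'D_v f a = 0.
Proof.
move=> df d0 fmin; pose r := d / (`|v| + 1).
have v0 : 0 < `|v| + 1 by rewrite ltr_wpDl.
have r0 : 0 < r by rewrite divr_gt0.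
have dl (s : R) := is_derive_line (v := v) (df (a + s *: v)).
have f0 : is_derive (0 : R) 1 (fun s : R => f (a + s *: v)) 0.
  apply: (@derive1_at_min R _ (- r) r 0).
  - by rewrite ge0_cp ?ltW.
  - by move=> t _; have [] := dl t.
  - by rewrite in_itv/= oppr_lt0 r0.
  - move=> t; rewrite in_itv/= -ltr_norml => tr; rewrite scale0r addr0.
    apply: fmin; rewrite addrAC subrr add0r normrZ.
    apply: (@le_lt_trans _ _ (`|t| * (`|v| + 1))); first by rewrite ler_wpM2l ?lerDl.
    by rewrite -ltr_pdivlMr.
have := dl 0; rewrite scale0r addr0 => f0'.
by rewrite -(@derive_val _ _ _ _ _ _ _ f0') (@derive_val _ _ _ _ _ _ _ f0).
Qed.

(** Equality holds at S = r^2: the right side is affine in S and touches the square root there.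
    Majorising both square roots of the penalised objective in this way turns stationarity at its
    minimiser into a computation with smooth quadratics. *)
Lemma sqrt_amgm (S r : R) : 0 < r -> 0 <= S -> Num.sqrt S <= (S + r ^+ 2) / (2 * r).
Proof.
move=> r0 S0; rewrite ler_pdivlMr ?mulr_gt0// -{2}(sqr_sqrtr S0).
by rewrite -subr_ge0; have := sqr_ge0 (Num.sqrt S - r); lra.
Qed.

(* A point of the image of the ball is moved towards K while the deviation from
   the centre is penalised by eps * sqrt (1 + |v|^2), a function with gradient
   at most eps and nonnegative derivative along v. *)
Lemma approximate_multiplier n m (h : 'cV[R]_n -> 'cV[R]_m) (K : set 'cV[R]_m)
    (e r : R) :
  0 < e -> (forall v, differentiable h v) -> closed K -> K 0 ->
  (forall v, `|v| <= r -> ~ K (h v)) -> enorm (h 0) + e < e * r ->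
  exists v k y C, [/\ `|v| <= r, K k /\ `|k| <= `|h v| + enorm (h 0) + e,
    dot y y = 1, forall k', K k' -> dot y (k' - k) <= C * dot (k' - k) (k' - k)
    & [/\ 0 <= dot y (h v - k), dot y ('D_v h v) <= 0
        & forall w, `|dot y ('D_w h v)| <= e * n%:R * `|w|]].
Proof.
move=> e0 dh clK K0 hK hr.
have ch : continuous h by move=> v; exact: differentiable_continuous.
(* The value of the penalised objective [g] at (0, 0), hence an upper bound for its minimum. *)
pose c := enorm (h 0) + e.
have c0 : 0 < c by rewrite ltr_wpDl ?enorm_ge0.
have r0 : 0 < r by rewrite -(pmulr_rgt0 _ e0) (lt_trans c0).
have [B BP] : exists B, forall v, `|v| <= r -> `|h v| <= B.
  have /ex_strict_bound_gt0[B _ /= BP] : bounded_set (h @` [set v | `|v| <= r]).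
    apply/compact_bounded/continuous_compact; last exact: cV_closed_ball_compact.
    exact: continuous_subspaceT.
  by exists B => v vr; apply/ltW/BP; exists v.
pose A := [set v : 'cV[R]_n | `|v| <= r] `*`
  (K `&` [set k : 'cV[R]_m | `|k| <= B + c]).
pose pen (v : 'cV[R]_n) : R := Num.sqrt (1 + dot v v).
pose g (p : 'cV[R]_n * 'cV[R]_m) : R := enorm (h p.1 - p.2) + e * pen p.1.
have cfst p : {for p, continuous (fun p : 'cV[R]_n * 'cV[R]_m => p.1)}.
  exact: cvg_fst.
have cg : continuous g.
  move=> p; have ch1 : {for p, continuous (fun p : 'cV[R]_n * 'cV[R]_m => h p.1)}.
    exact: (continuous_comp (cfst p) (ch p.1)).
  have csnd : {for p, continuous (fun p : 'cV[R]_n * 'cV[R]_m => p.2)}.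
    exact: cvg_snd.
  have cpen : {for p, continuous (fun p : 'cV[R]_n * 'cV[R]_m => pen p.1)}.
    have cd := continuous_dot (cfst p) (cfst p).
    have c1 : {for p, continuous (fun p : 'cV[R]_n * 'cV[R]_m => 1 : R)}.
      exact: cst_continuous.
    by apply: (continuous_comp (continuousD c1 cd)); exact: sqrt_continuous.
  have ce : {for p, continuous (fun p : 'cV[R]_n * 'cV[R]_m => e : R)}.
    exact: cst_continuous.
  exact: (continuousD (continuous_enorm (continuousB ch1 csnd))
    (continuousM ce cpen)).
have B0 : 0 <= B by apply: le_trans (BP 0 _) => //; rewrite normr0 ltW.
have A00 : A (0, 0).
  do 2?split=> //=; first by rewrite normr0 ltW.
  by rewrite normr0 addr_ge0 ?(ltW c0).
have [|||[v k] /set_mem[/= vr [Kk kB]] gmin] := @compact_EVT_min _ R g A.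
- by exists (0, 0).
- apply: compact_setX; first exact: cV_closed_ball_compact.
  rewrite setIC; apply: compact_closedI => //; exact: cV_closed_ball_compact.
- exact: continuous_subspaceT.
have g00 : g (0, 0) = c by rewrite /g/= /pen dot0r addr0 sqrtr1 mulr1 subr0.
have pen0 u : 0 < pen u by rewrite sqrtr_gt0 ltr_pwDl ?dot_ge0.
have pen_norm u : `|u| <= pen u.
  by apply: le_trans (norm_le_enorm u) _; rewrite ler_wsqrtr// lerDr.
have gvk : g (v, k) <= c by rewrite -g00; apply: gmin; exact/mem_set.
(* Points of [K] outside the truncation radius B + c are farther than c from every value of [h] on
   the ball, so they do worse than (0, 0): the minimum over the compact part is one over all of
   [K]. *)
have {}gmin v' k' : `|v'| <= r -> K k' -> g (v, k) <= g (v', k').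
  move=> v'r Kk'; have [k'B|k'B] := leP `|k'| (B + c).
    by apply: gmin; exact/mem_set.
  apply: (le_trans gvk); rewrite /g/= ler_wpDr ?mulr_ge0 ?(ltW e0) ?(ltW (pen0 _))//.
  apply: le_trans (norm_le_enorm _); rewrite distrC.
  apply: le_trans (lerB_dist _ _); rewrite lerBrDr addrC.
  by apply: le_trans (ltW k'B); rewrite lerD2r BP.
(* Interiority, without which stationarity in [v] would fail: e |v| <= e [pen v] <= c < e r. *)
have vr' : `|v| < r.
  rewrite -(ltr_pM2l e0); apply: le_lt_trans hr; apply: le_trans gvk.
  by rewrite /g ler_wpDl ?enorm_ge0// ler_wpM2l ?(ltW e0)//=.
pose a := h v - k; pose N := enorm a.
have N0 : 0 < N.
  rewrite lt_neqAle enorm_ge0 andbT eq_sym; apply/eqP => /eqP.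
  rewrite /N sqrtr_eq0 => a0; apply: (hK v vr); rewrite (_ : h v = k)//.
  by apply/subr0_eq/dot_eq0/eqP; rewrite eq_le a0 dot_ge0.
have NE : N ^+ 2 = dot a a by rewrite sqr_enorm.
have stat w : N^-1 * dot a ('D_w h v) + e / pen v * dot v w = 0.
  pose b z := h z + (- k).
  have db z : differentiable b z by exact: differentiableD.
  have db' z w' : 'D_w' b z = 'D_w' h z.
    by rewrite deriveD ?derive_cst ?addr0//; exact: diff_derivable.
  (* The quadratic majorant of [g (_, k)] from [sqrt_amgm], up to a constant. It touches [g] at [v],
     hence is also minimal there. *)
  pose f z := (2 * N)^-1 * dot (b z) (b z) + e / (2 * pen v) * dot z z.
  have df1 z := diff_dot (db z) (db z).
  have did (z : 'cV[R]_n) : differentiable (id : 'cV[R]_n -> 'cV[R]_n) z.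
    by have [] := is_diff_id z.
  have df2 z := diff_dot (did z) (did z).
  have fE : f = (2 * N)^-1 \*: (fun z => dot (b z) (b z)) +
      (e / (2 * pen v)) \*: (fun z => dot z z) by [].
  have df z : differentiable f z.
    rewrite fE; apply: differentiableD; apply: differentiableZ.
      exact: (df1 z).1.
    exact: (df2 z).1.
  have fv : f v + N / 2 + e / (2 * pen v) * (1 + pen v ^+ 2) = g (v, k).
    rewrite /f -/(a) -NE /g/= -/a -/N.
    have -> : dot v v = pen v ^+ 2 - 1.
      by rewrite sqr_sqrtr ?addr_ge0 ?dot_ge0//; ring.
    by field; rewrite !gt_eqF.
  have fz z : g (z, k) <= f z + N / 2 + e / (2 * pen v) * (1 + pen v ^+ 2).
    have h1 := sqrt_amgm N0 (dot_ge0 (h z - k)).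
    have h2 : pen z <= _ := sqrt_amgm (pen0 v) (addr_ge0 ler01 (dot_ge0 z)).
    rewrite /g /f/= /b.
    have -> : (2 * N)^-1 * dot (h z - k) (h z - k) + e / (2 * pen v) * dot z z +
        N / 2 + e / (2 * pen v) * (1 + pen v ^+ 2) =
      (dot (h z - k) (h z - k) + N ^+ 2) / (2 * N) +
        e * ((1 + dot z z + pen v ^+ 2) / (2 * pen v)).
      by field; rewrite !gt_eqF.
    by rewrite lerD// ler_wpM2l ?(ltW e0).
  have rv : 0 < r - `|v| by rewrite subr_gt0.
  have <- : 'D_w f v = N^-1 * dot a ('D_w h v) + e / pen v * dot v w.
    rewrite fE deriveD; [|apply: derivableZ|apply: derivableZ].
    - rewrite !deriveZ; [|exact: diff_derivable (df2 v).1
                         |exact: diff_derivable (df1 v).1].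
      rewrite (df1 v).2 (df2 v).2 db' derive_id -/a.
      rewrite [dot ('D_w h v) a]dotC [dot w v]dotC /GRing.scale/=.
      by field; rewrite !gt_eqF.
    - exact: diff_derivable (df1 v).1.
    - exact: diff_derivable (df2 v).1.
  apply: (local_min_derive w df rv) => z zv.
  have zr : `|z| <= r.
    rewrite -[X in `|X|](subrK v); apply: (le_trans (ler_normD _ _)).
    by rewrite -lerBrDr ltW.
  by have := le_trans (gmin _ _ zr Kk) (fz z); rewrite -fv !lerD2r.
have kk : `|k| <= `|h v| + enorm (h 0) + e.
  rewrite -{1}(subrK (h v) k) addrC -addrA; apply: (le_trans (ler_normD _ _)).
  rewrite lerD2l distrC; apply: le_trans (norm_le_enorm _) _.
  apply: le_trans gvk; rewrite /g/= lerDl mulr_ge0 ?ltW//.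
(* The normal is the normalised residual. The constant comes from |a|^2 <= |a - (k' - k)|^2,
   expanded and divided by 2 N. *)
exists v, k, (N^-1 *: a), (2 * N)^-1; split=> //.
- by rewrite dotZl dotZr -NE; field; rewrite gt_eqF.
- move=> k' Kk'; have := gmin v k' vr Kk'; rewrite /g/= lerD2r -/a.
  have -> : h v - k' = a - (k' - k).
    by rewrite /a opprB subrKA.
  rewrite -/N -(ler_sqr) ?nnegrE ?enorm_ge0// !sqr_enorm => ak.
  rewrite dotZl (_ : (2 * N)^-1 * _ = N^-1 * (dot (k' - k) (k' - k) / 2)).
    rewrite ler_pM2l ?invr_gt0//.
    have sq (x y : 'cV[R]_m) :
        dot (x - y) (x - y) = dot x x - 2 * dot x y + dot y y.
      by rewrite dotBl !dotBr [dot y x]dotC; ring.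
    by move: ak; rewrite (sq a); lra.
  by field; rewrite gt_eqF.
(* By stationarity the normal sees only the gradient of the penalty: w = v gives the sign, and |v|
   <= [pen v] gives the bound for arbitrary w. *)
- have vw w : dot (N^-1 *: a) ('D_w h v) = - (e / pen v * dot v w).
    by apply/eqP; rewrite -addr_eq0 dotZl stat.
  split.
  + by rewrite dotZl mulr_ge0 ?dot_ge0 ?invr_ge0 ?(ltW N0).
  + rewrite vw oppr_le0 mulr_ge0 ?dot_ge0 ?divr_ge0//; exact/ltW.
  + move=> w; rewrite vw normrN normrM -mulrA [X in X * _]ger0_norm; last first.
      by rewrite divr_ge0 ?ltW.
    rewrite -mulrA ler_wpM2l ?(ltW e0)// ler_pdivrMl//.
    apply: (le_trans (dot_bound _ _)); rewrite mulrAC mulrC ler_wpM2r//.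
Qed.

End ApproximateMultipliers.

(** * From approximate multipliers to a directional normal *)

Section FritzJohn.
Context {R : realType}.

(** A quadratic error is eventually below any multiple of the distance; [D] also absorbs the passage
    from the Euclidean to the sup norm. *)
Lemma proximal_regular_normal m (Q : set 'cV[R]_m) p y C : Q p ->
  (forall p', Q p' -> dot y (p' - p) <= C * dot (p' - p) (p' - p)) ->
  regular_normal_cone Q p y.
Proof.
move=> Qp prox; split=> // e e0; pose D := (`|C| + 1) * m.+1%:R.
have D0 : 0 < D by rewrite mulr_gt0 ?ltr_wpDl.
apply/nbhs_ballP; exists (e / D) => /=; first by rewrite divr_gt0.
move=> p'; rewrite -ball_normE/= distrC => p'p /prox/le_trans; apply.
rewrite -sqr_enorm expr2 mulrA ler_wpM2r ?enorm_ge0//.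
apply: (@le_trans _ _ (`|C| * (m%:R * `|p' - p|))).
  apply: (@le_trans _ _ (`|C| * enorm (p' - p))).
    by rewrite ler_wpM2r ?enorm_ge0// ler_norm.
  by rewrite ler_wpM2l// enorm_le_norm.
apply: (@le_trans _ _ (D * `|p' - p|)).
  by rewrite mulrA ler_wpM2r// ler_pM ?ler0n// ?lerDl// ler_nat.
by rewrite mulrC -ler_pdivlMr// ltW.
Qed.

Lemma diff_affine_comp n (W : normedModType R) (h : 'cV[R]_n -> W)
    (b v : 'cV[R]_n) (s : R) : differentiable h (b + s *: v) ->
  differentiable (fun v => h (b + s *: v)) v /\
  forall w, 'D_w (fun v => h (b + s *: v)) v = s *: 'D_w h (b + s *: v).
Proof.
move=> dh; pose A : 'cV[R]_n -> 'cV[R]_n := cst b + s \*: id.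
have did : differentiable (id : 'cV[R]_n -> 'cV[R]_n) v.
  by have [] := is_diff_id v.
have dA : differentiable A v.
  by apply: differentiableD => //; apply: differentiableZ.
have dhA : differentiable (h \o A) v by exact: differentiable_comp.
split=> // w.
have -> : 'D_w (fun v => h (b + s *: v)) v = 'd (h \o A) v w by rewrite deriveE.
rewrite diff_comp//= -deriveE// -(deriveE w dA) deriveD; last 2 first.
- exact: derivable_cst.
- by apply: derivableZ; exact: diff_derivable.
rewrite derive_cst add0r deriveZ; last exact: diff_derivable.
rewrite derive_id deriveE// linearZ/= -deriveE//.
Qed.

Lemma rescaleE m (t : R) (a b w d q : 'cV[R]_m) : t != 0 ->
  a - b - t *: (w + t *: d) - (t ^+ 2 / 2) *: q =
  t ^+ 2 *: (t ^- 2 *: (a - b - t *: w) - d - 2^-1 *: q).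
Proof. by move=> t0; apply/matrixP => i j; rewrite !mxE; field. Qed.

Lemma rescaleK m (t : R) (a b w s : 'cV[R]_m) : t != 0 ->
  b + t *: w + t ^+ 2 *: (t ^- 2 *: (a - b - t *: w) + s) = a + t ^+ 2 *: s.
Proof. by move=> t0; apply/matrixP => i j; rewrite !mxE; field. Qed.

Lemma sub_sub_split (V : zmodType) (a b c : V) : a = b + c + (a - b - c).
Proof. by rewrite -(addrA a) -opprD [RHS]addrC subrK. Qed.

Lemma eighths_le (e : R) : 0 < e -> e / 8 + e / 8 <= e.
Proof. by move=> e0; lra. Qed.

(** Closing arithmetic of [fritz_john_approx]: [d] and [d'] are the pairings of the normal with the
    derivative along [v] at the base point and at the moved point, [s] its pairing with the rescaled
    remainder, [r] that with the shift. One gets y / 2 >= - (p + q + r) >= - 3 e / 8. *)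
Lemma ge_of_eighths (e p q r s d d' y : R) : 0 < e ->
  p <= e / 8 -> q <= e / 8 -> r <= e / 8 -> - p <= d - d' -> d - d' <= p ->
  - q <= s - d - 2^-1 * y -> s - d - 2^-1 * y <= q -> 0 <= s + r -> d' <= 0 ->
  - e <= y.
Proof. by move=> *; lra. Qed.

(** Here [g] is the pairing of the normal with k. If it were negative, moving k to (1 - s) k would
    gain - s g, of first order in s, where the proximal inequality allows only C s^2 a. *)
Lemma prox_absurd (C s a g : R) : 0 < s -> 0 <= s * a ->
  s * (`|C| * a + 1) < - g -> - s * g <= C * (- s * (- s * a)) ->
  C * (s * a) <= `|C| * (s * a) -> False.
Proof.
move=> s0 sa sg H1 H2.
have := ler_wpM2l (ltW s0) H2; have := mulr_gt0 s0 s0; nra.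
Qed.

Lemma weaken_prod (a b c : R) : 0 <= a -> 0 <= b -> 0 <= c ->
  a * b <= (a + 1) * b * (c + 1) /\ a * (b * c) <= (a + 1) * b * (c + 1).
Proof.
move=> a0 b0 c0; have ab := mulr_ge0 a0 b0; have bc := mulr_ge0 b0 c0.
have abc := mulr_ge0 ab c0.
have -> : (a + 1) * b * (c + 1) = a * b * c + a * b + b * c + b by ring.
by rewrite mulrA; split; lra.
Qed.

Lemma ratio_le (a s : R) : 0 <= a -> 0 <= s -> a * (s / (a + 1)) <= s.
Proof.
move=> a0 s0; rewrite mulrCA ler_piMr// ler_pdivrMr ?ltr_wpDl// mul1r.
by rewrite lerDl.
Qed.

Context {n m : nat}.
Context (h : 'cV[R]_n -> 'cV[R]_m) (Q : set 'cV[R]_m) (c : 'cV[R]_m)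
  (u x : 'cV[R]_n) (h_C2 : Ck 2 h) (Q_closed : closed Q).

Let w := 'D_x h u.
Let q := 'D_x ('D_x h) u.

(* [Q_opt] encodes optimality of [u]: raising the objective coordinate (the
   direction [c]) never leads into [Q].  [Q_conic] says that the second-order
   slices of [Q] can be shrunk towards 0, as is the case for a union of finitely
   many polyhedra; it makes the limit multiplier nonnegative on the slices. *)
Context
  (Q_ray : exists2 d, 0 < d & forall t : R, 0 < t < d -> Q (h u + t *: w))
  (Q_opt : exists2 d, 0 < d & forall z (s : R), `|z - u| < d -> 0 < s ->
    ~ Q (h z + s *: c))
  (Q_conic : forall r, exists2 d, 0 < d & forall (t : R) k,
    0 < t < d -> `|k| <= r -> Q (h u + t *: w + t ^+ 2 *: k) ->
    exists2 s0, 0 < s0 & forall s : R, 0 < s < s0 ->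
      Q (h u + t *: w + t ^+ 2 *: ((1 - s) *: k))).

Lemma common_bound (s : seq R) : (forall d, d \in s -> 0 < d) ->
  exists2 t, 0 < t & forall d, d \in s -> t < d.
Proof.
elim: s => [|a s IH] s0; first by exists 1.
have [d ds|t t0 ts] := IH; first by apply: s0; rewrite inE ds orbT.
have a0 : 0 < a by apply: s0; rewrite inE eqxx.
exists (Num.min (a / 2) t); first by rewrite lt_min divr_gt0.
move=> d; rewrite inE => /orP[/eqP ->|/ts]; rewrite gt_min; last by move=> ->; rewrite orbT.
by rewrite ltr_pdivrMr// ltr_pMr ?ltr1n.
Qed.

(* [approximate_multiplier] is applied to the rescaled remainder
   [t^-2 (h (u + t x + t^2 v) - h u - t w)], shifted by a small multiple of [c] so
   that it misses the slice of [Q]. *)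
Lemma fritz_john_approx (e : R) : 0 < e -> e <= 1 ->
  exists (t : R) w' y, [/\ 0 < t < e, `|w' - w| <= e,
    regular_normal_cone Q (h u + t *: w') y, dot y y = 1
    & (forall v, `|dot y ('D_v h u)| <= e * `|v|) /\ - e <= dot y q].
Proof.
move=> e0 e1; have dh := h_C2.1.
have [B B0 BP] := derive_bound (dh u).
pose M : R := m%:R.
(* Used both as the length of the shift along [c] and as the penalty slope. The denominator keeps
   each of their contributions below e / 8. *)
pose e' := e / (8 * (n%:R + M * `|c| + 1)).
have e'0 : 0 < e' by rewrite divr_gt0// mulr_gt0// ltr_wpDl// addr_ge0// mulr_ge0 ?ler0n.
pose C1 := M * (`|q| + 1 + `|c|).
have C10 : 0 <= C1 by rewrite mulr_ge0 ?ler0n// !addr_ge0.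
(* Then e' r = C1 + 2 e', which exceeds [enorm (psi 0)] + e' as [approximate_multiplier] requires,
   [C1] bounding [enorm (psi 0)]. *)
pose r := (C1 + e') / e' + 1.
have r0 : 0 < r by rewrite ltr_wpDl// divr_ge0 ?addr_ge0 ?(ltW e'0).
(* The error on first derivatives gets multiplied by |v| <= r, so r, although large, must be known
   before [e2], and both before t. *)
pose e2 := e / (8 * (M + 1) * (r + 1)).
have e20 : 0 < e2 by rewrite divr_gt0// !mulr_gt0// ltr_wpDl// ?ler0n// ltW.
pose e3 := e / (8 * (M + 1)).
have e30 : 0 < e3 by rewrite divr_gt0// !mulr_gt0// ltr_wpDl ?ler0n.
(* Bounds the projected point [k], through its distance to [psi v] and the bounds on [psi v] and
   [psi 0]. *)
pose r' := B * r + `|q| + 1 + `|c| + C1 + 1.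
have r'0 : 0 < r' by rewrite ltr_wpDl// !addr_ge0// mulr_ge0 ?ltW.
have [d1 d10 ray] := Q_ray.
have [d2 d20 opt] := Q_opt.
have [d3 d30 conic] := Q_conic r'.
have [d4 d40 tay] := taylor2 u x h_C2 e30.
have /nbhs_ballP[d5 /= d50 near5] := derive_near u (CkS h_C2) e20.
pose X := `|x| + r.
have X0 : 0 < X by rewrite ltr_wpDl.
have [|t t0 tP] := @common_bound
  [:: e; 1; d1; d3; d2 / X; d5 / X; d4; d4 / r; e / r'].
  by move=> d; rewrite !inE; do ?[case/orP]; move=> /eqP -> //; rewrite divr_gt0.
have te : t < e by apply: tP; rewrite !inE eqxx ?orbT.
have t1 : t < 1 by apply: tP; rewrite !inE eqxx ?orbT.
have td1 : t < d1 by apply: tP; rewrite !inE eqxx ?orbT.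
have td3 : t < d3 by apply: tP; rewrite !inE eqxx ?orbT.
have td4 : t < d4 by apply: tP; rewrite !inE eqxx ?orbT.
have tXd2 : t * X < d2 by rewrite -ltr_pdivlMr//; apply: tP; rewrite !inE eqxx ?orbT.
have tXd5 : t * X < d5 by rewrite -ltr_pdivlMr//; apply: tP; rewrite !inE eqxx ?orbT.
have trd4 : t * r < d4 by rewrite -ltr_pdivlMr//; apply: tP; rewrite !inE eqxx ?orbT.
have tr'e : t * r' < e by rewrite -ltr_pdivlMr//; apply: tP; rewrite !inE eqxx ?orbT.
have tt0 : 0 < t ^+ 2 by rewrite exprn_gt0.
pose z v := u + t *: x + t ^+ 2 *: v.
have zE v : z v = u + t *: (x + t *: v) by rewrite /z scalerDr scalerA addrA expr2.
have zu v : `|v| <= r -> `|z v - u| <= t * X.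
  move=> vr; rewrite zE addrAC subrr add0r normrZ gtr0_norm// ler_wpM2l ?(ltW t0)//.
  apply: (le_trans (ler_normD _ _)); rewrite lerD2l normrZ gtr0_norm//.
  by rewrite -[leRHS]mul1r ler_pM ?(ltW t0) ?(ltW t1).
pose D v := t ^- 2 *: (h (z v) - h u - t *: w).
(* On the whole ball the rescaled remainder is close to the affine map sending v to ['D_v h u] + q /
   2: this is [taylor2] with the perturbed direction x + t v. *)
have DP v : `|v| <= r -> `|D v - 'D_v h u - 2^-1 *: q| <= e3.
  move=> vr.
  have := tay t (x + t *: v); rewrite t0 td4 addrAC subrr add0r normrZ gtr0_norm//.
  have tv : t * `|v| < d4 by apply: le_lt_trans trd4; rewrite ler_wpM2l ?(ltW t0).
  move=> /(_ isT tv); rewrite -zE.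
  have -> : 'D_(x + t *: v) h u = w + t *: 'D_v h u.
    by rewrite addrC (derive_linear (dh u)) addrC.
  have -> : h (z v) - h u - t *: (w + t *: 'D_v h u) - (t ^+ 2 / 2) *: q =
      t ^+ 2 *: (D v - 'D_v h u - 2^-1 *: q).
    by rewrite rescaleE// gt_eqF.
  by rewrite normrZ gtr0_norm// mulrC ler_pM2r.
pose psi v := D v + e' *: c.
have M0 : 0 <= M by rewrite ler0n.
have Mc0 : 0 <= M * `|c| by rewrite mulr_ge0.
have n0 : 0 <= n%:R :> R by rewrite ler0n.
have cancel8 (a b : R) : 0 < a -> 0 < b -> a * (e / (8 * a * b)) * b = e / 8.
  by move=> a0 b0; field; rewrite !gt_eqF.
have e'Z : e' * (n%:R + M * `|c| + 1) = e / 8.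
  rewrite -(cancel8 (n%:R + M * `|c| + 1) 1) ?ltr_wpDl ?addr_ge0//.
  by rewrite !mulr1 mulrC.
have e2Z : (M + 1) * e2 * (r + 1) = e / 8 by rewrite cancel8// ltr_wpDl// ltW.
have e3Z : (M + 1) * e3 = e / 8.
  by rewrite -(cancel8 (M + 1) 1) ?ltr_wpDl// !mulr1.
have e'1 : e' <= 1.
  rewrite ler_pdivrMr ?mulr_gt0 ?ltr_wpDl ?addr_ge0//.
  by rewrite mul1r (le_trans e1)// mulr_ege1 ?ler1n// lerDr addr_ge0.
have e31 : e3 <= 1.
  rewrite ler_pdivrMr ?mulr_gt0 ?ltr_wpDl//.
  by rewrite mul1r (le_trans e1)// mulr_ege1 ?ler1n// lerDr.
have [Me2 Me2r] := weaken_prod M0 (ltW e20) (ltW r0).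
rewrite e2Z in Me2 Me2r.
have Me3 : M * e3 <= e / 8 by rewrite -e3Z ler_wpM2r ?(ltW e30)// lerDl.
have e'n : e' * n%:R <= e / 8.
  by rewrite -e'Z ler_wpM2l ?(ltW e'0)// -addrA lerDl addr_ge0.
have e'Mc : e' * (M * `|c|) <= e / 8.
  by rewrite -e'Z ler_wpM2l ?(ltW e'0)// addrAC lerDr addr_ge0.
have psi0 : enorm (psi 0) <= C1.
  apply: (le_trans (enorm_le_norm _)); rewrite ler_wpM2l ?ler0n//.
  apply: (le_trans (ler_normD _ _)); rewrite lerD//; last first.
    by rewrite normrZ gtr0_norm// ler_piMl.
  have := DP 0; rewrite normr0 (ltW r0) derive0 subr0 => /(_ isT) D0.
  rewrite -[X in `|X|](subrK (2^-1 *: q)) addrC; apply: (le_trans (ler_normD _ _)).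
  rewrite lerD ?(le_trans D0)// normrZ ler_piMl// ger0_norm ?invf_le1 ?ler1n//.
have psiB v : `|v| <= r -> `|psi v| <= B * r + `|q| + 1 + `|c|.
  move=> vr; apply: (le_trans (ler_normD _ _)); rewrite lerD//; last first.
    by rewrite normrZ gtr0_norm// ler_piMl.
  rewrite [X in `|X|](sub_sub_split _ ('D_v h u) (2^-1 *: q)).
  apply: (le_trans (ler_normD _ _)); rewrite lerD ?(le_trans (DP v vr))//.
  apply: (le_trans (ler_normD _ _)); rewrite lerD//.
    by apply: (le_trans (BP v)); rewrite ler_wpM2l ?(ltW B0).
  by rewrite normrZ ler_piMl// ger0_norm ?invf_le1 ?ler1n.
have dpsi v : differentiable psi v /\ forall v', 'D_v' psi v = 'D_v' h (z v).
  have [dz dzE] := diff_affine_comp (dh (z v)).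
  pose b := fun v => h (z v) + (- h u - t *: w).
  have db : differentiable b v.
    exact: differentiableD dz (differentiable_cst _ _).
  have psiE : psi = (t ^- 2 \*: b) + cst (e' *: c).
    by apply/funext => v'; rewrite /psi /D -addrA.
  rewrite psiE; split=> [|v'].
    exact: differentiableD (differentiableZ _ db) (differentiable_cst _ _).
  rewrite deriveD ?derive_cst ?addr0; last 2 first.
  - by apply: derivableZ; exact: diff_derivable.
  - exact: derivable_cst.
  rewrite deriveZ; last exact: diff_derivable.
  rewrite deriveD ?derive_cst ?addr0; last 2 first.
  - exact: diff_derivable.
  - exact: derivable_cst.
  by rewrite dzE scalerA mulVf ?scale1r// gt_eqF.
pose K := [set k | Q (h u + t *: w + t ^+ 2 *: k)].
have KE v s : K (psi v + s) = Q (h (z v) + (t ^+ 2 * e') *: c + t ^+ 2 *: s).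
  have -> : psi v + s = t ^- 2 *: (h (z v) - h u - t *: w) + (e' *: c + s).
    by rewrite addrA.
  rewrite /K/= rescaleK ?gt_eqF//.
  by rewrite scalerDr scalerA addrA.
have [||||| v [k [y [C [vr [Kk kB] y1 prox [ypsi ydv ydw]]]]]] :=
    @approximate_multiplier _ n m psi K e' r e'0.
- by move=> v; exact: (dpsi v).1.
- have ck : continuous (fun k : 'cV[R]_m => h u + t *: w + t ^+ 2 *: k).
    move=> k; have c1 : {for k, continuous (fun _ : 'cV[R]_m => h u + t *: w)}.
      exact: cst_continuous.
    exact: (continuousD c1 (@scaler_continuous _ _ (t ^+ 2) k)).
  exact: ((continuous_closedP _).1 ck _ Q_closed).
- by rewrite /K/= scaler0 addr0; apply: ray; rewrite t0 td1.
(* If [psi v] were in the slice, [h (z v)] plus a positive multiple of [c] would lie in [Q], against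
   [Q_opt]. *)
- move=> v vr; rewrite -[psi v]addr0 KE scaler0 addr0; apply: opt.
    exact: le_lt_trans (zu v vr) tXd2.
  by rewrite mulr_gt0.
- have -> : e' * r = C1 + e' + e' by rewrite /r; field; rewrite gt_eqF.
  by rewrite ltr_pwDr// lerD2r.
have y_le1 : `|y| <= 1.
  by apply: (le_trans (norm_le_enorm y)); rewrite /enorm y1 sqrtr1.
have dot_le a d : `|a| <= d -> `|dot y a| <= M * d.
  move=> ad; apply: (le_trans (dot_bound _ _)).
  by rewrite -mulrA ler_wpM2l// (le_trans _ ad)// ler_piMl.
have kr' : `|k| <= r'.
  by apply: (le_trans kB); rewrite lerD// lerD// psiB.
have yk : 0 <= dot y k.
  have [|s0 s00 s0P] := conic t k _ kr' Kk; first by rewrite t0 td3.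
  rewrite leNgt; apply/negP => yk; pose a := dot k k.
  have Ca0 : 0 < `|C| * a + 1 by rewrite ltr_wpDl// mulr_ge0// dot_ge0.
  have [|s s_gt0 sP] := @common_bound [:: s0; - dot y k / (`|C| * a + 1)].
    move=> d; rewrite !inE => /orP[] /eqP -> //.
    by rewrite divr_gt0// oppr_gt0.
  have ss0 : s < s0 by apply: sP; rewrite !inE eqxx.
  have sa : s * (`|C| * a + 1) < - dot y k.
    by rewrite -ltr_pdivlMr//; apply: sP; rewrite !inE eqxx orbT.
  have := prox _ (s0P s _); rewrite s_gt0 ss0 => /(_ isT).
  rewrite scalerBl scale1r addrAC subrr add0r -scaleNr !dotZr dotZl -/a.
  have sa0 : 0 <= s * a by rewrite mulr_ge0 ?dot_ge0 ?ltW.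
  have : C * (s * a) <= `|C| * (s * a) by rewrite ler_wpM2r// ler_norm.
  move=> H1 H2; exact: (prox_absurd s_gt0 sa0 sa H2 H1).
have dzh v' : `|dot y ('D_v' h u) - dot y ('D_v' h (z v))| <= M * (e2 * `|v'|).
  rewrite -dotBr; apply: dot_le; rewrite distrC; apply: near5.
  by rewrite -ball_normE/= distrC; apply: le_lt_trans (zu v vr) tXd5.
exists t, (w + t *: k), y; split=> //.
- by rewrite t0.
- by rewrite addrAC subrr add0r normrZ gtr0_norm// (le_trans _ (ltW tr'e))// ler_wpM2l ?(ltW t0).
- rewrite scalerDr scalerA -expr2 addrA.
  (* Passing from the slice to [Q] scales differences by t^2 and their squares by t^4, so the
     proximal constant is divided by t^2. *)
  apply: (proximal_regular_normal (C := C / t ^+ 2)) => // p' Qp'.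
  pose k' := t ^- 2 *: (p' - h u - t *: w).
  have p'E : p' = h u + t *: w + t ^+ 2 *: k'.
    by have := rescaleK p' (h u) w 0 (lt0r_neq0 t0); rewrite addr0 scaler0 addr0.
  have Kk' : K k' by rewrite /K/= -p'E.
  rewrite {1 2 3}p'E opprD addrACA subrr add0r -scalerBr !dotZr dotZl.
  have -> : C / t ^+ 2 * (t ^+ 2 * (t ^+ 2 * dot (k' - k) (k' - k))) =
      t ^+ 2 * (C * dot (k' - k) (k' - k)) by field; rewrite gt_eqF.
  by rewrite ler_pM2l// prox.
split=> [v'|].
  rewrite -[X in `|X|](subrK (dot y ('D_v' h (z v)))).
  apply: (le_trans (ler_normD _ _)).
  have H1 := dzh v'; have H2 := ydw v'; rewrite (dpsi v).2 in H2.
  apply: (le_trans (lerD H1 H2)).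
  have -> : M * (e2 * `|v'|) + e' * n%:R * `|v'| = (M * e2 + e' * n%:R) * `|v'|.
    by ring.
  by rewrite ler_wpM2r// (le_trans (lerD Me2 e'n))// eighths_le.
have H1 := dzh v.
have H2 := dot_le _ _ (DP v vr); have H3 := dot_le c _ (lexx _).
rewrite (dpsi v).2 in ydv; rewrite dotBr /psi dotDr dotZr in ypsi.
rewrite (dotBr y _ (2^-1 *: q)) (dotBr y (D v)) (dotZr 2^-1 y q) in H2.
have H4 : e2 * `|v| <= e2 * r by rewrite ler_wpM2l ?(ltW e20).
move: H1 H2 H3; rewrite !ler_norml => /andP[H11 H12] /andP[H21 H22] /andP[H31 H32].
have H5 := le_trans (ler_wpM2l M0 H4) Me2r.
have H6 : e' * dot y c <= e' * (M * `|c|) by rewrite ler_wpM2l ?(ltW e'0).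
have H7 := le_trans H6 e'Mc.
apply: (ge_of_eighths e0 H5 Me3 H7 H11 H12 H21 H22 _ ydv).
by rewrite (le_trans ypsi)// lerBlDr lerDl.
Qed.

(** [fritz_john_approx] with e = 1/(k+1) yields unit regular normals at points approaching [h u] in
    directions approaching [w]; a convergent subsequence is by definition a directional normal. Unit
    length survives the limit, so it is nonzero. *)
Lemma fritz_john2 : exists y,
  [/\ y <> 0, dir_normal_cone Q (h u) w y, forall v, dot y ('D_v h u) = 0
    & 0 <= dot y q].
Proof.
have /choice[T TP] k : exists p : R * ('cV[R]_m * 'cV[R]_m),
    [/\ 0 < p.1 < k.+1%:R^-1, `|p.2.1 - w| <= k.+1%:R^-1,
      regular_normal_cone Q (h u + p.1 *: p.2.1) p.2.2, dot p.2.2 p.2.2 = 1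
    & (forall v, `|dot p.2.2 ('D_v h u)| <= k.+1%:R^-1 * `|v|) /\
      - k.+1%:R^-1 <= dot p.2.2 q].
  have [||t [w' [y H]]] := @fritz_john_approx k.+1%:R^-1.
  - by rewrite invr_gt0.
  - by rewrite invf_le1// ler1n.
  - by exists (t, (w', y)).
have [|y [s [ks sy]]] := @bolzano_weierstrass _ _ (fun k => (T k).2.2) 1.
  move=> k; apply: (le_trans (norm_le_enorm _)).
  by rewrite /enorm; have [_ _ _ -> _] := TP k; rewrite sqrtr1.
have sinv k : (s k).+1%:R^-1 <= k.+1%:R^-1 :> R.
  by rewrite lef_pV2 ?posrE// ler_nat ltnS.
have inv0 : (fun k => k.+1%:R^-1 : R) @ \oo --> 0 by exact: cvg_harmonic.
have dot_cvg a : dot (T (s k)).2.2 a @[k --> \oo] --> dot y a.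
  by apply: cvg_dot => //; exact: cvg_cst.
exists y; split.
- move=> y0; have /eqP := dot0l y; apply/negP.
  have -> : dot 0 y = 1; last by rewrite oner_eq0.
  have yy : dot (T (s k)).2.2 (T (s k)).2.2 @[k --> \oo] --> dot y y.
    exact: cvg_dot.
  have E : (fun k => dot (T (s k)).2.2 (T (s k)).2.2) = cst 1.
    by apply/funext => k; have [_ _ _ -> _] := TP (s k).
  rewrite -{1}y0; rewrite E in yy.
  by apply: (cvg_unique _ yy) => //; exact: cvg_cst.
- exists (fun k => (T (s k)).1), (fun k => (T (s k)).2.1), (fun k => (T (s k)).2.2).
  split=> [k||||k]; last by have [] := TP (s k).
  + by have [/andP[]] := TP (s k).
  + apply: squeeze_cvgr (cvg_cst 0) inv0.
    near=> k.
    by have [/andP[/ltW -> /ltW/le_trans->]] := TP (s k).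
  + apply/cvgrPdist_le => e e0; near=> k.
    rewrite distrC; have [_ H _ _ _] := TP (s k); apply: (le_trans H).
    apply: (le_trans (sinv k)).
    near: k; move/cvgrPdist_le : inv0 => /(_ e e0); apply: filterS => k.
    by rewrite sub0r normrN ger0_norm// invr_ge0.
  + exact: sy.
- move=> v; have vinv : (fun k => k.+1%:R^-1 * `|v| : R) @ \oo --> 0.
    by rewrite -[0](mul0r `|v|); apply: cvgMr_tmp.
  have bound k : `|dot (T (s k)).2.2 ('D_v h u)| <= k.+1%:R^-1 * `|v|.
    have [_ _ _ _ [H _]] := TP (s k); apply: (le_trans (H v)).
    by rewrite ler_wpM2r.
  apply/eqP; rewrite eq_le -oppr_ge0; apply/andP; split.
    apply: (cvg_ge0_approx (cvgN (dot_cvg _)) vinv) => k.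
    by rewrite lerN2 (le_trans (ler_norm _) (bound k)).
  apply: (cvg_ge0_approx (dot_cvg _) vinv) => k.
  by move: (bound k); rewrite ler_norml => /andP[].
- apply: (cvg_ge0_approx (dot_cvg q) inv0) => k.
  by have [_ _ _ _ [_]] := TP (s k); apply: le_trans; rewrite lerN2.
Unshelve. all: by end_near. Qed.

End FritzJohn.

(** * The graph of the normal cone mapping of the orthant *)

Section ComplementarityGraph.
Context {R : realType}.

(** Along a segment lying in the set, the pairing with a regular normal is linear in s and must be
    at most o(s). All sign information on regular normals is extracted in this way, by exhibiting
    segments. *)
Lemma regular_normal_le0 m (C : set 'cV[R]_m) z v h (s0 : R) : 0 < s0 ->
  (forall s : R, 0 < s < s0 -> C (z + s *: h)) -> regular_normal_cone C z v ->
  dot v h <= 0.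
Proof.
move=> s00 Ch [_ vP]; rewrite leNgt; apply/negP => vh.
have h0 : 0 < enorm h + 1 by rewrite ltr_wpDl ?enorm_ge0.
(* Chosen so that this tolerance times [enorm h] is strictly below [dot v h]. *)
have e0 : 0 < dot v h / (enorm h + 1) by rewrite divr_gt0.
have /nbhs_ballP[d /= d0 dP] := vP _ e0.
have h1 : 0 < `|h| + 1 by rewrite ltr_wpDl.
have [|s s_gt0 sP] := @common_bound R [:: s0; d / (`|h| + 1)].
  by move=> a; rewrite !inE => /orP[] /eqP -> //; rewrite divr_gt0.
have ss0 : s < s0 by apply: sP; rewrite !inE eqxx.
have sd : s * (`|h| + 1) < d by rewrite -ltr_pdivlMr//; apply: sP; rewrite !inE eqxx orbT.
have shE : z + s *: h - z = s *: h by rewrite addrAC subrr add0r.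
have := dP (z + s *: h); rewrite -ball_normE/= distrC shE normrZ gtr0_norm//.
have shd : s * `|h| < d by apply: le_lt_trans sd; rewrite ler_wpM2l ?(ltW s_gt0)// lerDl.
have sC : C (z + s *: h) by apply: Ch; rewrite s_gt0 ss0.
move=> /(_ shd sC); apply/negP; rewrite -ltNge.
have -> : enorm (s *: h) = s * enorm h.
  rewrite /enorm dotZl dotZr mulrA -expr2 sqrtrM ?sqr_ge0// sqrtr_sqr.
  by rewrite gtr0_norm.
rewrite dotZr mulrCA ltr_pM2l// mulrAC ltr_pdivrMr//.
by rewrite ltr_pM2l// ltrDl.
Qed.

(** A nonzero p dominates t w' for small t, and a nonzero slope w forces w' to be nonzero. Hence no
    coordinate can vanish close to a ray unless it vanishes on the whole ray; local polyhedrality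
    enters the proof in this scalar form. *)
Lemma ray_zero (p w : R) : exists2 d, 0 < d & forall t w' : R, 0 < t < d ->
  `|w' - w| < d -> p + t * w' = 0 -> p = 0 /\ w = 0.
Proof.
have [->|p0] := eqVneq p 0; first have [->|w0] := eqVneq w 0.
- by exists 1.
- exists `|w|; first by rewrite normr_gt0.
  move=> t w' /andP[t0 _] ww' /eqP; rewrite add0r mulf_eq0 gt_eqF//= => /eqP w'0.
  by move: ww'; rewrite w'0 sub0r normrN ltxx.
- have w1 : 0 < `|w| + 1 by rewrite ltr_wpDl.
  exists (Num.min 1 (`|p| / (`|w| + 1))).
    by rewrite lt_min ltr01 divr_gt0// normr_gt0.
  move=> t w' /andP[t0]; rewrite !lt_min => /andP[_ tp] /andP[ww' _] /eqP.
  rewrite addr_eq0 => /eqP pE; move: tp; rewrite ltr_pdivlMr// pE normrN normrM.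
  rewrite gtr0_norm// ltr_pM2l// ltNge => /negP[].
  rewrite -(subrK w w') addrC; apply: (le_trans (ler_normD _ _)).
  by rewrite lerD2l ltW.
Qed.

Lemma ray_zero_mx m (p w : 'cV[R]_m) : exists2 d, 0 < d &
  forall (t : R) (w' : 'cV[R]_m), 0 < t < d -> `|w' - w| < d ->
    forall i, (p + t *: w') i 0 = 0 -> p i 0 = 0 /\ w i 0 = 0.
Proof.
have /choice[d dP] i : exists d : R, 0 < d /\ forall t w' : R, 0 < t < d ->
    `|w' - w i 0| < d -> p i 0 + t * w' = 0 -> p i 0 = 0 /\ w i 0 = 0.
  by have [d d0 dP] := ray_zero (p i 0) (w i 0); exists d.
have [r r0 rd] := common_radius (fun i => (dP i).1).
exists r => // t w' /andP[t0 tr] w'r i; rewrite !mxE.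
apply: (dP i).2; first by rewrite t0 (lt_le_trans tr).
have := norm_coord (w' - w) i; rewrite !mxE => /le_lt_trans; apply.
exact: lt_le_trans w'r (rd i).
Qed.

Lemma ray_nonpos (p w : R) : p <= 0 -> (p = 0 -> w <= 0) ->
  exists2 d, 0 < d & forall t : R, 0 < t < d -> p + t * w <= 0.
Proof.
rewrite le_eqVlt => /orP[/eqP -> /(_ erefl) w0|p0 _].
  by exists 1 => // t /andP[t0 _]; rewrite add0r pmulr_rle0.
have w1 : 0 < `|w| + 1 by rewrite ltr_wpDl.
exists (- p / (`|w| + 1)); first by rewrite divr_gt0// oppr_gt0.
move=> t /andP[t0]; rewrite ltr_pdivlMr// => tp.
rewrite -lerBrDl sub0r (le_trans _ (ltW tp))// ler_pM2l//.
by rewrite (le_trans (ler_norm w))// lerDl.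
Qed.

Lemma ray_nonpos_mx m (p w : 'cV[R]_m) : (forall i, p i 0 <= 0) ->
  (forall i, p i 0 = 0 -> w i 0 <= 0) ->
  exists2 d, 0 < d & forall t : R, 0 < t < d -> forall i, (p + t *: w) i 0 <= 0.
Proof.
move=> p0 w0; have /choice[d dP] i : exists d : R, 0 < d /\
    forall t : R, 0 < t < d -> p i 0 + t * w i 0 <= 0.
  by have [d d0 dP] := ray_nonpos (p0 i) (w0 i); exists d.
have [r r0 rd] := common_radius (fun i => (dP i).1).
exists r => // t /andP[t0 tr] i; rewrite !mxE; apply: (dP i).2.
by rewrite t0 (lt_le_trans tr).
Qed.

Context {l : nat}.
Implicit Types p q wp wq vp vq : 'cV[R]_l.

(** The test point p - e_i gives q_i >= 0, and p with its i-th coordinate cleared gives p_i q_i >=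
    0, the opposite sign being automatic. *)
Lemma N_PE p q : N_P p q <->
  forall i, [/\ p i 0 <= 0, 0 <= q i 0 & p i 0 * q i 0 = 0].
Proof.
split=> [[p0 pq] i|pq]; last first.
  split=> [i|p' p'0]; first by have [] := pq i.
  rewrite dotBr subr_le0; apply: ler_sum => i _.
  have [_ q0 pqi] := pq i; rewrite [leRHS]mulrC pqi.
  by rewrite mulr_ge0_le0.
have pi0 := p0 i; have q0 : 0 <= q i 0.
  have := pq (p - delta_mx i 0); rewrite addrAC subrr add0r dotNr dot_delta.
  rewrite oppr_le0; apply=> j; rewrite !mxE subr_le0 (le_trans (p0 j))//.
split=> //; apply/eqP; rewrite eq_le mulr_le0_ge0//=.
have := pq (p - p i 0 *: delta_mx i 0).
rewrite addrAC subrr add0r dotNr dotZr dot_delta oppr_le0; apply=> j.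
rewrite !mxE eqxx andbT; have [->|ji] := eqVneq j i; first by rewrite mulr1 subrr.
by rewrite mulr0 subr0.
Qed.

Lemma graphE m (M : 'cV[R]_l -> set 'cV[R]_m) p (q : 'cV[R]_m) :
  graph M (col_mx p q) = M p q.
Proof. by rewrite /graph/= col_mxKu col_mxKd. Qed.

Lemma graph_N_P p q : graph (@N_P R l) (col_mx p q) <->
  forall i, [/\ p i 0 <= 0, 0 <= q i 0 & p i 0 * q i 0 = 0].
Proof. by rewrite graphE; exact: N_PE. Qed.

(** For (p, q) in the graph this is its tangent cone, by [gph_ray_tangent] and
    [tangent_gph_direction]. The disjunction selects, for each coordinate, the branch of the
    complementarity angle along which the pair moves. *)
Definition gph_direction p q wp wq := forall i,
  [/\ p i 0 = 0 -> wp i 0 <= 0, q i 0 = 0 -> 0 <= wq i 0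
    & (p i 0 = 0 /\ wp i 0 = 0) \/ (q i 0 = 0 /\ wq i 0 = 0)].

Lemma gph_ray p q wp wq : N_P p q -> gph_direction p q wp wq ->
  exists2 d, 0 < d & forall t : R, 0 < t < d ->
    graph (@N_P R l) (col_mx p q + t *: col_mx wp wq).
Proof.
move=> /N_PE pq w.
have [|i|d1 d10 d1P] := @ray_nonpos_mx _ p wp; first by move=> i; have [] := pq i.
  by have [] := w i.
have [i|i|d2 d20 d2P] := @ray_nonpos_mx _ (- q) (- wq).
- by have [_ q0 _] := pq i; rewrite mxE oppr_le0.
- rewrite !mxE => /eqP; rewrite oppr_eq0 oppr_le0 => /eqP.
  by have [] := w i.
exists (Num.min d1 d2) => [|t]; first by rewrite lt_min d10.
rewrite lt_min => /and3P[t0 td1 td2].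
rewrite scale_col_mx add_col_mx; apply/graph_N_P => i.
have Hp := d1P t _ i; have Hq := d2P t _ i; rewrite t0 td1 td2 in Hp Hq.
split; first exact: Hp.
  by have := Hq isT; rewrite !mxE mulrN -opprD oppr_le0.
have [_ _ [[p0 wp0]|[q0 wq0]]] := w i; rewrite !mxE.
  by rewrite p0 wp0 mulr0 addr0 mul0r.
by rewrite q0 wq0 mulr0 addr0 mulr0.
Qed.

Lemma gph_ray_tangent p q wp wq : N_P p q -> gph_direction p q wp wq ->
  tangent_cone (graph (@N_P R l)) (col_mx p q) (col_mx wp wq).
Proof.
move=> pq w; have [d d0 dP] := gph_ray pq w.
exists (fun k => d / 2 * k.+1%:R^-1), (fun=> col_mx wp wq); split.
- by move=> k; rewrite !mulr_gt0// invr_gt0.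
- rewrite -[X in _ --> X](mulr0 (d / 2)); apply: cvgMl_tmp; exact: cvg_harmonic.
- exact: cvg_cst.
- move=> k; apply: dP; rewrite !mulr_gt0 ?invr_gt0//=.
  rewrite (@le_lt_trans _ _ (d / 2))//.
    by rewrite ler_piMr ?divr_ge0 ?(ltW d0)// invf_le1 ?ler1n.
  by rewrite ltr_pdivrMr// ltr_pMr// ltr1n.
Qed.

(* Near the ray through w, the graph meets only the faces containing w. *)
Lemma gph_near_ray p q wp wq : exists2 d, 0 < d &
  forall (t : R) (vp vq : 'cV[R]_l), 0 < t < d ->
    `|col_mx vp vq - col_mx wp wq| < d -> forall i,
    ((p + t *: vp) i 0 = 0 -> p i 0 = 0 /\ wp i 0 = 0) /\
    ((q + t *: vq) i 0 = 0 -> q i 0 = 0 /\ wq i 0 = 0).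
Proof.
have [d d0 dP] := ray_zero_mx (col_mx p q) (col_mx wp wq).
exists d => // t vp vq td vd i; split.
  by have := dP t _ td vd (lshift l i); rewrite scale_col_mx add_col_mx !col_mxEu.
by have := dP t _ td vd (rshift l i); rewrite scale_col_mx add_col_mx !col_mxEd.
Qed.

(** One factor of the vanishing product is zero, and the two implications propagate this zero to the
    base point and to w. The face so found is common to w and v, which permits interpolating between
    them. *)
Lemma gph_face p q wp wq (t : R) vp vq i :
  graph (@N_P R l) (col_mx p q + t *: col_mx vp vq) ->
  ((p + t *: vp) i 0 = 0 -> p i 0 = 0 /\ wp i 0 = 0) ->
  ((q + t *: vq) i 0 = 0 -> q i 0 = 0 /\ wq i 0 = 0) -> 0 < t ->
  [/\ p i 0 = 0 -> vp i 0 <= 0, q i 0 = 0 -> 0 <= vq i 0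
    & [/\ p i 0 = 0, wp i 0 = 0 & vp i 0 = 0] \/
      [/\ q i 0 = 0, wq i 0 = 0 & vq i 0 = 0]].
Proof.
rewrite scale_col_mx add_col_mx => /graph_N_P/(_ i)[Hp Hq /eqP H] Zp Zq t0.
split=> [p0|q0|].
- by move: Hp; rewrite !mxE p0 add0r pmulr_rle0.
- by move: Hq; rewrite !mxE q0 add0r pmulr_rge0.
move: H; rewrite mulf_eq0 => /orP[] /eqP H; [left|right].
  have [p0 w0] := Zp H; split=> //; move/eqP: H.
  by rewrite !mxE p0 add0r mulf_eq0 gt_eqF//= => /eqP.
have [q0 w0] := Zq H; split=> //; move/eqP: H.
by rewrite !mxE q0 add0r mulf_eq0 gt_eqF//= => /eqP.
Qed.

Lemma tangent_gph_direction p q wp wq :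
  tangent_cone (graph (@N_P R l)) (col_mx p q) (col_mx wp wq) ->
  gph_direction p q wp wq.
Proof.
move=> [t [u [t0 tc uw uD]]] i.
have [d d0 dP] := gph_near_ray p q wp wq.
have face k : 0 < t k < d -> `|u k - col_mx wp wq| < d ->
    (p i 0 = 0 /\ wp i 0 = 0) \/ (q i 0 = 0 /\ wq i 0 = 0).
  have := uD k; rewrite -[u k]vsubmxK => Dk tk uk.
  have [Zp Zq] := dP _ _ _ tk uk i.
  by have [_ _ [[? ? _]|[? ? _]]] := gph_face Dk Zp Zq (t0 k); [left|right].
have [k0 k0P] : exists k0, forall k, (k0 <= k)%N -> 0 < t k < d /\
    `|u k - col_mx wp wq| < d.
  have : \forall k \near \oo, `|0 - t k| < d /\ `|col_mx wp wq - u k| < d.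
    by near=> k; split; near: k; [move/cvgrPdist_lt : tc|move/cvgrPdist_lt : uw];
      apply.
  case=> k0 _ k0P; exists k0 => k /k0P[]; rewrite sub0r normrN gtr0_norm//.
  by rewrite distrC t0.
have [F1 F2] := k0P _ (leqnn k0).
have F3 := face _ F1 F2; split=> //.
- move=> p0; rewrite -oppr_ge0.
  have uwi : (u k (lshift l i) 0 : R) @[k --> \oo] --> wp i 0.
    by rewrite -(col_mxEu wp wq); exact: cvg_coord.
  apply: (cvg_ge0_approx (b := fun=> 0) (cvgN uwi)) => [|k]; first exact: cvg_cst.
  rewrite oppr0 oppr_ge0.
  have := uD k; rewrite -[u k]vsubmxK scale_col_mx add_col_mx.
  move=> /graph_N_P/(_ i)[+ _ _]; rewrite col_mxEu !mxE p0 add0r.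
  by rewrite pmulr_rle0.
- move=> q0; have uwi : (u k (rshift l i) 0 : R) @[k --> \oo] --> wq i 0.
    by rewrite -(col_mxEd wp wq); exact: cvg_coord.
  apply: (cvg_ge0_approx (b := fun=> 0) uwi) => [|k]; first exact: cvg_cst.
  rewrite oppr0.
  have := uD k; rewrite -[u k]vsubmxK scale_col_mx add_col_mx.
  move=> /graph_N_P/(_ i)[_ + _]; rewrite col_mxEd !mxE q0 add0r.
  by rewrite pmulr_rge0.
Unshelve. all: by end_near. Qed.

End ComplementarityGraph.

Section ComplementarityNormals.
Context {R : realType} {l : nat}.
Implicit Types p q wp wq vp vq kp kq : 'cV[R]_l.

(** A nearby feasible direction shares a face with w, and faces are convex cones. So the tangent
    cone contains the segment from w towards it as well as the one from w along w itself;
    [regular_normal_le0] on both gives two nonpositive pairings whose sum is the claim. *)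
Lemma regular_normal_tangent_gph p q wp wq v : N_P p q ->
  regular_normal_cone (tangent_cone (graph (@N_P R l)) (col_mx p q))
    (col_mx wp wq) v ->
  exists2 d, 0 < d & forall (t : R) vp vq, 0 < t < d ->
    `|col_mx vp vq - col_mx wp wq| < d ->
    graph (@N_P R l) (col_mx p q + t *: col_mx vp vq) ->
    dot v (col_mx vp vq) <= 0.
Proof.
move=> pq nv; have w := tangent_gph_direction nv.1.
have [d d0 dP] := gph_near_ray p q wp wq.
exists d => // t vp vq td vd Dv; have t0 : 0 < t by case/andP: td.
have vw : dot v (col_mx vp vq - col_mx wp wq) <= 0.
  apply: (regular_normal_le0 ltr01 _ nv) => s /andP[s0 s1].
  rewrite opp_col_mx add_col_mx scale_col_mx add_col_mx.
  apply: gph_ray_tangent => // i.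
  have [Zp Zq] := dP _ _ _ td vd i.
  have [wp0 wq0 _] := w i; have [vp0 vq0 vpq] := gph_face Dv Zp Zq t0.
  rewrite !mxE; split.
  - move=> /[dup] /wp0 ? /vp0 ?; nra.
  - move=> /[dup] /wq0 ? /vq0 ?; nra.
  - by case: vpq => -[-> -> ->]; [left|right]; rewrite subrr mulr0 addr0.
have ww : dot v (col_mx wp wq) <= 0.
  apply: (regular_normal_le0 ltr01 _ nv) => s /andP[s0 _].
  rewrite scale_col_mx add_col_mx; apply: gph_ray_tangent => // i.
  have [wp0 wq0 wpq] := w i; rewrite !mxE; split.
  - move=> /wp0 ?; nra.
  - move=> /wq0 ?; nra.
  - by case: wpq => -[-> ->]; [left|right]; rewrite mulr0 addr0.
by rewrite -(subrK (col_mx wp wq) (col_mx vp vq)) dotDr; lra.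
Qed.

Lemma gph_shrink p q kp kq : graph (@N_P R l) (col_mx p q) ->
  (forall i, p i 0 = 0 -> kp i 0 = 0) -> (forall i, q i 0 = 0 -> kq i 0 = 0) ->
  exists2 s0, 0 < s0 & forall s : R, 0 < s < s0 ->
    graph (@N_P R l) (col_mx p q - s *: col_mx kp kq).
Proof.
move=> Dpq kp0 kq0; have pq := (N_PE p q).1; rewrite graphE in Dpq.
have [s0 s00 sP] : exists2 s0, 0 < s0 & forall s : R, 0 < s < s0 ->
    graph (@N_P R l) (col_mx p q + s *: col_mx (- kp) (- kq)).
  apply: gph_ray => // i; have [_ _ pqi] := pq Dpq i; rewrite !mxE; split.
  - by move=> /kp0 ->; rewrite oppr0.
  - by move=> /kq0 ->; rewrite oppr0.
  - move/eqP: pqi; rewrite mulf_eq0 => /orP[] /eqP /[dup] i0.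
      by move=> /kp0 ->; left; rewrite oppr0.
    by move=> /kq0 ->; right; rewrite oppr0.
by exists s0 => // s /sP; rewrite -opp_col_mx scalerN.
Qed.

(** For small t, a coordinate vanishing at the point has zero base value and zero slope, hence a
    zero entry in k, and stays zero when k shrinks. The nonzero coordinates keep their sign for
    small s. *)
Lemma gph_conic p q wp wq (r : R) : exists2 d, 0 < d & forall (t : R) kp kq,
  0 < t < d -> `|col_mx kp kq| <= r ->
  graph (@N_P R l) (col_mx p q + t *: col_mx wp wq + t ^+ 2 *: col_mx kp kq) ->
  exists2 s0, 0 < s0 & forall s : R, 0 < s < s0 ->
    graph (@N_P R l)
      (col_mx p q + t *: col_mx wp wq + t ^+ 2 *: ((1 - s) *: col_mx kp kq)).
Proof.
have [d d0 dP] := gph_near_ray p q wp wq.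
have r0 : 0 < `|r| + 1 by rewrite ltr_wpDl.
exists (Num.min d (d / (`|r| + 1))); first by rewrite lt_min d0 divr_gt0.
move=> t kp kq; rewrite lt_min => /and3P[t0 td]; rewrite ltr_pdivlMr// => tr kr.
have tE x y : col_mx p q + t *: col_mx wp wq + t ^+ 2 *: col_mx x y =
    col_mx p q + t *: col_mx (wp + t *: x) (wq + t *: y).
  by rewrite -add_col_mx scalerDr -scale_col_mx scalerA -expr2 addrA.
rewrite tE => Dk.
have tk : `|col_mx (wp + t *: kp) (wq + t *: kq) - col_mx wp wq| < d.
  rewrite -add_col_mx addrAC subrr add0r -scale_col_mx normrZ gtr0_norm//.
  apply: le_lt_trans tr; rewrite ler_wpM2l ?(ltW t0)//.
  by rewrite (le_trans kr)// (le_trans (ler_norm r))// lerDl.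
have tt0 : 0 < t < d by rewrite t0 td.
have Z i := dP t _ _ tt0 tk i.
have [|||s0 s00 sP] := @gph_shrink (p + t *: (wp + t *: kp))
    (q + t *: (wq + t *: kq)) (t ^+ 2 *: kp) (t ^+ 2 *: kq).
- by rewrite -add_col_mx -scale_col_mx.
- move=> i /[dup] H /((Z i).1)[p0 w0]; move/eqP: H.
  by rewrite !mxE p0 w0 !add0r mulrA -expr2 => /eqP.
- move=> i /[dup] H /((Z i).2)[q0 w0]; move/eqP: H.
  by rewrite !mxE q0 w0 !add0r mulrA -expr2 => /eqP.
exists s0 => // s /sP.
rewrite -add_col_mx -scale_col_mx -tE -!scale_col_mx scalerBl scale1r scalerBr.
by rewrite addrA !scalerA (mulrC s).
Qed.

Context {n2 : nat}.

(* Coordinates: value of the objective, residual of the generalized equation,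
   pair (psi(z), eta). *)
Definition target (c : R) : set 'cV[R]_(1 + (n2 + (l + l))) :=
  [set k | [/\ usubmx k 0 0 <= c, usubmx (dsubmx k) = 0
             & graph (@N_P R l) (dsubmx (dsubmx k))]].

Lemma targetE c (a : 'cV[R]_1) (b : 'cV[R]_n2) (k : 'cV[R]_(l + l)) :
  target c (col_mx a (col_mx b k)) <->
  [/\ a 0 0 <= c, b = 0 & graph (@N_P R l) k].
Proof. by rewrite /target/= !(col_mxKu, col_mxKd). Qed.

Lemma closed_coord m (i : 'I_m) (A : set R) :
  closed A -> closed [set k : 'cV[R]_m | A (k i 0)].
Proof.
by apply: (continuous_closedP _).1; exact: continuous_coord.
Qed.

Lemma target_closed c : closed (target c).
Proof.
pose ip i : 'I_(1 + (n2 + (l + l))) := rshift 1 (rshift n2 (lshift l i)).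
pose iq i : 'I_(1 + (n2 + (l + l))) := rshift 1 (rshift n2 (rshift l i)).
have -> : target c = [set k | k (lshift _ 0) 0 <= c] `&`
    (\bigcap_(i in setT) [set k | k (rshift 1 (lshift (l + l) i)) 0 = 0]) `&`
    (\bigcap_(i in setT) ([set k | k (ip i) 0 <= 0] `&`
      ([set k | 0 <= k (iq i) 0] `&` [set k | k (ip i) 0 * k (iq i) 0 = 0]))).
  apply/seteqP; split=> k; rewrite -[k]vsubmxK -[dsubmx k]vsubmxK.
    rewrite -[dsubmx (dsubmx k)]vsubmxK => /targetE[kc k0 /graph_N_P kD].
    split; [split|] => /=.
    - by rewrite col_mxEu.
    - by move=> i _ /=; rewrite col_mxEd col_mxEu k0 mxE.
    - move=> i _ /=; rewrite !(col_mxEu, col_mxEd) /=.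
      by have [] := kD i.
  rewrite -[dsubmx (dsubmx k)]vsubmxK => -[[/= kc k0] kD]; apply/targetE; split.
  - by rewrite col_mxEu in kc.
  - apply/matrixP => i j; rewrite ord1 [RHS]mxE.
    by have /= := k0 i I; rewrite col_mxEd col_mxEu.
  - apply/graph_N_P => i.
    by have /= := kD i I; rewrite !(col_mxEu, col_mxEd) => -[? []].
apply: closedI; first apply: closedI.
- exact: (closed_coord (@closed_le R c)).
- by apply: closed_bigI => i _; exact: (closed_coord (@closed_eq R 0)).
- apply: closed_bigI => i _; apply: closedI; last apply: closedI.
  + exact: (closed_coord (@closed_le R 0)).
  + exact: (closed_coord (@closed_ge R 0)).
  + have cM : continuous (fun k : 'cV[R]_(1 + (n2 + (l + l))) =>
        k (ip i) 0 * k (iq i) 0).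
      by move=> k; apply: continuousM; exact: continuous_coord.
    exact: ((continuous_closedP _).1 cM _ (@closed_eq R 0)).
Qed.

End ComplementarityNormals.

(** * Ray and shrinking properties of the target set *)

Section LiftedProblem.
Context {R : realType} {l n2 : nat}.

Lemma sublevel_conic (w r : R) : exists2 d, 0 < d & forall t k : R,
  0 < t < d -> `|k| <= r -> t * w + t ^+ 2 * k <= 0 ->
  exists2 s0, 0 < s0 & forall s : R, 0 < s < s0 ->
    t * w + t ^+ 2 * ((1 - s) * k) <= 0.
Proof.
have [d d0 dP] := ray_zero 0 w.
have r0 : 0 < `|r| + 1 by rewrite ltr_wpDl.
exists (Num.min d (d / (`|r| + 1))); first by rewrite lt_min d0 divr_gt0.
move=> t k; rewrite lt_min => /and3P[t0 td]; rewrite ltr_pdivlMr// => tr kr tk.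
(* Only the boundary case needs an argument: if the left side is zero and t is small, then w = 0 by
   [ray_zero], so k contributes zero too. *)
have [|s0 s00 sP] := @ray_nonpos R _ (- (t ^+ 2 * k)) tk.
  move=> E; have td0 : 0 < t < d by rewrite t0.
  have [||_ w0] := dP t (w + t * k) td0.
  - rewrite addrAC subrr add0r normrM gtr0_norm//; apply: le_lt_trans tr.
    rewrite ler_wpM2l ?(ltW t0)// (le_trans kr)// (le_trans (ler_norm r))//.
    by rewrite lerDl.
  - by rewrite add0r mulrDr mulrA -expr2.
  by move: E; rewrite w0 mulr0 add0r => ->; rewrite oppr0.
exists s0 => // s /sP; congr (_ <= _); ring.
Qed.

Lemma target_ray (a w0 : 'cV[R]_1) (p q wp wq : 'cV[R]_l) : w0 0 0 <= 0 ->
  N_P p q -> gph_direction p q wp wq ->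
  exists2 d, 0 < d & forall t : R, 0 < t < d ->
    target (a 0 0) (col_mx a (col_mx (0 : 'cV[R]_n2) (col_mx p q)) +
      t *: col_mx w0 (col_mx 0 (col_mx wp wq))).
Proof.
move=> w00 pq w; have [d d0 dP] := gph_ray pq w.
exists d => // t td; rewrite !(scale_col_mx, add_col_mx); apply/targetE; split.
- by case/andP: td => t0 _; rewrite !mxE gerDl pmulr_rle0.
- by rewrite scaler0 addr0.
- by rewrite -!(scale_col_mx, add_col_mx); exact: dP.
Qed.

Lemma target_conic (a w0 : 'cV[R]_1) (p q wp wq : 'cV[R]_l) (r : R) :
  exists2 d, 0 < d & forall (t : R) k, 0 < t < d -> `|k| <= r ->
  target (a 0 0) (col_mx a (col_mx (0 : 'cV[R]_n2) (col_mx p q)) +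
    t *: col_mx w0 (col_mx 0 (col_mx wp wq)) + t ^+ 2 *: k) ->
  exists2 s0, 0 < s0 & forall s : R, 0 < s < s0 ->
    target (a 0 0) (col_mx a (col_mx (0 : 'cV[R]_n2) (col_mx p q)) +
      t *: col_mx w0 (col_mx 0 (col_mx wp wq)) + t ^+ 2 *: ((1 - s) *: k)).
Proof.
have [d1 d10 P1] := sublevel_conic (w0 0 0) r.
have [d2 d20 P2] := gph_conic p q wp wq r.
exists (Num.min d1 d2) => [|t k]; first by rewrite lt_min d10.
rewrite lt_min => /and3P[t0 td1 td2].
rewrite -[k]vsubmxK -[dsubmx k]vsubmxK -[dsubmx (dsubmx k)]vsubmxK.
move: (usubmx k) (usubmx (dsubmx k)) (usubmx (dsubmx (dsubmx k)))
  (dsubmx (dsubmx (dsubmx k))) => k0 kb kp kq {k} kr.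
have k0r : `|k0 0 0| <= r.
  have := norm_coord (col_mx k0 (col_mx kb (col_mx kp kq))) (lshift _ 0).
  by rewrite col_mxEu => /le_trans; apply.
have kpqr : `|col_mx kp kq| <= r.
  apply: le_trans kr; apply: norm_le_coord => // i.
  have := norm_coord (col_mx k0 (col_mx kb (col_mx kp kq))) (rshift 1 (rshift n2 i)).
  by rewrite !col_mxEd.
have E s x y (K : 'cV[R]_(l + l)) :
    col_mx a (col_mx 0 (col_mx p q)) + t *: col_mx w0 (col_mx 0 (col_mx wp wq)) +
      s *: col_mx x (col_mx y K) =
    col_mx (a + t *: w0 + s *: x)
      (col_mx (s *: y) (col_mx p q + t *: col_mx wp wq + s *: K)).
  by rewrite !(scale_col_mx, add_col_mx) scaler0 !add0r.
rewrite E => /targetE[c0 cb cD].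
have [||s1 s10 sP1] := P1 t (k0 0 0) _ k0r; first by rewrite t0 td1.
  by move: c0; rewrite !mxE -addrA gerDl.
have [|s2 s20 sP2] := P2 t kp kq _ kpqr cD; first by rewrite t0 td2.
exists (Num.min s1 s2) => [|s]; first by rewrite lt_min s10.
rewrite lt_min => /and3P[s_gt0 ss1 ss2].
rewrite !(scale_col_mx (1 - s) k0) (scale_col_mx (1 - s) kb) E.
apply/targetE; split.
- by rewrite !mxE -addrA gerDl sP1// s_gt0 ss1.
- by rewrite scalerA mulrC -scalerA cb scaler0.
- by apply: sP2; rewrite s_gt0 ss2.
Qed.

End LiftedProblem.

(** * The lifted map *)

Section ColumnMaps.
Context {R : realType} {n : nat}.

Lemma Ck_col_mx k m1 m2 (g : 'cV[R]_n -> 'cV[R]_m1) (h : 'cV[R]_n -> 'cV[R]_m2) :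
  Ck k g -> Ck k h -> Ck k (fun z => col_mx (g z) (h z)).
Proof.
move=> cg ch; apply: Ck_mx => i j; case: (split_ordP i) => i' ->.
  rewrite [X in Ck k X](_ : _ = fun z => g z i' j); first exact: Ck_coord.
  by apply/funext => z; rewrite col_mxEu.
rewrite [X in Ck k X](_ : _ = fun z => h z i' j); first exact: Ck_coord.
by apply/funext => z; rewrite col_mxEd.
Qed.

Lemma derive_col_mx m1 m2 (g : 'cV[R]_n -> 'cV[R]_m1) (h : 'cV[R]_n -> 'cV[R]_m2)
    z v : differentiable g z -> differentiable h z ->
  'D_v (fun z => col_mx (g z) (h z)) z = col_mx ('D_v g z) ('D_v h z).
Proof.
move=> dg dh.
have gu i j : (fun z => col_mx (g z) (h z) (lshift m2 i) j) = (fun z => g z i j : R).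
  by apply/funext => x; rewrite col_mxEu.
have hd i j : (fun z => col_mx (g z) (h z) (rshift m1 i) j) = (fun z => h z i j : R).
  by apply/funext => x; rewrite col_mxEd.
rewrite derive_mx; last first.
  apply/derivable_mxP => i j; case: (split_ordP i) => i' ->.
    by rewrite gu; apply: diff_derivable; exact: differentiable_comp (differentiable_coord _ _ _).
  by rewrite hd; apply: diff_derivable; exact: differentiable_comp (differentiable_coord _ _ _).
apply/matrixP => i j; rewrite mxE; case: (split_ordP i) => i' ->.
  by rewrite gu derive_coord// col_mxEu.
by rewrite hd derive_coord// col_mxEd.
Qed.

Lemma Ck_submx k m1 m2 (h : 'cV[R]_n -> 'cV[R]_(m1 + m2)) : Ck k h ->
  Ck k (fun z => usubmx (h z)) /\ Ck k (fun z => dsubmx (h z)).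
Proof.
move=> ch; split; apply: Ck_mx => i j.
  rewrite [X in Ck k X](_ : _ = fun z => h z (lshift m2 i) j); first exact: Ck_coord.
  by apply/funext => z; rewrite mxE.
rewrite [X in Ck k X](_ : _ = fun z => h z (rshift m1 i) j); first exact: Ck_coord.
by apply/funext => z; rewrite mxE.
Qed.

Lemma Ck_const_mx k (f : 'cV[R]_n -> R) : Ck k f ->
  Ck k (fun z => const_mx (f z) : 'cV[R]_1).
Proof.
move=> cf; apply: Ck_mx => i j.
by rewrite [X in Ck k X](_ : _ = f)//; apply/funext => z; rewrite mxE.
Qed.

Lemma derive_const_mx (f : 'cV[R]_n -> R) z v : differentiable f z ->
  'D_v (fun z => const_mx (f z) : 'cV[R]_1) z = const_mx ('D_v f z).
Proof.
move=> df; have fE i j : (fun z => (const_mx (f z) : 'cV[R]_1) i j : R) = f.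
  by apply/funext => x; rewrite mxE.
rewrite derive_mx; last first.
  by apply/derivable_mxP => i j; rewrite fE; exact: diff_derivable.
by apply/matrixP => i j; rewrite !mxE fE.
Qed.

End ColumnMaps.

Section LiftedMap.
Context {R : realType} {n1 n2 l : nat}.
Context (f : 'cV[R]_(n1 + n2) -> R) (F : 'cV[R]_(n1 + n2) -> 'cV[R]_n2)
  (psi : 'cV[R]_(n1 + n2) -> 'cV[R]_l).
Context (f_C2 : Ck 2 f) (F_C2 : Ck 2 F) (psi_C2 : Ck 2 psi)
  (jac_y_psi_C2 : Ck 2 (jac_y psi)).

Lemma jac_y_mulmx z v : jac_y psi z *m v = 'D_(col_mx 0 v) psi z.
Proof.
rewrite -jac_mulmx; last exact: psi_C2.1.
by rewrite -[jac psi z]hsubmxK mul_row_col mulmx0 add0r.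
Qed.

Let upper (u : 'cV[R]_(n1 + n2 + l)) := usubmx u.
Let lower (u : 'cV[R]_(n1 + n2 + l)) := dsubmx u.

Lemma Ck_submx_id k : Ck k upper /\ Ck k lower.
Proof.
apply: Ck_submx; apply: (@Ck_linear _ _ _ _ id) => // x; exact: cvg_id.
Qed.

Lemma linear_upper : linear upper. Proof. by move=> a x y; exact: linearP. Qed.
Lemma linear_lower : linear lower. Proof. by move=> a x y; exact: linearP. Qed.

Lemma Ck_upper k (W : normedModType R) (h : 'cV[R]_(n1 + n2) -> W) :
  Ck k h -> Ck k (h \o upper).
Proof.
by apply: Ck_linear_comp; [exact: linear_upper|exact: (Ck_submx_id 0).1].
Qed.

Lemma derive_upper (W : normedModType R) (h : 'cV[R]_(n1 + n2) -> W) u w :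
  differentiable h (usubmx u) ->
  'D_w (h \o upper) u = 'D_(usubmx w) h (usubmx u).
Proof.
move=> dh; have := @diff_linear_comp _ _ _ _ upper h u linear_upper
  (Ck_submx_id 0).1 dh.
by case.
Qed.

Lemma derive_lower u w : 'D_w lower u = dsubmx w.
Proof.
have [dL dLE] := linear_diff linear_lower u (Ck_submx_id 0).2.
by rewrite deriveE ?dLE.
Qed.

Definition lifted_eq (u : 'cV[R]_(n1 + n2 + l)) : 'cV[R]_n2 :=
  F (usubmx u) + (jac_y psi (usubmx u))^T *m dsubmx u.

Definition lifted (u : 'cV[R]_(n1 + n2 + l)) : 'cV[R]_(1 + (n2 + (l + l))) :=
  col_mx (const_mx (f (usubmx u)))
    (col_mx (lifted_eq u) (col_mx (psi (usubmx u)) (dsubmx u))).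

Lemma lifted_eq_C2 : Ck 2 lifted_eq.
Proof.
exact: (CkD (Ck_upper F_C2)
  (Ck_mulmx_tr (Ck_upper jac_y_psi_C2) (Ck_submx_id 2).2)).
Qed.

Lemma lifted_C2 : Ck 2 lifted.
Proof.
apply: Ck_col_mx; first exact: (Ck_const_mx (Ck_upper f_C2)).
apply: Ck_col_mx; first exact: lifted_eq_C2.
by apply: Ck_col_mx; [exact: (Ck_upper psi_C2)|exact: (Ck_submx_id 2).2].
Qed.

Lemma derive_lifted_eq u w : 'D_w lifted_eq u =
  'D_(usubmx w) F (usubmx u) +
  (('D_(usubmx w) (jac_y psi) (usubmx u))^T *m dsubmx u +
   (jac_y psi (usubmx u))^T *m dsubmx w).
Proof.
have dlow := (Ck_submx_id 1).2.1.
have dJ := (Ck_upper jac_y_psi_C2).1; have dF := (Ck_upper F_C2).1.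
have dM : differentiable (fun u => (jac_y psi (usubmx u))^T *m dsubmx u) u.
  have [+ _] := Ck_mulmx_tr (CkS (Ck_upper jac_y_psi_C2)) (Ck_submx_id 1).2.
  exact.
rewrite [LHS](@deriveD _ _ _ (F \o upper)
  (fun u => (jac_y psi (usubmx u))^T *m dsubmx u)); last 2 first.
- exact: diff_derivable.
- exact: diff_derivable.
rewrite derive_upper; last exact: F_C2.1.
congr (_ + _).
rewrite [LHS](@derive_mulmx_tr _ _ _ _ (jac_y psi \o upper) lower)//.
by rewrite derive_lower derive_upper//; exact: jac_y_psi_C2.1.
Qed.

(** The multiplier enters linearly, so there is no pure second derivative in it; the mixed
    derivative occurs twice, whence the factor 2. *)
Lemma derive2_lifted_eq u w : 'D_w ('D_w lifted_eq) u =
  'D_(usubmx w) ('D_(usubmx w) F) (usubmx u) +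
  (('D_(usubmx w) ('D_(usubmx w) (jac_y psi)) (usubmx u))^T *m dsubmx u) +
  2%:R *: (('D_(usubmx w) (jac_y psi) (usubmx u))^T *m dsubmx w).
Proof.
set d := usubmx w; set e := dsubmx w.
have cF1 : Ck 1 ('D_d F) by exact: F_C2.2.
have cJ1 : Ck 1 ('D_d (jac_y psi)) by exact: jac_y_psi_C2.2.
have clow : Ck 1 lower := (Ck_submx_id 1).2; have cJ := CkS jac_y_psi_C2.
have ce : Ck 1 (fun _ : 'cV[R]_(n1 + n2 + l) => e) by exact: Ck_cst.
pose A := 'D_d F \o upper.
pose B u := (('D_d (jac_y psi) \o upper) u)^T *m lower u.
pose C u := ((jac_y psi \o upper) u)^T *m (fun=> e) u.
have cA : Ck 1 A by exact: (Ck_upper cF1).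
have cB : Ck 1 B := Ck_mulmx_tr (Ck_upper cJ1) clow.
have cC : Ck 1 C := Ck_mulmx_tr (Ck_upper cJ) ce.
have -> : 'D_w lifted_eq = A + (B + C).
  by apply/funext => v; rewrite derive_lifted_eq.
have dA := cA.1 u; have dB := cB.1 u; have dC := cC.1 u.
rewrite deriveD; last 2 first.
- exact: diff_derivable.
- exact: diff_derivable (differentiableD dB dC).
rewrite deriveD; [|exact: diff_derivable|exact: diff_derivable].
rewrite derive_upper; last exact: cF1.1.
rewrite (derive_mulmx_tr _ ((Ck_upper cJ1).1 u) (clow.1 u)).
rewrite (derive_mulmx_tr _ ((Ck_upper cJ).1 u) (ce.1 u)) derive_cst mulmx0 addr0.
rewrite derive_lower derive_upper; last exact: cJ1.1.
rewrite derive_upper; last exact: cJ.1.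
by rewrite -/d -/e scaler_nat mulr2n /= -!addrA.
Qed.

Lemma F_eta_C2 eta : Ck 2 (F_eta F psi eta).
Proof.
have ceta : Ck 2 (fun _ : 'cV[R]_(n1 + n2) => eta) by exact: Ck_cst.
have H := CkD F_C2 (Ck_mulmx_tr jac_y_psi_C2 ceta).
exact: H.
Qed.

Lemma derive_F_eta eta z d :
  'D_d (F_eta F psi eta) z = 'D_d F z + ('D_d (jac_y psi) z)^T *m eta.
Proof.
have ceta : Ck 2 (fun _ : 'cV[R]_(n1 + n2) => eta) by exact: Ck_cst.
have cM := Ck_mulmx_tr jac_y_psi_C2 ceta.
rewrite [LHS](deriveD (f := F)); last 2 first.
- exact: diff_derivable (F_C2.1 z).
- exact: diff_derivable (cM.1 z).
rewrite derive_mulmx_tr; [|exact: jac_y_psi_C2.1|exact: differentiable_cst].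
by rewrite derive_cst mulmx0 addr0.
Qed.

Lemma derive2_F_eta eta z d : 'D_d ('D_d (F_eta F psi eta)) z =
  'D_d ('D_d F) z + ('D_d ('D_d (jac_y psi)) z)^T *m eta.
Proof.
pose M z := ('D_d (jac_y psi) z)^T *m (fun=> eta) z.
have ceta : Ck 1 (fun _ : 'cV[R]_(n1 + n2) => eta) by exact: Ck_cst.
have cM : Ck 1 M := Ck_mulmx_tr (Ck_derive d jac_y_psi_C2) ceta.
have -> : 'D_d (F_eta F psi eta) = 'D_d F + M.
  by apply/funext => x; rewrite derive_F_eta.
rewrite deriveD; last 2 first.
- exact: diff_derivable ((F_C2.2 d).1 z).
- exact: diff_derivable (cM.1 z).
rewrite derive_mulmx_tr; [|exact: (jac_y_psi_C2.2 d).1|exact: differentiable_cst].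
by rewrite derive_cst mulmx0 addr0.
Qed.

Lemma derive_lifted u w : 'D_w lifted u =
  col_mx (const_mx ('D_(usubmx w) f (usubmx u)))
    (col_mx ('D_w lifted_eq u) (col_mx ('D_(usubmx w) psi (usubmx u)) (dsubmx w))).
Proof.
have d1 := (Ck_upper f_C2).1; have d2 := lifted_eq_C2.1.
have d3 := (Ck_upper psi_C2).1; have d4 := (Ck_submx_id 1).2.1.
have c34 := Ck_col_mx (CkS (Ck_upper psi_C2)) (Ck_submx_id 1).2.
have c234 := Ck_col_mx (CkS lifted_eq_C2) c34.
rewrite [LHS](derive_col_mx _ ((CkS (Ck_const_mx (Ck_upper f_C2))).1 u) (c234.1 u)).
rewrite derive_const_mx// (derive_col_mx _ (d2 u) (c34.1 u)).
rewrite (derive_col_mx _ (d3 u) (d4 u)) derive_lower.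
rewrite derive_upper; last exact: f_C2.1.
by rewrite derive_upper//; exact: psi_C2.1.
Qed.

Lemma derive2_lifted u w : 'D_w ('D_w lifted) u =
  col_mx (const_mx ('D_(usubmx w) ('D_(usubmx w) f) (usubmx u)))
    (col_mx ('D_w ('D_w lifted_eq) u)
      (col_mx ('D_(usubmx w) ('D_(usubmx w) psi) (usubmx u)) 0)).
Proof.
set d := usubmx w; set e := dsubmx w.
have cf1 := Ck_upper (Ck_derive d f_C2); have ceq1 := Ck_derive w lifted_eq_C2.
have cpsi1 := Ck_upper (Ck_derive d psi_C2).
have ce : Ck 1 (fun _ : 'cV[R]_(n1 + n2 + l) => e) by exact: Ck_cst.
have c34 := Ck_col_mx cpsi1 ce; have c234 := Ck_col_mx ceq1 c34.
have -> : 'D_w lifted = fun u => col_mx (const_mx (('D_d f \o upper) u))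
    (col_mx ('D_w lifted_eq u) (col_mx (('D_d psi \o upper) u) e)).
  by apply/funext => v; rewrite derive_lifted.
rewrite (derive_col_mx _ ((Ck_const_mx cf1).1 u) (c234.1 u)).
rewrite (derive_const_mx _ (cf1.1 u)) (derive_col_mx _ (ceq1.1 u) (c34.1 u)).
rewrite (derive_col_mx _ (cpsi1.1 u) (ce.1 u)) derive_cst.
rewrite derive_upper; last exact: (f_C2.2 d).1.
by rewrite derive_upper//; exact: (psi_C2.2 d).1.
Qed.

Lemma derive_lifted_eq_col z eta d e : 'D_(col_mx d e) lifted_eq (col_mx z eta) =
  jac (F_eta F psi eta) z *m d + (jac_y psi z)^T *m e.
Proof.
rewrite derive_lifted_eq !(col_mxKu, col_mxKd) jac_mulmx; last exact: (F_eta_C2 _).1.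
by rewrite derive_F_eta addrA.
Qed.

Lemma derive2_lifted_eq_col z eta d e :
  'D_(col_mx d e) ('D_(col_mx d e) lifted_eq) (col_mx z eta) =
  curvature F psi z eta d e.
Proof.
rewrite derive2_lifted_eq !(col_mxKu, col_mxKd) /curvature d2vE; last exact: F_eta_C2.
by rewrite derive2_F_eta.
Qed.

End LiftedMap.

(** * Multipliers of the variational inequality *)

Section Multipliers.
Context {R : realType} {n1 n2 l : nat}.
Context (F : 'cV[R]_(n1 + n2) -> 'cV[R]_n2) (psi : 'cV[R]_(n1 + n2) -> 'cV[R]_l).
Context (psi_C2 : Ck 2 psi).

Section ConvexConstraints.
Context (psi_convex : forall (x : 'cV[R]_n1) (i : 'I_l),
     convex_function setT (fun y : 'cV[R]_n2 => psi (col_mx x y) i 0)).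

(** Comparing the convexity bound at parameter t with the first-order expansion and dividing by t
    leaves the gradient inequality up to an arbitrary [e]. *)
Lemma convex_gradient x y y' i :
  (jac_y psi (col_mx x y) *m (y' - y)) i 0 <=
  psi (col_mx x y') i 0 - psi (col_mx x y) i 0.
Proof.
rewrite jac_y_mulmx//; set v := col_mx 0 (y' - y); set z := col_mx x y.
apply/ler_addgt0Pr => e e0.
have [d d0 dP] := diff_expansion v (psi_C2.1 z) e0.
have [|t t0 tP] := @common_bound R [:: d; 1].
  by move=> a; rewrite !inE => /orP[] /eqP ->.
have td : t < d by apply: tP; rewrite !inE eqxx.
have t1 : t < 1 by apply: tP; rewrite !inE eqxx orbT.
have := dP t v _; rewrite t0 td subrr normr0 => /(_ isT d0).
move=> /(le_trans (norm_coord _ i)); rewrite !mxE ler_norml => /andP[H _].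
have cvx : psi (z + t *: v) i 0 <=
    t * psi (col_mx x y') i 0 + (1 - t) * psi z i 0.
  have := @psi_convex x i (Itv01 (ltW t0) (ltW t1)) y' y.
  rewrite !inE => /(_ I I); congr (_ <= _).
  congr (psi _ i 0); rewrite /z /v scale_col_mx add_col_mx scaler0 addr0.
  congr col_mx; rewrite /conv/= scalerBr scalerBl scale1r.
  by rewrite addrCA.
rewrite -(ler_pM2l t0) mulrDr.
move: H cvx; move: ('D_v psi z i 0) (psi (z + t *: v) i 0) => a b.
move: (psi z i 0) (psi (col_mx x y') i 0) => a' b'; lra.
Qed.

(** Where convexity enters: replacing F by the multiplier term, the gradient inequality bounds each
    summand by eta_i (psi_i(y') - psi_i(z)), and complementarity removes the second part. *)
Lemma KKT_feasible z eta : N_P (psi z) eta -> F z + (jac_y psi z)^T *m eta = 0 ->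
  MPVI_feasible F psi z.
Proof.
move=> /N_PE pq Feta; split; first by move=> i; rewrite vsubmxK; have [] := pq i.
move=> y' y'G; have /eqP := Feta; rewrite addr_eq0 => /eqP ->.
rewrite dotNl oppr_ge0 -dot_mulmx.
apply: sumr_le0 => i _; have [_ eta0 compl] := pq i.
have := convex_gradient (usubmx z) (dsubmx z) y' i; rewrite vsubmxK => grad_le.
apply: (le_trans (ler_wpM2l eta0 grad_le)).
by rewrite mulrBr [X in _ - X]mulrC compl subr0 mulr_ge0_le0// y'G.
Qed.

End ConvexConstraints.

(** Projection onto the active coordinates, as a matrix so that nondegeneracy becomes an inclusion
    of row spaces. *)
Definition active z : 'M[R]_l := diag_mx (\row_i ((psi z i 0 == 0)%:R : R)).

Lemma activeE z (a : 'cV[R]_l) :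
  (forall i, psi z i 0 != 0 -> a i 0 = 0) -> active z *m a = a.
Proof.
move=> az; apply/matrixP => i j; rewrite ord1 mul_diag_mx !mxE.
have [p0|p0] := eqVneq (psi z i 0) 0; first by rewrite mul1r.
by rewrite az// mul0r.
Qed.

Context (z : 'cV[R]_(n1 + n2)) (z_feasible : nonpos_orthant (psi z)).
Context (licq : forall ds : 'cV[R]_l,
     (jac_y psi z)^T *m ds = 0 -> plus_span (N_P (psi z)) ds -> ds = 0).

(** Positive and negative parts of [a] both lie in the normal cone, and [a] is their difference. *)
Lemma active_plus_span (a : 'cV[R]_l) :
  (forall i, psi z i 0 != 0 -> a i 0 = 0) -> plus_span (N_P (psi z)) a.
Proof.
move=> az; exists [:: a]; last by rewrite memv_span1.
move=> c; rewrite inE => /eqP ->.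
have part (b : 'cV[R]_l) : (forall i, 0 <= b i 0) ->
    (forall i, psi z i 0 != 0 -> b i 0 = 0) -> N_P (psi z) b.
  move=> b0 bz; apply/N_PE => i; split=> //.
  by have [->|/bz ->] := eqVneq (psi z i 0) 0; rewrite ?mul0r ?mulr0.
exists (\col_i Num.max (a i 0) 0).
  apply: part => i; rewrite mxE; first by rewrite le_max lexx orbT.
  by move=> /az ->; rewrite maxxx.
exists (\col_i Num.max (- a i 0) 0).
  apply: part => i; rewrite mxE; first by rewrite le_max lexx orbT.
  by move=> /az ->; rewrite oppr0 maxxx.
apply/matrixP => i j; rewrite ord1 !mxE.
have [a0|a0] := ltP (a i 0) 0.
  have -> : Num.max (- a i 0) 0 = - a i 0 by apply: max_l; rewrite oppr_ge0 ltW.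
  by rewrite sub0r opprK.
have -> : Num.max (- a i 0) 0 = 0 by apply: max_r; rewrite oppr_le0.
by rewrite subr0.
Qed.

(** By nondegeneracy the kernel of [A] is contained in that of [active z], so the rows of [active z]
    are combinations of the rows of [A], and B collects the coefficients. It serves for the
    existence of multipliers and for their convergence. *)
Lemma active_left_inverse : exists B : 'M[R]_(l, n2),
  forall a : 'cV[R]_l, (forall i, psi z i 0 != 0 -> a i 0 = 0) ->
    B *m ((jac_y psi z)^T *m a) = a.
Proof.
pose A := (jac_y psi z)^T *m active z.
have /submxP[B BE] : (active z <= A)%MS.
  rewrite submxE; apply/eqP/matrixP => i j; rewrite [RHS]mxE.
  set K := cokermx A; have AK : A *m K = 0 by exact: mulmx_coker.
  have /matrixP/(_ i 0) : active z *m col j K = 0.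
    apply: licq.
      by rewrite mulmxA -/A colE mulmxA AK mul0mx.
    apply: active_plus_span => k pk.
    by rewrite mul_diag_mx !mxE (negbTE pk) mul0r.
  by rewrite colE mulmxA -colE !mxE.
exists B => a az; rewrite -[in LHS](activeE az) (mulmxA _^T) -/A mulmxA -BE.
exact: activeE.
Qed.

(** By transposition, [B^T] solves for a direction in y with prescribed derivatives of the active
    constraints. *)
Lemma active_right_inverse (B : 'M[R]_(l, n2)) (c : 'cV[R]_l) i :
  (forall a : 'cV[R]_l, (forall i, psi z i 0 != 0 -> a i 0 = 0) ->
     B *m ((jac_y psi z)^T *m a) = a) ->
  psi z i 0 = 0 -> (jac_y psi z *m (B^T *m c)) i 0 = c i 0.
Proof.
move=> BP pi; have H k : psi z k 0 != 0 -> (delta_mx i 0 : 'cV[R]_l) k 0 = 0.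
  by rewrite mxE andbT; have [->|//] := eqVneq k i; rewrite pi eqxx.
rewrite -[LHS]dot_delta [LHS]dotC dot_mulmx dot_mulmx trmxK (BP _ H) dotC.
exact: dot_delta.
Qed.

Lemma licq_injective (a : 'cV[R]_l) : (forall i, psi z i 0 != 0 -> a i 0 = 0) ->
  (jac_y psi z)^T *m a = 0 -> a = 0.
Proof. by move=> az Ja; apply: licq => //; exact: active_plus_span. Qed.

Lemma N_P_inactive p q i : N_P p q -> p i 0 != 0 -> (q : 'cV[R]_l) i 0 = 0.
Proof.
move=> /N_PE/(_ i)[_ _ /eqP]; rewrite mulf_eq0 => /orP[/eqP ->|/eqP //].
by rewrite eqxx.
Qed.

Lemma multiplier_unique eta eta' : N_P (psi z) eta -> N_P (psi z) eta' ->
  0 = F z + (jac_y psi z)^T *m eta -> 0 = F z + (jac_y psi z)^T *m eta' ->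
  eta = eta'.
Proof.
move=> Neta Neta' E E'; apply/subr0_eq/licq_injective.
  by move=> i pi; rewrite !mxE (N_P_inactive Neta pi) (N_P_inactive Neta' pi) subrr.
have /addrI JE : F z + (jac_y psi z)^T *m eta = F z + (jac_y psi z)^T *m eta'.
  by rewrite -E -E'.
by rewrite mulmxBr JE subrr.
Qed.

Lemma vi_linearized w : MPVI_feasible F psi z ->
  (forall i, psi z i 0 = 0 -> (jac_y psi z *m w) i 0 <= 0) ->
  0 <= dot (F z) w.
Proof.
move=> [_ vi] Jw; have [B BP] := active_left_inverse.
(* All active constraints decrease at unit rate along [w1]. Adding s [w1] provides a slack s t that
   absorbs the expansion error of psi, so a short step stays in [Gamma]; s is tied to [e], which is
   arbitrary. *)
pose w1 : 'cV[R]_n2 := B^T *m const_mx (-1 : R).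
have Jw1 i : psi z i 0 = 0 -> (jac_y psi z *m w1) i 0 = -1.
  by move=> pi; rewrite (active_right_inverse _ BP pi) mxE.
apply/ler_addgt0Pr => e e0; pose c := `|dot (F z) w1| + 1.
have c0 : 0 < c by rewrite ltr_wpDl.
pose s := e / c; have s0 : 0 < s by rewrite divr_gt0.
pose v := col_mx 0 (w + s *: w1) : 'cV[R]_(n1 + n2).
have Dv : 'D_v psi z = jac_y psi z *m w + s *: (jac_y psi z *m w1).
  by rewrite /v -jac_y_mulmx// mulmxDr -scalemxAr.
have [d d0 dP] := diff_expansion v (psi_C2.1 z) s0.
have [i|d' d'0 d'P] := @ray_nonpos_mx _ _ (psi z) ('D_v psi z + const_mx s)
    z_feasible.
  move=> pi; rewrite Dv mxE [X in _ + X]mxE [X in X + _]mxE [X in _ + X + _]mxE.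
  by rewrite Jw1// mulrN1 subrK Jw.
have [|t t0 tP] := @common_bound R [:: d; d'].
  by move=> a; rewrite !inE => /orP[] /eqP ->.
have td : t < d by apply: tP; rewrite !inE eqxx.
have td' : t < d' by apply: tP; rewrite !inE eqxx orbT.
have yG : Gamma psi (usubmx z) (dsubmx z + t *: (w + s *: w1)).
  move=> i; have -> : col_mx (usubmx z) (dsubmx z + t *: (w + s *: w1)) = z + t *: v.
    by rewrite -[in RHS](vsubmxK z) scale_col_mx add_col_mx scaler0 addr0.
  have := d'P t _ i; rewrite t0 td' => /(_ isT); apply: le_trans.
  have := dP t v _; rewrite t0 td subrr normr0 => /(_ isT d0).
  move=> /(le_trans (norm_coord _ i)); rewrite !mxE ler_norml => /andP[_].
  by rewrite mulrDr [t * s]mulrC => H; lra.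
have := vi _ yG; rewrite addrAC subrr add0r dotZr pmulr_rge0// dotDr dotZr.
move=> /le_trans; apply; rewrite lerD2l.
apply: (@le_trans _ _ (s * c)); last by rewrite divfK// gt_eqF.
by rewrite ler_wpM2l ?(ltW s0)// (le_trans (ler_norm _))// lerDl.
Qed.

(** The candidate is - B F(z) restricted to the active set. Its signs come from [vi_linearized]
    tested on the directions - [B^T] e_i. *)
Lemma multiplier_exists : MPVI_feasible F psi z ->
  exists eta, N_P (psi z) eta /\ 0 = F z + (jac_y psi z)^T *m eta.
Proof.
move=> feas; have [B BP] := active_left_inverse.
pose Fb := B *m F z; pose eta := - (active z *m Fb).
have JB (c : 'cV[R]_l) i pi := @active_right_inverse B c i BP pi.
have etaE i : eta i 0 = if psi z i 0 == 0 then - Fb i 0 else 0.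
  rewrite mxE mul_diag_mx !mxE; case: eqP => _; first by rewrite mul1r.
  by rewrite mul0r oppr0.
exists eta; split.
  apply/N_PE => i; rewrite etaE; have [pi|pi] := eqVneq (psi z i 0) 0; last first.
    by split; rewrite ?mulr0// z_feasible.
  split; rewrite ?pi ?mul0r//.
  have -> : - Fb i 0 = dot (F z) (B^T *m - delta_mx i 0).
    by rewrite dot_mulmx trmxK dotNr dot_delta.
  apply: vi_linearized => // j pj; rewrite JB// !mxE oppr_le0.
  by case: (_ && _).
apply/esym/eqP; rewrite addr_eq0; apply/eqP/dot_ext => w.
(* Any w is split into w', along which the active constraints are stationary, and a correction. Both
   w' and - w' are admissible in [vi_linearized], so F(z) is orthogonal to w'. *)
pose c := jac_y psi z *m w; pose w' := w - B^T *m (active z *m c).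
have Jw' i : psi z i 0 = 0 -> (jac_y psi z *m w') i 0 = 0.
  move=> pi; rewrite mulmxBr mxE [X in _ + X]mxE JB// mul_diag_mx !mxE pi eqxx.
  by rewrite mul1r subrr.
have Fw' : dot (F z) w' = 0.
  apply/eqP; rewrite eq_le -oppr_ge0 -dotNr; apply/andP; split.
    apply: vi_linearized => // i pi.
    by rewrite mulmxN mxE Jw'// oppr0.
  by apply: vi_linearized => // i pi; rewrite Jw'.
rewrite -[w](subrK (B^T *m (active z *m c))) dotDr Fw' add0r.
rewrite dot_mulmx trmxK dot_mulmx tr_diag_mx -/(active z) subrK.
by rewrite dotNl -dot_mulmx -/c -dotNl opprK.
Qed.

End Multipliers.

(** * Second-order conditions *)

Section NormalsOfTarget.
Context {R : realType} {n2 l : nat}.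

Lemma regular_normalZ m (C : set 'cV[R]_m) z v (a : R) : 0 < a ->
  regular_normal_cone C z v -> regular_normal_cone C z (a *: v).
Proof.
move=> a0 [Cz vP]; split=> // e e0; have := vP (e / a) (divr_gt0 e0 a0).
apply: filterS => z' H /H; rewrite dotZl mulrAC ler_pdivlMr//.
by rewrite mulrC.
Qed.

Lemma dir_normalZ m (C : set 'cV[R]_m) z w v (a : R) : 0 < a ->
  dir_normal_cone C z w v -> dir_normal_cone C z w (a *: v).
Proof.
move=> a0 [t [u [v' [t0 tc uw v'v nv]]]].
exists t, u, (fun k => a *: v' k); split=> //; last by move=> k; exact: regular_normalZ.
exact: cvgZl_tmp.
Qed.

(** The target is a product, so one factor can be varied with the others frozen. The half-line fixes
    the sign of the first component, and the factor {0} leaves the second one free. *)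
Lemma target_regular_normal c (k y : 'cV[R]_(1 + (n2 + (l + l)))) :
  regular_normal_cone (target c) k y ->
  0 <= usubmx y 0 0 /\
  regular_normal_cone (graph (@N_P R l)) (dsubmx (dsubmx k)) (dsubmx (dsubmx y)).
Proof.
move=> ny; have := ny.1; have := ny.
rewrite -{1 2}[k]vsubmxK -{1 2}[dsubmx k]vsubmxK -{1 3}[y]vsubmxK -[dsubmx y]vsubmxK.
move: (usubmx k) (usubmx (dsubmx k)) (dsubmx (dsubmx k)) => k0 kb kD.
move: (usubmx y) (usubmx (dsubmx y)) (dsubmx (dsubmx y)) => y0 yb yD {}ny.
move=> /targetE[kc kb0 DkD]; split.
  rewrite -oppr_le0.
  have -> : - y0 0 0 = dot (col_mx y0 (col_mx yb yD)) (col_mx (- delta_mx 0 0) 0).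
    by rewrite dot_col_mx dot0r addr0 dotNr dot_delta.
  apply: (regular_normal_le0 ltr01 _ ny) => s /andP[s0 _].
  rewrite scale_col_mx add_col_mx scaler0 addr0; apply/targetE; split=> //.
  by rewrite !mxE /= mulrN mulr1 lerBlDr (le_trans kc)// lerDl ltW.
split=> // e e0; have [_ /(_ e e0)/nbhs_ballP[d /= d0 dP]] := ny.
apply/nbhs_ballP; exists d => //= k'; rewrite -ball_normE/= => kk' Dk'.
have := dP (col_mx k0 (col_mx kb k')).
have -> : col_mx k0 (col_mx kb k') - col_mx k0 (col_mx kb kD) =
    col_mx 0 (col_mx 0 (k' - kD)).
  by rewrite !(opp_col_mx, add_col_mx) !subrr.
rewrite ?col_mxKd /enorm !dot_col_mx !dot0r !add0r; apply; last by apply/targetE.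
rewrite -ball_normE/=.
have -> : col_mx k0 (col_mx kb kD) - col_mx k0 (col_mx kb k') =
    col_mx 0 (col_mx 0 (kD - k')).
  by rewrite !(opp_col_mx, add_col_mx) !subrr.
apply: le_lt_trans kk'; apply: norm_le_coord => // i.
case: (split_ordP i) => i' ->; first by rewrite col_mxEu mxE normr0.
rewrite col_mxEd; case: (split_ordP i') => j ->; first by rewrite col_mxEu mxE normr0.
by rewrite col_mxEd norm_coord.
Qed.

Lemma target_dir_normal c k w y : dir_normal_cone (target c) k w y ->
  0 <= usubmx y 0 0 /\
  dir_normal_cone (graph (@N_P R l)) (dsubmx (dsubmx k)) (dsubmx (dsubmx w))
    (dsubmx (dsubmx (y : 'cV[R]_(1 + (n2 + (l + l)))))).
Proof.
move=> [t [u [v [t0 tc uw vy nv]]]]; split.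
  have vy0 : (v k (lshift _ 0) 0 : R) @[k --> \oo] --> usubmx y 0 0.
    by rewrite mxE; exact: cvg_coord.
  apply: (cvg_ge0_approx (b := fun=> 0) vy0) => [|j]; first exact: cvg_cst.
  by rewrite oppr0; have [+ _] := target_regular_normal (nv j); rewrite mxE.
exists t, (fun j => dsubmx (dsubmx (u j))), (fun j => dsubmx (dsubmx (v j))).
split=> //; do ?exact/cvg_dsubmx/cvg_dsubmx.
move=> j; have [_] := target_regular_normal (nv j).
by rewrite !linearD/= !linearZ.
Qed.

(** Where p_i < 0 one has q_i = 0, and p_i can move both ways inside the graph; the two directions
    +1 and -1 force the component to vanish. *)
Lemma regular_normal_gph_inactive (p q : 'cV[R]_l) v i :
  regular_normal_cone (graph (@N_P R l)) (col_mx p q) v ->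
  p i 0 < 0 -> usubmx v i 0 = 0.
Proof.
move=> nv pi; have /graph_N_P D := nv.1; have pi' : 0 < - p i 0 by rewrite oppr_gt0.
have qi : q i 0 = 0.
  have [_ _ /eqP] := D i; rewrite mulf_eq0 => /orP[/eqP p0|/eqP //].
  by rewrite p0 ltxx in pi.
have move_i (e : R) : `|e| <= 1 -> e * usubmx v i 0 <= 0.
  move=> e1; rewrite -dot_delta -dotZr.
  have -> : dot (usubmx v) (e *: delta_mx i 0) = dot v (col_mx (e *: delta_mx i 0) 0).
    by rewrite -[in RHS](vsubmxK v) dot_col_mx dot0r addr0.
  apply: (regular_normal_le0 pi' _ nv) => s /andP[s0 sp].
  rewrite scale_col_mx add_col_mx scaler0 addr0; apply/graph_N_P => j.
  have [pj qj pqj] := D j; rewrite !mxE andbT.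
  have [->|_] := eqVneq j i; last by rewrite !mulr0 addr0.
  rewrite mulr1 qi mulr0; split=> //; rewrite -lerBrDl sub0r.
  apply: le_trans (ltW sp); rewrite -[leRHS]mulr1 ler_wpM2l ?(ltW s0)//.
  by rewrite (le_trans (ler_norm e)).
apply/eqP; rewrite eq_le -oppr_le0 -[in X in _ && X]mulN1r -[X in X <= _]mul1r.
by rewrite !move_i// ?normrN normr1.
Qed.

Lemma dir_normal_gph_inactive (p q : 'cV[R]_l) w v i :
  dir_normal_cone (graph (@N_P R l)) (col_mx p q) w v ->
  p i 0 < 0 -> usubmx v i 0 = 0.
Proof.
move=> [t [u [v' [t0 tc uw v'v nv]]]] pi.
have pi' : 0 < - p i 0 by rewrite oppr_gt0.
have tu : (t k *: u k) (lshift l i) 0 @[k --> \oo] --> (0 : R).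
  have -> : (fun k => (t k *: u k) (lshift l i) 0) =
      (fun k => t k * u k (lshift l i) 0).
    by apply/funext => k; rewrite mxE.
  rewrite -(mul0r (w (lshift l i) 0)); apply: cvgM => //.
  exact: cvg_coord.
have vz : \forall k \near \oo, usubmx (v' k) i 0 = 0.
  move/cvgrPdist_lt : tu => /(_ _ pi'); apply: filterS => k.
  rewrite sub0r normrN ltr_norml => /andP[_ H].
  have := nv k; rewrite -[u k]vsubmxK scale_col_mx add_col_mx.
  move/regular_normal_gph_inactive; apply; rewrite !mxE.
  by rewrite mxE in H; rewrite -ltrBrDl sub0r.
have vi : usubmx (v' k) i 0 @[k --> \oo] --> (usubmx v i 0 : R).
  by apply: cvg_coord; exact: cvg_usubmx.
have v0 : usubmx (v' k) i 0 @[k --> \oo] --> (0 : R) by exact: cvg_near_cst.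
exact: (cvg_unique _ vi v0).
Qed.

End NormalsOfTarget.

(** * The two second-order conditions at the base point *)

Section SecondOrder.
Context {R : realType} {n1 n2 l : nat}.
Context (f : 'cV[R]_(n1 + n2) -> R) (F : 'cV[R]_(n1 + n2) -> 'cV[R]_n2)
  (psi : 'cV[R]_(n1 + n2) -> 'cV[R]_l) (z : 'cV[R]_(n1 + n2)).
Context (f_C2 : Ck 2 f) (F_C2 : Ck 2 F) (psi_C2 : Ck 2 psi)
  (jac_y_psi_C2 : Ck 2 (jac_y psi)).
Context (licq : forall ds : 'cV[R]_l,
     (jac_y psi z)^T *m ds = 0 -> plus_span (N_P (psi z)) ds -> ds = 0).
Context (eta : 'cV[R]_l) (N_eta : N_P (psi z) eta)
  (F_eta0 : 0 = F z + (jac_y psi z)^T *m eta).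

Let Phi := lifted f F psi.

Lemma lifted_at : Phi (col_mx z eta) =
  col_mx (const_mx (f z)) (col_mx 0 (col_mx (psi z) eta)).
Proof. by rewrite /Phi /lifted /lifted_eq !(col_mxKu, col_mxKd) -F_eta0. Qed.

Lemma derive_lifted_at d e : 'D_(col_mx d e) Phi (col_mx z eta) =
  col_mx (const_mx (dot (grad f z) d))
    (col_mx (jac (F_eta F psi eta) z *m d + (jac_y psi z)^T *m e)
      (col_mx (jac psi z *m d) e)).
Proof.
rewrite /Phi derive_lifted// derive_lifted_eq_col// !(col_mxKu, col_mxKd).
by rewrite (dot_grad _ (f_C2.1 z)) (jac_mulmx _ (psi_C2.1 z)).
Qed.

Lemma derive2_lifted_at d e :
  'D_(col_mx d e) ('D_(col_mx d e) Phi) (col_mx z eta) =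
  col_mx (const_mx (d2 f z d)) (col_mx (curvature F psi z eta d e)
    (col_mx (d2v psi z d) 0)).
Proof.
rewrite /Phi derive2_lifted// derive2_lifted_eq_col// !(col_mxKu, col_mxKd).
by rewrite d2E// d2vE.
Qed.

Lemma dot_lifted (alpha : R) b tau mu (a : R) b' t' m' :
  dot (col_mx (const_mx alpha : 'cV[R]_1) (col_mx (b : 'cV[R]_n2)
        (col_mx (tau : 'cV[R]_l) (mu : 'cV[R]_l))))
      (col_mx (const_mx a) (col_mx b' (col_mx t' m'))) =
  alpha * a + dot b b' + dot tau t' + dot mu m'.
Proof.
by rewrite !dot_col_mx !addrA [dot (const_mx _) _]/dot big_ord1 !mxE.
Qed.

(** The e-part of stationarity determines [mu]; with lambda = - b it is [jac_y psi z *m lambda], the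
    form in which the normal appears in the theorem. *)
Lemma stationaryP alpha b tau mu :
  (forall d e, alpha * dot (grad f z) d +
     dot b (jac (F_eta F psi eta) z *m d + (jac_y psi z)^T *m e) +
     dot tau (jac psi z *m d) + dot mu e = 0) <->
  alpha *: grad f z + (jac (F_eta F psi eta) z)^T *m b + (jac psi z)^T *m tau = 0 /\
  mu = - (jac_y psi z *m b).
Proof.
split=> [st|[st ->] d e].
  split; last first.
    apply: dot_ext => h; have := st 0 h.
    rewrite !mulmx0 !dot0r mulr0 !add0r addr0 dotNl dot_mulmx trmxK => /eqP.
    by rewrite addrC addr_eq0 => /eqP.
  apply: dot_ext => h; have := st h 0.
  rewrite mulmx0 addr0 !dot_mulmx [dot mu 0]dot0r addr0 dot0l => <-.
  by rewrite !dotDl dotZl.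
have H : alpha * dot (grad f z) d + dot ((jac (F_eta F psi eta) z)^T *m b) d +
    dot ((jac psi z)^T *m tau) d = 0.
  by rewrite -dotZl -!dotDl st dot0l.
by rewrite dotDr dotNl !dot_mulmx trmxK -[RHS]H; ring.
Qed.

Lemma jac_y_tr_mulmx (tau : 'cV[R]_l) : (jac psi z)^T *m tau = 0 -> (jac_y psi z)^T *m tau = 0.
Proof.
move=> Jt; apply: dot_ext => h; rewrite -dot_mulmx dot0l.
rewrite jac_y_mulmx// -(jac_mulmx _ (psi_C2.1 z)) dot_mulmx Jt.
exact: dot0l.
Qed.

Lemma second_order_necessary
    (psi_convex : forall (x : 'cV[R]_n1) (i : 'I_l),
     convex_function setT (fun y : 'cV[R]_n2 => psi (col_mx x y) i 0))
    d e :
  local_minimizer f (MPVI_feasible F psi) z ->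
  critical_direction f F psi z eta d e ->
  (forall (lambda : 'cV[R]_n2) (tau : 'cV[R]_l),
     (jac (F_eta F psi eta) z)^T *m lambda - (jac psi z)^T *m tau = 0 ->
     dir_normal_cone (graph (@N_P R l)) (col_mx (psi z) eta)
       (col_mx (jac psi z *m d) e) (col_mx tau (jac_y psi z *m lambda)) ->
     lambda = 0) ->
  exists (lambda : 'cV[R]_n2) (tau : 'cV[R]_l),
    [/\ dir_normal_cone (graph (@N_P R l)) (col_mx (psi z) eta)
          (col_mx (jac psi z *m d) e) (col_mx tau (jac_y psi z *m lambda)),
        grad f z - (jac (F_eta F psi eta) z)^T *m lambda
          + (jac psi z)^T *m tau = 0
      & d2 f z d - dot lambda (curvature F psi z eta d e)
          + dot tau (d2v psi z d) >= 0].
Proof.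
move=> [_ fmin] [df0 eq0 tang] cq; have gdir := tangent_gph_direction tang.
have w_E := derive_lifted_at d e; rewrite -eq0 in w_E.
pose u := col_mx z eta; pose x := col_mx d e; pose a : 'cV[R]_1 := const_mx (f z).
have aE : a 0 0 = f z by rewrite mxE.
have [|||y [y0 ny st so]] := @fritz_john2 R _ _ Phi (target (f z))
    (col_mx (const_mx 1) 0) u x (lifted_C2 f_C2 F_C2 psi_C2 jac_y_psi_C2)
    (@target_closed R l n2 (f z)).
- rewrite w_E lifted_at -/a -aE; apply: target_ray => //.
  by rewrite mxE.
(* A lifted point in the shifted target would give, by [KKT_feasible], a feasible point near z with
   an objective value strictly below f(z). *)
- have /nbhs_ballP[r /= r0 rP] := fmin; exists r => // v s vu s0.
  rewrite /Phi /lifted scale_col_mx scaler0 add_col_mx addr0.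
  move=> /targetE[fv eqv]; rewrite graphE => Nv.
  have vz : ball z r (usubmx v).
    rewrite -ball_normE/= distrC; apply: le_lt_trans vu.
    by rewrite -[in X in X <= _](col_mxKu z eta) -linearB norm_usubmx.
  have := rP _ vz (KKT_feasible psi_C2 psi_convex Nv eqv).
  apply/negP; rewrite -ltNge (lt_le_trans _ fv)// !mxE mulr1 ltrDl//.
- move=> r; rewrite w_E lifted_at -/a -aE; exact: target_conic.
have [alpha [b [tau [mu yE]]]] : exists alpha b tau mu,
    y = col_mx (const_mx alpha) (col_mx b (col_mx tau mu)).
  exists (usubmx y 0 0), (usubmx (dsubmx y)), (usubmx (dsubmx (dsubmx y))),
    (dsubmx (dsubmx (dsubmx y))).
  rewrite !vsubmxK -[LHS]vsubmxK; congr col_mx.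
  by apply/matrixP => i j; rewrite [RHS]mxE !ord1.
move: ny y0 st so; rewrite {y}yE => ny y0 st so.
have [] := target_dir_normal ny.
rewrite w_E lifted_at !(col_mxKu, col_mxKd) mxE => alpha0 nyD.
have [stz muE] : alpha *: grad f z + (jac (F_eta F psi eta) z)^T *m b +
    (jac psi z)^T *m tau = 0 /\ mu = - (jac_y psi z *m b).
  apply/stationaryP => h k; have := st (col_mx h k).
  by rewrite derive_lifted_at dot_lifted.
rewrite derive2_lifted_at dot_lifted dot0r addr0 in so.
have tau_inactive i : psi z i 0 != 0 -> tau i 0 = 0.
  move=> pi; have := dir_normal_gph_inactive nyD; rewrite col_mxKu; apply.
  by rewrite lt_neqAle pi; exact: N_eta.1.
have muE' : mu = jac_y psi z *m - b by rewrite mulmxN.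
rewrite {}muE' in nyD.
(* If alpha = 0 the qualification kills only [b]. Then the transposed Jacobian of psi annihilates
   [tau], which is supported on the active set, so nondegeneracy gives [tau] = 0 and the whole
   normal vanishes. *)
have [a0|a0] := eqVneq alpha 0.
  have b0 : b = 0.
    apply/eqP; rewrite -oppr_eq0; apply/eqP; apply: (cq _ tau) nyD.
    move: stz; rewrite a0 scale0r add0r mulmxN => /eqP; rewrite addr_eq0 => /eqP ->.
    by rewrite opprK subrr.
  have tau0 : tau = 0.
    apply: (licq_injective N_eta.1 licq tau_inactive).
    apply: jac_y_tr_mulmx.
    by move: stz; rewrite a0 b0 scale0r mulmx0 !add0r.
  by case: y0; rewrite a0 muE b0 tau0 mulmx0 oppr0 !col_mx0.
have a_gt0 : 0 < alpha by rewrite lt_neqAle eq_sym a0.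
have ai_gt0 : 0 < alpha^-1 by rewrite invr_gt0.
exists (- (alpha^-1 *: b)), (alpha^-1 *: tau); split.
- have := dir_normalZ ai_gt0 nyD.
  by rewrite scale_col_mx scalemxAr scalerN.
- have -> : grad f z = alpha^-1 *: (alpha *: grad f z).
    by rewrite scalerA mulVf// scale1r.
  by rewrite mulmxN opprK -!scalemxAr -!scalerDr stz scaler0.
- rewrite dotNl opprK !dotZl.
  have -> : d2 f z d = alpha^-1 * (alpha * d2 f z d) by rewrite mulrA mulVf// mul1r.
  by rewrite -!mulrDr mulr_ge0// ltW.
Qed.

Lemma second_order_absurd (S q v : R) : 0 < S -> 0 < q ->
  `|v - q / 2 * S| <= S / 8 * q -> v <= S / 8 * q -> False.
Proof.
move=> S0 q0; rewrite ler_norml => /andP[H _] H'.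
have Sq := mulr_gt0 S0 q0; lra.
Qed.

Definition second_order_condition := forall (d : 'cV[R]_(n1 + n2)) (e : 'cV[R]_l),
  d <> 0 -> critical_direction f F psi z eta d e ->
  exists (alpha : R) (lambda : 'cV[R]_n2) (tau : 'cV[R]_l),
    [/\ ~ (alpha = 0 /\ lambda = 0 /\ tau = 0),
        alpha >= 0,
        alpha *: grad f z - (jac (F_eta F psi eta) z)^T *m lambda
          + (jac psi z)^T *m tau = 0,
        regular_normal_cone
          (tangent_cone (graph (@N_P R l)) (col_mx (psi z) eta))
          (col_mx (jac psi z *m d) e)
          (col_mx tau (jac_y psi z *m lambda))
      & alpha * d2 f z d - dot lambda (curvature F psi z eta d e)
          + dot tau (d2v psi z d) > 0].

(** The multiplier of the limit direction annihilates the first derivative of the lifted map, so by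
    Taylor its pairing with the increment is at least (1/2 - 1/8) S t^2. The growth bounds and the
    normal cone condition make it at most S t^2 / 8. *)
Lemma second_order_sequence (t : nat -> R) (x_ : nat -> 'cV[R]_(n1 + n2 + l))
    (x : 'cV[R]_(n1 + n2 + l)) (b : nat -> R) :
  second_order_condition ->
  (forall k, 0 < t k) -> t @ \oo --> 0 -> x_ @ \oo --> x -> x <> 0 ->
  b @ \oo --> 0 ->
  (forall k, let u := col_mx z eta + t k *: x_ k in
     [/\ f (usubmx u) - f z <= b k * t k ^+ 2,
         `|lifted_eq F psi u| <= b k * t k ^+ 2
       & graph (@N_P R l) (col_mx (psi (usubmx u)) (dsubmx u))]) -> False.
Proof.
move=> sosc t0 tc xc x0 bc uP.
pose u := col_mx z eta; pose d := usubmx x; pose e := dsubmx x.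
have xE : x = col_mx d e by rewrite vsubmxK.
have Phi_C2 := lifted_C2 f_C2 F_C2 psi_C2 jac_y_psi_C2.
pose K k := (t k)^-1 *: (Phi (u + t k *: x_ k) - Phi u).
have Kc : K @ \oo --> 'D_x Phi u by exact: cvg_diff_quotient (Phi_C2.1 u) t0 tc xc.
have btc : (fun k => b k * t k) @ \oo --> 0.
  by rewrite -(mulr0 0); exact: cvgM.
have PhiE v : Phi v = col_mx (const_mx (f (usubmx v)))
  (col_mx (lifted_eq F psi v) (col_mx (psi (usubmx v)) (dsubmx v))) by [].
have Phiu := lifted_at; rewrite -/u in Phiu.
have DPhi := derive_lifted_at d e.
rewrite -xE -/u in DPhi.
have KE k : K k = col_mx (const_mx ((t k)^-1 * (f (usubmx (u + t k *: x_ k)) - f z)))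
   (col_mx ((t k)^-1 *: lifted_eq F psi (u + t k *: x_ k))
     ((t k)^-1 *: (col_mx (psi (usubmx (u + t k *: x_ k)))
        (dsubmx (u + t k *: x_ k)) - col_mx (psi z) eta))).
  rewrite /K PhiE Phiu !(opp_col_mx, add_col_mx, scale_col_mx) subr0.
  congr col_mx; apply/matrixP => i j; by rewrite !mxE.
pose kap k := dsubmx (dsubmx (K k)).
have kapc : kap @ \oo --> col_mx (jac psi z *m d) e.
  have := cvg_dsubmx (cvg_dsubmx Kc); rewrite DPhi !col_mxKd; exact.
have kapE k : col_mx (psi z) eta + t k *: kap k =
    col_mx (psi (usubmx (u + t k *: x_ k))) (dsubmx (u + t k *: x_ k)).
  by rewrite /kap KE !col_mxKd scalerA divff ?gt_eqF// scale1r addrC subrK.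
have kapD k : graph (@N_P R l) (col_mx (psi z) eta + t k *: kap k).
  by rewrite kapE; have [] := uP k.
have crit : critical_direction f F psi z eta d e.
  split.
  - have fc : (usubmx (K k) 0 0 : R) @[k --> \oo] --> dot (grad f z) d.
      have <- : usubmx ('D_x Phi u) 0 0 = dot (grad f z) d.
        by rewrite DPhi col_mxKu mxE.
      by apply: cvg_coord; exact: cvg_usubmx.
    rewrite -oppr_ge0; apply: (cvg_ge0_approx (cvgN fc) btc) => k.
    rewrite lerN2 KE col_mxKu mxE ler_pdivrMl// mulrCA -expr2.
    by have [] := uP k.
  - have := cvg_usubmx (cvg_dsubmx Kc); rewrite DPhi col_mxKd col_mxKu => Hc.
    have H0 : usubmx (dsubmx (K k)) @[k --> \oo] --> (0 : 'cV[R]_n2).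
      apply/norm_cvg0P; apply: squeeze_cvgr (cvg_cst 0) btc.
      near=> k; rewrite normr_ge0/= KE col_mxKd col_mxKu normrZ normfV gtr0_norm//.
      by rewrite ler_pdivrMl// mulrCA -expr2; have [] := uP k.
    exact: (cvg_unique _ H0 Hc).
  - by exists t, kap.
(* If d = 0, the linearised equation reduces to J^T e = 0 with J the partial Jacobian [jac_y psi z].
   Tangency forces e to vanish on inactive coordinates, so e = 0 by nondegeneracy, against x <>
   0. *)
have d0 : d <> 0.
  move=> d0; apply: x0; rewrite xE d0.
  have [_ E tang] := crit; have gdir := tangent_gph_direction tang.
  suff -> : e = 0 by rewrite col_mx0.
  apply: (licq_injective N_eta.1 licq) => [i pi|].
    by have [_ _ [[p0 _]|[_ ->//]]] := gdir i; rewrite p0 eqxx in pi.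
  by rewrite E d0 mulmx0 add0r.
have [alpha [lam [tau [_ alpha0 st nv pos]]]] := sosc d e d0 crit.
pose yD := col_mx tau (jac_y psi z *m lam).
pose y := col_mx (const_mx alpha : 'cV[R]_1) (col_mx (- lam) yD).
have /stationaryP st' : alpha *: grad f z + (jac (F_eta F psi eta) z)^T *m (- lam) +
    (jac psi z)^T *m tau = 0 /\ jac_y psi z *m lam = - (jac_y psi z *m - lam).
  by rewrite !mulmxN opprK.
have yst v : dot y ('D_v Phi u) = 0.
  by rewrite -[v]vsubmxK /u derive_lifted_at// dot_lifted; exact: st'.
pose S := alpha * d2 f z d - dot lam (curvature F psi z eta d e) + dot tau (d2v psi z d).
have yS : dot y ('D_x ('D_x Phi) u) = S.
  by rewrite xE /u derive2_lifted_at// dot_lifted dot0r addr0 dotNl.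
pose M : R := (1 + (n2 + (l + l)))%:R * `|y|.
have M0 : 0 < M + 1 by rewrite ltr_wpDl// mulr_ge0.
have e0 : 0 < S / 8 / (M + 1) by rewrite !divr_gt0.
have [r r0 rP] := taylor2 u x Phi_C2 e0.
have [r' r'0 r'P] := regular_normal_tangent_gph N_eta nv.
pose A := alpha + n2%:R * `|lam|.
have A0 : 0 <= A by rewrite addr_ge0// mulr_ge0.
have Sb : 0 < S / 8 / (A + 1) by rewrite !divr_gt0// ltr_wpDl.
near \oo => k.
have tr : 0 < t k < r.
  rewrite t0; near: k; move/cvgrPdist_lt : tc => /(_ r r0); apply: filterS => k.
  by rewrite sub0r normrN gtr0_norm.
have tr' : 0 < t k < r'.
  rewrite t0; near: k; move/cvgrPdist_lt : tc => /(_ r' r'0); apply: filterS => k.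
  by rewrite sub0r normrN gtr0_norm.
have xr : `|x_ k - x| < r.
  by near: k; move/cvgrPdist_lt : xc => /(_ r r0); apply: filterS => k; rewrite distrC.
have kr' : `|kap k - col_mx (jac psi z *m d) e| < r'.
  near: k; move/cvgrPdist_lt : kapc => /(_ r' r'0); apply: filterS => k.
  by rewrite distrC.
have bk : b k < S / 8 / (A + 1).
  near: k; move/cvgrPdist_lt : bc => /(_ _ Sb); apply: filterS => k.
  by rewrite sub0r normrN; apply: le_lt_trans; exact: ler_norm.
have tt0 : 0 < t k ^+ 2 by rewrite exprn_gt0.
apply: (second_order_absurd (v := dot y (Phi (u + t k *: x_ k) - Phi u)) pos tt0).
  have -> : dot y (Phi (u + t k *: x_ k) - Phi u) - t k ^+ 2 / 2 * S =
      dot y (Phi (u + t k *: x_ k) - Phi u - t k *: 'D_(x_ k) Phi u -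
        (t k ^+ 2 / 2) *: 'D_x ('D_x Phi) u).
    by rewrite [RHS]dotBr (dotBr y _ (t k *: _)) !dotZr yst yS mulr0 subr0.
  apply: (le_trans (dot_bound _ _)); rewrite -/M.
  apply: (@le_trans _ _ (M * (S / 8 / (M + 1) * t k ^+ 2))).
    by rewrite ler_wpM2l ?mulr_ge0//; exact: rP tr xr.
  by rewrite mulrA ler_wpM2r ?ratio_le ?mulr_ge0 ?divr_ge0// ltW.
have [fk Hk _] := uP k; rewrite -/u in fk Hk.
have -> : Phi (u + t k *: x_ k) - Phi u = t k *: K k.
  by rewrite /K scalerA divff ?gt_eqF// scale1r.
rewrite KE !scale_col_mx !scalerA divff ?gt_eqF// !scale1r dot_col_mx dot_col_mx.
(* Exact nonpositivity, without an o(t^2) term, holds thanks to [regular_normal_tangent_gph]; a mere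
   regular normal inequality would leave an error of order o(t). *)
have kapk : dot yD (col_mx (psi (usubmx (u + t k *: x_ k)))
    (dsubmx (u + t k *: x_ k)) - col_mx (psi z) eta) <= 0.
  rewrite -kapE addrAC subrr add0r dotZr pmulr_rle0//.
  have := r'P (t k) (usubmx (kap k)) (dsubmx (kap k)) tr'.
  by rewrite vsubmxK => /(_ kr' (kapD k)).
have lamk : dot (- lam) (lifted_eq F psi (u + t k *: x_ k)) <=
    n2%:R * `|lam| * (b k * t k ^+ 2).
  apply: (le_trans (ler_norm _)); apply: (le_trans (dot_bound _ _)).
  by rewrite normrN ler_wpM2l// mulr_ge0.
have alk : dot (const_mx alpha : 'cV[R]_1) (t k *: const_mx
    ((t k)^-1 * (f (usubmx (u + t k *: x_ k)) - f z))) <= alpha * (b k * t k ^+ 2).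
  rewrite /dot big_ord1 !mxE mulVKf ?gt_eqF//.
  by rewrite ler_wpM2l.
apply: (le_trans (lerD alk (lerD lamk kapk))); rewrite addr0 -mulrDl -/A mulrA.
rewrite ler_wpM2r ?(ltW tt0)//.
apply: (le_trans (ler_wpM2l A0 (ltW bk))); apply: ratio_le => //.
by rewrite divr_ge0// ltW.
Unshelve. all: by end_near. Qed.

(** No bound on [etas] is assumed. Inactive constraints stay inactive near z, so the difference to
    [eta] is eventually supported on the active set and B recovers it; the error from moving the
    Jacobian is at most half that difference and is absorbed. *)
Lemma multiplier_cvg (zs : nat -> 'cV[R]_(n1 + n2)) (etas : nat -> 'cV[R]_l) :
  zs @ \oo --> z -> (forall k, N_P (psi (zs k)) (etas k)) ->
  lifted_eq F psi (col_mx (zs k) (etas k)) @[k --> \oo] --> (0 : 'cV[R]_n2) ->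
  etas @ \oo --> eta.
Proof.
move=> zc Nk Lc; have [B BP] := active_left_inverse N_eta.1 licq.
pose g k := lifted_eq F psi (col_mx (zs k) (etas k)) - F_eta F psi eta (zs k).
have Gc : continuous (F_eta F psi eta).
  by move=> x; apply: differentiable_continuous; exact: (F_eta_C2 F_C2 jac_y_psi_C2 eta).1.
have gc : g @ \oo --> (0 : 'cV[R]_n2).
  rewrite -[0 in X in _ --> X]subr0; apply: cvgB => //.
  rewrite [X in _ --> X](_ : _ = F_eta F psi eta z); last by rewrite /F_eta -F_eta0.
  exact: (cvg_comp _ _ zc (Gc z)).
have cJ : continuous (jac_y psi).
  by move=> x; apply: differentiable_continuous; exact: jac_y_psi_C2.1.
have Jc : jac_y psi (zs k) @[k --> \oo] --> jac_y psi z.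
  exact: (cvg_comp _ _ zc (cJ z)).
have cpsi : continuous psi.
  by move=> x; apply: differentiable_continuous; exact: psi_C2.1.
have psic : psi (zs k) @[k --> \oo] --> psi z by exact: (cvg_comp _ _ zc (cpsi z)).
have pneg : \forall k \near \oo, forall i, psi z i 0 != 0 -> psi (zs k) i 0 < 0.
  apply: (@filter_forall _ _ (fun i k => psi z i 0 != 0 -> psi (zs k) i 0 < 0) \oo) => i.
  have [_|pi] := eqVneq (psi z i 0) 0; first exact: nearW.
  have pi0 : 0 < - psi z i 0.
    by rewrite oppr_gt0 lt_neqAle pi; exact: N_eta.1.
  move/cvgrPdist_lt : psic => /(_ _ pi0); apply: filterS => k H _.
  have := le_lt_trans (norm_coord _ i) H; rewrite !mxE ltr_norml => /andP[+ _].
  by rewrite opprK ltrDl oppr_gt0.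
pose c : R := n2%:R * `|B|; have c0 : 0 <= c by rewrite mulr_ge0.
pose c' : R := c * l%:R; have c'0 : 0 <= c' by rewrite mulr_ge0.
apply/cvgrPdist_le => e e0.
have d1 : 0 < e / 2 / (c + 1) by rewrite !divr_gt0// ltr_wpDl.
have d2 : 0 < 2^-1 / (c' + 1) :> R by rewrite divr_gt0 ?invr_gt0// ltr_wpDl.
near=> k; rewrite distrC; set a := etas k - eta.
have a_active i : psi z i 0 != 0 -> a i 0 = 0.
  move=> pi; rewrite !mxE (N_P_inactive N_eta pi) subr0.
  apply: (N_P_inactive (Nk k)); rewrite lt_eqF//.
  by move: i pi; near: k.
have ga : (jac_y psi z)^T *m a = g k + (jac_y psi z - jac_y psi (zs k))^T *m a.
  have -> : g k = (jac_y psi (zs k))^T *m a.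
    rewrite /g /lifted_eq /F_eta col_mxKu col_mxKd opprD addrACA subrr add0r.
    by rewrite -mulmxBr.
  have -> : (jac_y psi z - jac_y psi (zs k))^T =
      (jac_y psi z)^T - (jac_y psi (zs k))^T by rewrite linearB.
  by rewrite mulmxBl addrC subrK.
have gk : `|g k| <= e / 2 / (c + 1).
  near: k; move/cvgrPdist_le : gc => /(_ _ d1); apply: filterS => k.
  by rewrite sub0r normrN.
have Jk : `|jac_y psi z - jac_y psi (zs k)| <= 2^-1 / (c' + 1).
  by near: k; move/cvgrPdist_le : Jc => /(_ _ d2).
have H1 := norm_mulmx B ((jac_y psi z)^T *m a); rewrite BP// -/c in H1.
have H2 : `|(jac_y psi z)^T *m a| <=
    e / 2 / (c + 1) + l%:R * (2^-1 / (c' + 1)) * `|a|.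
  rewrite ga; apply: (le_trans (ler_normD _ _)); rewrite lerD//.
  apply: (le_trans (norm_mulmx _ _)); rewrite ler_wpM2r// ler_wpM2l//.
  exact: le_trans (norm_trmx _) Jk.
have {H1 H2} := le_trans H1 (ler_wpM2l c0 H2).
have -> : c * (e / 2 / (c + 1) + l%:R * (2^-1 / (c' + 1)) * `|a|) =
    c * (e / 2 / (c + 1)) + c' * (2^-1 / (c' + 1)) * `|a|.
  by rewrite mulrDr; congr (_ + _); rewrite !mulrA.
move=> H.
have H3 := ratio_le c0 (ltW (divr_gt0 e0 (ltr0Sn R 1))).
have H4 := ler_wpM2r (normr_ge0 a) (ratio_le c'0 (ltW (_ : 0 < 2^-1 :> R))).
have {}H4 : c' * (2^-1 / (c' + 1)) * `|a| <= 2^-1 * `|a| by apply: H4; rewrite invr_gt0.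
have {H H3 H4} := le_trans H (lerD H3 H4).
move: (`|a|) => y; lra.
Unshelve. all: by end_near. Qed.

(** Negates quadratic growth with beta = delta = e. The first point violates growth; the second,
    with its multiplier, comes from a near-projection onto [MPVI_Omega]. *)
Lemma violating_point (e : R) : 0 < e ->
  ~ essential_local_minimizer2 f (MPVI_phi F) (MPVI_Omega psi) z ->
  exists p : 'cV[R]_(n1 + n2) * ('cV[R]_(n1 + n2) * 'cV[R]_l),
    let r := enorm (p.1 - z) in
    [/\ 0 < r <= e, f p.1 - f z <= e * r ^+ 2, `|p.1 - p.2.1| <= e * r ^+ 2,
        `|F p.1 + (jac_y psi p.2.1)^T *m p.2.2| <= e * r ^+ 2
      & N_P (psi p.2.1) p.2.2].
Proof.
move=> e0 nmin; apply: contrapT => np; apply: nmin.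
exists e, e; split=> // z' z'e; rewrite leNgt; apply/negP.
set r := enorm (z' - z); rewrite gt_max => /andP[fz' dz'].
have r0 : 0 < r.
  rewrite lt_neqAle enorm_ge0 andbT eq_sym; apply/eqP => r0.
  have : z' - z = 0 by apply: dot_eq0; rewrite -sqr_enorm -/r r0 expr0n.
  by move/subr0_eq => zz'; move: fz'; rewrite r0 expr0n mulr0 zz' subrr ltxx.
have [|w [z'' [eta'' [D ->]]]] := dist_lt _ dz'.
  by exists (col_mx z ((jac_y psi z)^T *m eta)), z, eta; rewrite graphE.
rewrite /MPVI_phi opp_col_mx add_col_mx => /ltW H.
have {}H := le_trans (norm_le_enorm _) H; apply: np.
exists (z', (z'', eta'')); split => //=.
- by rewrite r0.
- exact: ltW.
- by apply: le_trans H; rewrite -[X in `|X| <= _](col_mxKu _ (- F z' - (jac_y psi z'')^T *m eta'')) norm_usubmx.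
- apply: le_trans H; rewrite -normrN opprD.
  by rewrite -[X in `|X| <= _](col_mxKd (z' - z'')) norm_dsubmx.
- by rewrite graphE in D.
Qed.

Lemma second_order_sufficient : second_order_condition ->
  essential_local_minimizer2 f (MPVI_phi F) (MPVI_Omega psi) z.
Proof.
move=> sosc; apply: contrapT => nmin.
pose N : R := (n1 + n2)%:R; have N0 : 0 <= N by rewrite ler0n.
pose h v : 'cV[R]_(1 + n2) := col_mx (const_mx (f v)) (F v).
have [L [dL [L0 dL0 hL]]] : exists L d, [/\ 0 < L, 0 < d & forall u v,
    `|u - z| < d -> `|v - z| < d -> `|h u - h v| <= L * `|u - v|].
  apply: Ck1_lipschitz; apply: Ck_col_mx; last exact: CkS.
  exact: (Ck_const_mx (CkS f_C2)).
(* The first bound gives [r k] <= 1 and makes the displacement to [zs k] cost at most r / 2 in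
   [rzs]; the second keeps both points inside the Lipschitz ball. *)
pose kappa := Num.min (2 * (N + 1))^-1 (dL / 4).
have kappa0 : 0 < kappa.
  by rewrite lt_min invr_gt0 mulr_gt0 ?ltr_wpDl//= divr_gt0.
pose ep (k : nat) : R := k.+1%:R^-1 * kappa.
have ep0 k : 0 < ep k by rewrite mulr_gt0// invr_gt0.
have ep_kappa k : ep k <= kappa.
  by rewrite ler_piMl ?(ltW kappa0)// invf_le1 ?ler1n.
have epc : ep @ \oo --> 0.
  by rewrite -(mul0r kappa); apply: cvgMr_tmp; exact: cvg_harmonic.
have /choice[p pP] k := violating_point (ep0 k) nmin.
pose zs k := (p k).2.1; pose etas k := (p k).2.2; pose r k := enorm ((p k).1 - z).
have r0 k : 0 < r k by have [/andP[]] := pP k.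
have r_ep k : r k <= ep k by have [/andP[]] := pP k.
have kN : kappa <= (2 * (N + 1))^-1 by rewrite ge_min lexx.
have kd : kappa <= dL / 4 by rewrite ge_min lexx orbT.
have k1 : kappa <= 1.
  by rewrite (le_trans kN)// invf_le1 ?mulr_gt0 ?ltr_wpDl// mulr_ege1 ?ler1n// lerDr.
have r1 k : r k <= 1 by rewrite (le_trans (r_ep k))// (le_trans (ep_kappa k)).
have pz k : `|(p k).1 - z| <= r k by exact: norm_le_enorm.
have pzs k : `|(p k).1 - zs k| <= ep k * r k ^+ 2 by have [] := pP k.
have er k : ep k * r k ^+ 2 <= ep k.
  by rewrite ler_piMr ?(ltW (ep0 k))// expr_le1 ?(ltW (r0 k)).
have zsz k : `|zs k - z| <= ep k + ep k.
  rewrite -(subrKA (p k).1); apply: (le_trans (ler_normD _ _)).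
  by rewrite lerD// ?(le_trans (pz k))// distrC (le_trans (pzs k)).
have rzs k : r k <= 2 * N * `|zs k - z|.
  have H1 := enorm_le_norm ((p k).1 - z); rewrite -/(r k) -/N in H1.
  have H2 : `|(p k).1 - z| <= ep k * r k ^+ 2 + `|zs k - z|.
    rewrite -(subrKA (zs k)); apply: (le_trans (ler_normD _ _)).
    by rewrite lerD2r.
  have H3 : N * (ep k * r k ^+ 2) <= r k / 2.
    apply: (@le_trans _ _ (N * (2^-1 / (N + 1)) * r k)).
      rewrite -mulrA ler_wpM2l// ler_pM ?(ltW (ep0 k)) ?sqr_ge0//.
        by rewrite (le_trans (ep_kappa k))// -invfM.
      by rewrite expr2 ler_piMr// ltW.
    by rewrite [leRHS]mulrC ler_wpM2r ?(ltW (r0 k))// ratio_le// invr_ge0.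
  have := le_trans H1 (ler_wpM2l N0 H2); rewrite mulrDr => H4.
  rewrite -mulrA; move: H3 H4.
  by move: (N * (ep k * r k ^+ 2)) (N * `|zs k - z|) => A B; lra.
have zsc : zs @ \oo --> z.
  apply/cvgrPdist_le => e e0; near=> k; rewrite distrC (le_trans (zsz k))//.
  have : ep k <= e / 2.
    near: k; move/cvgrPdist_le : epc => /(_ _ (divr_gt0 e0 (ltr0Sn R 1))).
    by apply: filterS => k; rewrite sub0r normrN; apply: le_trans; exact: ler_norm.
  by move: (ep k) => y; lra.
have hk k : `|h (zs k) - h (p k).1| <= L * (ep k * r k ^+ 2).
  apply: (@le_trans _ _ (L * `|zs k - (p k).1|)); last first.
    by rewrite ler_wpM2l ?(ltW L0)// distrC.
  apply: hL; first (apply: (le_lt_trans (zsz k)); have := ep_kappa k).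
    by move: (ep k) => y; lra.
  apply: (le_lt_trans (pz k)); apply: (le_lt_trans (r_ep k)).
  by have := ep_kappa k; move: (ep k) => y; lra.
pose U k := col_mx (zs k) (etas k); pose u := col_mx z eta.
(* Normalising by the distance in (z, eta) jointly makes the rescaled directions unit vectors, so
   their limit is nonzero. As r <= 2 N t by [rzs], errors of order r^2 are also of order t^2. *)
pose t k := `|U k - u|.
have t_zs k : `|zs k - z| <= t k.
  by rewrite -[zs k](col_mxKu _ (etas k)) -{1}[z](col_mxKu _ eta) -linearB norm_usubmx.
have t0 k : 0 < t k.
  have := lt_le_trans (r0 k) (rzs k); rewrite pmulr_rgt0.
    by move=> /lt_le_trans; apply.
  rewrite mulr_gt0// lt_neqAle N0 andbT eq_sym; apply/eqP => N_0.
  by have := lt_le_trans (r0 k) (rzs k); rewrite N_0 mulr0 mul0r ltxx.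
pose b k := (L + 1) * (2 * N) ^+ 2 * ep k.
have bc : b @ \oo --> 0.
  by rewrite -(mulr0 ((L + 1) * (2 * N) ^+ 2)); exact: cvgMl_tmp.
have bP k : (L + 1) * (ep k * r k ^+ 2) <= b k * t k ^+ 2.
  have -> : b k * t k ^+ 2 = (L + 1) * (ep k * (2 * N * t k) ^+ 2).
    by rewrite /b exprMn; ring.
  rewrite ler_wpM2l ?addr_ge0 ?(ltW L0)// ler_wpM2l ?(ltW (ep0 k))//.
  rewrite ler_sqr ?nnegrE ?(ltW (r0 k))//.
    by apply: (le_trans (rzs k)); rewrite ler_wpM2l// mulr_ge0.
  by rewrite !mulr_ge0// ltW.
have fU k : f (zs k) - f z <= b k * t k ^+ 2.
  apply: le_trans (bP k); have [_ fp _ _ _] := pP k; rewrite -/(r k) in fp.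
  have := le_trans (norm_coord _ (lshift n2 0)) (hk k).
  rewrite opp_col_mx add_col_mx col_mxEu !mxE => /(le_trans (ler_norm _)) H.
  by rewrite mulrDl mul1r -(subrKA (f (p k).1)) lerD.
have HU0 k : `|lifted_eq F psi (U k)| <= (L + 1) * (ep k * r k ^+ 2).
  have [_ _ _ Fp _] := pP k; rewrite -/(r k) -/(zs k) -/(etas k) in Fp.
  rewrite /lifted_eq /U col_mxKu col_mxKd.
  rewrite -[F (zs k)](subrK (F (p k).1)) -addrA; apply: (le_trans (ler_normD _ _)).
  rewrite mulrDl mul1r lerD//; apply: le_trans (hk k).
  rewrite /h opp_col_mx add_col_mx.
  by rewrite -[X in `|X| <= _](col_mxKd (const_mx (f (zs k)) - const_mx (f (p k).1)
    : 'cV[R]_1)) norm_dsubmx.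
have HU k : `|lifted_eq F psi (U k)| <= b k * t k ^+ 2.
  exact: le_trans (HU0 k) (bP k).
have NU k : N_P (psi (zs k)) (etas k) by have [] := pP k.
have etac : etas @ \oo --> eta.
  apply: (multiplier_cvg zsc NU).
  apply/norm_cvg0P; apply: (@squeeze_cvgr _ _ _ _ (fun=> 0) (fun k => (L + 1) * ep k)).
  - near=> k; rewrite normr_ge0/=; apply: (le_trans (HU0 k)).
    by rewrite ler_wpM2l// addr_ge0// ltW.
  - exact: cvg_cst.
  - by rewrite -(mulr0 (L + 1)); exact: cvgMl_tmp.
have Uc : t @ \oo --> 0.
  have dist0 m (w : nat -> 'cV[R]_m) (a : 'cV[R]_m) : w @ \oo --> a ->
      `|w k - a| @[k --> \oo] --> (0 : R).
    move=> /cvgrPdist_le wa; apply/cvgrPdist_le => e /wa; apply: filterS => k.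
    by rewrite sub0r normrN normr_id distrC.
  have d0 : `|zs k - z| + `|etas k - eta| @[k --> \oo] --> (0 : R).
    by rewrite -(addr0 0); apply: cvgD; exact: dist0.
  apply: (@squeeze_cvgr _ _ _ _ (fun=> 0) _ _ _ _ _ d0); last exact: cvg_cst.
  near=> k; rewrite normr_ge0/= /t /U /u opp_col_mx add_col_mx.
  apply: norm_le_coord => [|i]; first by rewrite addr_ge0.
  case: (split_ordP i) => j ->.
    by rewrite col_mxEu (le_trans (norm_coord _ _))// lerDl.
  by rewrite col_mxEd (le_trans (norm_coord _ _))// lerDr.
have xk1 k : `|(t k)^-1 *: (U k - u)| = 1.
  by rewrite normrZ normfV ger0_norm ?mulVf ?gt_eqF// ltW.
have [|x [s [ks sx]]] := @bolzano_weierstrass _ _ (fun k => (t k)^-1 *: (U k - u)) 1.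
  by move=> k; rewrite xk1.
apply: (second_order_sequence (t := t \o s) (b := b \o s) sosc _ _ sx).
- by move=> k /=.
- exact: cvg_subseq.
- move=> x0; rewrite x0 in sx; move/cvgrPdist_lt : sx => /(_ 1 ltr01)[k _ H].
  by have := H k (leqnn k); rewrite /= sub0r normrN xk1 ltxx.
- exact: cvg_subseq.
- move=> k /=.
  have -> : col_mx z eta + t (s k) *: ((t (s k))^-1 *: (U (s k) - u)) = U (s k).
    by rewrite scalerA divff ?gt_eqF// scale1r addrC subrK.
  split; first by rewrite col_mxKu; exact: fU.
    exact: HU.
  by rewrite col_mxKu col_mxKd graphE; exact: NU.
Unshelve. all: by end_near. Qed.

End SecondOrder.

Theorem theorem6p1 (R : realType) (n1 n2 l : nat)
  (f : 'cV[R]_(n1 + n2) -> R) (F : 'cV[R]_(n1 + n2) -> 'cV[R]_n2)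
  (psi : 'cV[R]_(n1 + n2) -> 'cV[R]_l) (zbar : 'cV[R]_(n1 + n2))
  (f_C2 : Ck 2 f) (F_C2 : Ck 2 F) (psi_C2 : Ck 2 psi)
  (jac_y_psi_C2 : Ck 2 (jac_y psi))
  (zbar_feasible : MPVI_feasible F psi zbar)
  (psi_convex : forall (x : 'cV[R]_n1) (i : 'I_l),
     convex_function setT (fun y : 'cV[R]_n2 => psi (col_mx x y) i 0))
  (psi_nondegenerate : forall ds : 'cV[R]_l,
     (jac_y psi zbar)^T *m ds = 0 -> plus_span (N_P (psi zbar)) ds -> ds = 0) :
  (exists! eta : 'cV[R]_l,
     N_P (psi zbar) eta /\ 0 = F zbar + (jac_y psi zbar)^T *m eta) /\
  (forall eta : 'cV[R]_l,
     N_P (psi zbar) eta -> 0 = F zbar + (jac_y psi zbar)^T *m eta ->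
     (local_minimizer f (MPVI_feasible F psi) zbar ->
      forall (d : 'cV[R]_(n1 + n2)) (e : 'cV[R]_l),
      critical_direction f F psi zbar eta d e ->
      (forall (lambda : 'cV[R]_n2) (tau : 'cV[R]_l),
         (jac (F_eta F psi eta) zbar)^T *m lambda
           - (jac psi zbar)^T *m tau = 0 ->
         dir_normal_cone (graph (@N_P R l)) (col_mx (psi zbar) eta)
           (col_mx (jac psi zbar *m d) e)
           (col_mx tau (jac_y psi zbar *m lambda)) ->
         lambda = 0) ->
      exists (lambda : 'cV[R]_n2) (tau : 'cV[R]_l),
        [/\ dir_normal_cone (graph (@N_P R l)) (col_mx (psi zbar) eta)
              (col_mx (jac psi zbar *m d) e)
              (col_mx tau (jac_y psi zbar *m lambda)),
            grad f zbar - (jac (F_eta F psi eta) zbar)^T *m lambda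
              + (jac psi zbar)^T *m tau = 0
          & d2 f zbar d - dot lambda (curvature F psi zbar eta d e)
              + dot tau (d2v psi zbar d) >= 0]) /\
     ((forall (d : 'cV[R]_(n1 + n2)) (e : 'cV[R]_l),
         d <> 0 -> critical_direction f F psi zbar eta d e ->
         exists (alpha : R) (lambda : 'cV[R]_n2) (tau : 'cV[R]_l),
           [/\ ~ (alpha = 0 /\ lambda = 0 /\ tau = 0),
               alpha >= 0,
               alpha *: grad f zbar
                 - (jac (F_eta F psi eta) zbar)^T *m lambda
                 + (jac psi zbar)^T *m tau = 0,
               regular_normal_cone
                 (tangent_cone (graph (@N_P R l)) (col_mx (psi zbar) eta))
                 (col_mx (jac psi zbar *m d) e)
                 (col_mx tau (jac_y psi zbar *m lambda))
             & alpha * d2 f zbar d - dot lambda (curvature F psi zbar eta d e)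
                 + dot tau (d2v psi zbar d) > 0]) ->
      essential_local_minimizer2 f (MPVI_phi F) (MPVI_Omega psi) zbar)).
Proof.
have z_feasible : nonpos_orthant (psi zbar).
  by have := zbar_feasible.1; rewrite /Gamma/= vsubmxK.
split=> [|eta N_eta F_eta0].
  have [eta [N_eta F_eta0]] :=
    multiplier_exists psi_C2 z_feasible psi_nondegenerate zbar_feasible.
  exists eta; split=> // eta' [N_eta' F_eta'].
  exact: (multiplier_unique z_feasible psi_nondegenerate N_eta N_eta' F_eta0 F_eta').
split=> [zmin d e crit cq|sosc].
  exact: (second_order_necessary f_C2 F_C2 psi_C2 jac_y_psi_C2
    psi_nondegenerate N_eta F_eta0 psi_convex zmin crit cq).
exact: (second_order_sufficient f_C2 F_C2 psi_C2 jac_y_psi_C2 psi_nondegenerate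
  N_eta F_eta0 sosc).
Qed.
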